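(* Let $f\in L^2(0,L;\mathbb{R}^3)$ with $\int_0^Lf\,dx_1=0$, let $h(t)=\int_0^tf(x_1)\,dx_1$ for $t\in(0,L)$, and let $$\mathcal{J}^{(2)}(u,D)=\frac12\int_0^LQ^*(A(x_1),0)\,dx_1+\int_0^Lh\cdot u'\,dx_1\qquad\text{for }(u,D)\in\mathcal{A}^{(2)},$$ where $R=(u'|D)$, $A=R^TR'\in L^2(0,L;\mathbb{R}^{3\times3}_{\mathrm{skew}})$ and $$\mathcal{A}^{(2)}=\{(u,D)\in H^2(0,L;\mathbb{R}^3)\times H^1(0,L;\mathbb{R}^{3\times2}):(u'|D)\in\mathrm{SO}(3)\text{ a.e. in }(0,L)\}.$$ Then $(u,D)\in\mathcal{A}^{(2)}$ is a stationary point of $\mathcal{J}^{(2)}$ if and only if $$\begin{aligned}\hat M_{11}'-\hat M_{22}'&=A_{13}(\check M_{21}-\hat M_{31})-A_{23}(\check M_{11}-\check M_{33})-h\cdot De_1,\\ \check M_{11}'-\check M_{33}'&=-A_{12}(\check M_{21}-\hat M_{31})+A_{23}(\hat M_{11}-\hat M_{22})-h\cdot De_2,\\ \check M_{21}'-\hat M_{31}'&=A_{12}(\check M_{11}-\check M_{33})-A_{13}(\hat M_{11}-\hat M_{22})\end{aligned}$$ and $$\begin{aligned}\hat M_{11}(0)-\hat M_{22}(0)&=\hat M_{11}(L)-\hat M_{22}(L)=0,\\ \check M_{11}(0)-\check M_{33}(0)&=\check M_{11}(L)-\check M_{33}(L)=0,\\ \check M_{21}(0)-\hat M_{31}(0)&=\check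 M_{21}(L)-\hat M_{31}(L)=0,\end{aligned}$$ where $\hat M,\check M\in L^2(0,L;\mathbb{R}^{3\times3})$ are the first-order moments of the stress $M$ associated with $(u,D)$, and the differential equations together with the boundary conditions are understood in the weak sense.
   Context: Domain. $L>0$; $\omega\subset\mathbb{R}^2$ is a bounded, simply connected Lipschitz domain with $|\omega|=1$ and $\int_\omega x_2\,d\tilde x=\int_\omega x_3\,d\tilde x=\int_\omega x_2x_3\,d\tilde x=0$, where $\tilde x=(x_2,x_3)$. $\widetilde\nabla\beta=(\partial_2\beta|\partial_3\beta)$, and $(a|B)$ denotes the $3\times3$ matrix with first column $a\in\mathbb{R}^3$ and remaining columns $B\in\mathbb{R}^{3\times2}$. A prime denotes the derivative in $x_1$. $De_1$, $De_2$ are the first and second columns of $D$. $\mathbb{R}^{3\times3}_{\mathrm{skew}}$ is the space of skew-symmetric $3\times3$ matrices. Energy density. $W_0:\mathbb{R}^{3\times3}\to[0,\infty)$ satisfies: (1) $W_0$ is twice continuously differentiable in a neighborhood of $\mathrm{SO}(3)$; (2) $W_0(\mathrm{Id})=0$ and there is $C_1>0$ such that $W_0(F)\ge C_1\,\mathrm{dist}^2(F,\mathrm{SO}(3))$ for all $F\in\mathbb{R}^{3\times3}$; (3) $W_0(RF)=W_0(F)$ for all $F\in\mathbb{R}^{3\times3}$, $R\in\mathrm{SO}(3)$. Let $Q(F)=\nabla^2W_0(\mathrm{Id})[F,F]$, and let $\mathbb{L}$ be the symmetric fourth-order tensor with $Q(F)=\mathbb{L}F:F$ for all $F\in\mathbb{R}^{3\times3}$,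 where $A:B=\mathrm{Tr}(AB^T)$. Limit density. For affine $\xi:\mathbb{R}^2\to\mathbb{R}^3$ and $\beta\in H^1(\omega;\mathbb{R}^3)$ let $Q^\xi(\beta)=\int_\omega Q(\xi|\widetilde\nabla\beta)\,d\tilde x$ if $\mathrm{Tr}(\xi|\widetilde\nabla\beta)=0$ a.e. in $\omega$, and $Q^\xi(\beta)=\infty$ otherwise. For $(F,t)\in\mathbb{R}^{3\times3}_{\mathrm{skew}}\times\mathbb{R}$, $$Q^*(F,t)=\min\{Q^\xi(\beta):\beta\in H^1(\omega;\mathbb{R}^3)\},\qquad\xi(\tilde x)=F(x_2e_2+x_3e_3)+te_1$$ (the minimum is attained). Stress and moments. Given $(u,D)\in\mathcal{A}^{(2)}$ with $A=R^TR'$, let $\beta_A\in L^2(0,L;H^1(\omega;\mathbb{R}^3))$ be such that, for a.e. $x_1\in(0,L)$, $\beta_A(x_1,\cdot)$ is a solution of the minimization problem defining $Q^*(A(x_1),0)$. The stress is $$M=\mathbb{L}\big(A(x_2e_2+x_3e_3)\,|\,\widetilde\nabla\beta_A\big)\in L^2((0,L)\times\omega;\mathbb{R}^{3\times3}),$$ and its first-order moments are $\hat M=\int_\omega x_2M\,d\tilde x$ and $\check M=\int_\omega x_3M\,d\tilde x$. Stationary points. Since $\mathcal{J}^{(2)}(u,D)$ depends only on $R=(u'|D)$, $\mathcal{J}^{(2)}$ is identified with a functional on $H^1(0,L;\mathrm{SO}(3))$. $(u,D)$ is a stationary point if $\frac{d}{ds}\big|_{s=0}\mathcal{J}^{(2)}(\gamma(s))=0$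 for every $B\in H^1(0,L;\mathbb{R}^{3\times3}_{\mathrm{skew}})$ and every (continuously differentiable) curve $\gamma:(-1,1)\to H^1(0,L;\mathrm{SO}(3))$ with $\gamma(0)=R$ and $\partial_s\gamma(0)=RB$. *)

(* Defs.v *)
From HB Require Import structures.
From mathcomp Require Import all_boot all_order all_algebra.
From mathcomp Require Import all_classical all_reals all_analysis.

Set Implicit Arguments.
Unset Strict Implicit.
Unset Printing Implicit Defensive.
Import Order.TTheory GRing.Theory Num.Theory.
Import numFieldNormedType.Exports.

Local Open Scope classical_set_scope.
Local Open Scope ring_scope.

Notation leb := (@lebesgue_measure _).

Definition leb2 {R : realType} :
  set (measurableTypeR R * measurableTypeR R) -> \bar R := (leb \x leb)%E.

HB.instance Definition _ (R : realType) := Measure.on (@leb2 R).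

(* The library's sigma-finiteness of a product is shadowed in canonical structure
   inference by its instance for subprobabilities; we redo it for leb2. *)
Lemma leb2_sigma_finite (R : realType) : sigma_finite setT (@leb2 R).
Proof.
have /sigma_finiteP[F [TF ndF Foo]] := sigma_finiteT (@lebesgue_measure R).
exists (fun n => F n `*` F n).
  rewrite -setXTT TF predeqE => -[x y]; split.
    move=> [/= [n _ Fnx] [k _ Gky]]; exists (maxn n k) => //; split.
    - by move: x Fnx; exact/subsetPset/ndF/leq_maxl.
    - by move: y Gky; exact/subsetPset/ndF/leq_maxr.
  by move=> [n _ []/= ? ?]; split; exists n.
move=> k; have [? ?] := Foo k.
split; first exact: measurableX.
by rewrite /leb2 product_measure1E// lte_mul_pinfty// ge0_fin_numE.
Qed.

HB.instance Definition _ (R : realType) := Measure_isSigmaFinite.Build _ _ _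
  (@leb2 R) (@leb2_sigma_finite R).

Notation leb3 := (leb \x leb2)%E.

(** * Matrices *)

(* One-based indices: [A _{ i , j }] is the entry of the i-th row and j-th column. *)
Definition ix (k : nat) : 'I_3 := inord k.-1.
Notation "A _{ i , j }" := (A (ix i) (ix j))
  (at level 8, i at level 50, j at level 50, format "A _{ i ,  j }") : ring_scope.

Definition evec (R : realType) (k : nat) : 'cV[R]_3 := delta_mx (ix k) 0.

Definition mxdot (R : realType) (m n : nat) (A B : 'M[R]_(m, n)) : R :=
  \tr (A *m B^T).

Definition frob (R : realType) (m n : nat) (A : 'M[R]_(m, n)) : R :=
  Num.sqrt (mxdot A A).

Definition SO3 (R : realType) : set 'M[R]_3 :=
  [set F | F^T *m F = 1%:M /\ \det F = 1].

Definition skew (R : realType) (F : 'M[R]_3) : Prop := F^T = - F.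

Definition dist_SO3 (R : realType) (F : 'M[R]_3) : R :=
  inf [set frob (F - P) | P in @SO3 R].

(** * Continuous differentiability *)

(* In finite dimension, f is C^1 on the open set U iff all its directional
   derivatives exist and are continuous on U. *)
Definition C1_on (R : realType) (V : normedModType R) (U : set V) (f : V -> R) :=
  forall v : V, (forall x, U x -> derivable f x v) /\
                (forall x, U x -> {for x, continuous ('D_v f)}).

Definition C2_on (R : realType) (V : normedModType R) (U : set V) (f : V -> R) :=
  C1_on U f /\ forall v : V, C1_on U ('D_v f).

(* Weak derivatives are tested with C^1_c functions; by mollification this
   gives the same notion as testing with C^oo_c functions. *)
Definition test_fun (R : realType) (V : normedModType R) (U : set V) (phi : V -> R) :=
  C1_on setT phi /\
  exists K : set V, [/\ compact K, K `<=` U & forall x, ~ K x -> phi x = 0].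

(** * L^2 and H^1 on the interval (0, L)

   Functions on (0, L) are total functions of which only the restriction to
   `]0, L[ matters; matrix-valued functions are treated entrywise. *)

Definition is_L2 (d : measure_display) (T : measurableType d) (R : realType)
    (mu : {measure set T -> \bar R}) (X : set T) (m n : nat)
    (f : T -> 'M[R]_(m, n)) : Prop :=
  forall i j, measurable_fun X (fun x => f x i j) /\
    mu.-integrable X (fun x => ((f x i j) ^+ 2)%:E).

Definition is_wder (R : realType) (L : R) (m n : nat) (f g : R -> 'M[R]_(m, n)) :=
  forall i j (phi : R -> R), test_fun `]0, L[ phi ->
    \int[leb]_(x in `]0, L[) (f x i j * derive1 phi x) =
    - \int[leb]_(x in `]0, L[) (g x i j * phi x).

Definition is_H1 (R : realType) (L : R) (m n : nat) (f : R -> 'M[R]_(m, n)) :=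
  is_L2 leb `]0, L[ f /\ exists g, is_L2 leb `]0, L[ g /\ is_wder L f g.

(* A chosen representative of the weak derivative of f (0 if f is not in H^1);
   it is determined up to a.e. equality on (0, L). *)
Definition wder (R : realType) (L : R) (m n : nat) (f : R -> 'M[R]_(m, n)) :
    R -> 'M[R]_(m, n) :=
  xget (cst 0) [set g | is_L2 leb `]0, L[ g /\ is_wder L f g].

Definition is_H2 (R : realType) (L : R) (m n : nat) (f : R -> 'M[R]_(m, n)) :=
  is_H1 L f /\ is_H1 L (wder L f).

Definition H1norm (R : realType) (L : R) (m n : nat) (f : R -> 'M[R]_(m, n)) : R :=
  Num.sqrt (\int[leb]_(x in `]0, L[) (frob (f x) ^+ 2 + frob (wder L f x) ^+ 2)).

(** * H^1 on the cross-section

   A point p of the plane stands for (x_2, x_3) = (p.1, p.2). *)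

Definition is_wgrad (R : realType) (om : set (R * R)) (b : R * R -> 'cV[R]_3)
    (G : R * R -> 'M[R]_(3, 2)) : Prop :=
  forall (i : 'I_3) (phi : R * R -> R), test_fun om phi ->
    (\int[leb2]_(p in om) (b p i 0 * 'D_((1, 0) : R * R) phi p) =
       - \int[leb2]_(p in om) (G p i 0 * phi p)) /\
    (\int[leb2]_(p in om) (b p i 0 * 'D_((0, 1) : R * R) phi p) =
       - \int[leb2]_(p in om) (G p i 1 * phi p)).

Definition is_H1_om (R : realType) (om : set (R * R)) (b : R * R -> 'cV[R]_3) :=
  is_L2 leb2 om b /\ exists G, is_L2 leb2 om G /\ is_wgrad om b G.

Definition wgrad (R : realType) (om : set (R * R)) (b : R * R -> 'cV[R]_3) :
    R * R -> 'M[R]_(3, 2) :=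
  xget (cst 0) [set G | is_L2 leb2 om G /\ is_wgrad om b G].

(* b is in L^2(0, L; H^1(om; R^3)), with G its gradient in (x_2, x_3): through
   L^2(0, L; L^2(om)) = L^2((0, L) x om), b and G are jointly measurable and
   square integrable. *)
Definition is_L2H1 (R : realType) (L : R) (om : set (R * R))
    (b : R -> R * R -> 'cV[R]_3) (G : R -> R * R -> 'M[R]_(3, 2)) : Prop :=
  [/\ is_L2 leb3 (`]0, L[ `*` om) (fun z : R * (R * R) => b z.1 z.2),
      is_L2 leb3 (`]0, L[ `*` om) (fun z : R * (R * R) => G z.1 z.2) &
      \forall x \ae leb, x \in `]0, L[ -> is_wgrad om (b x) (G x)].

(** * The cross-section *)

Definition simply_connected (R : realType) (om : set (R * R)) : Prop :=
  connected om /\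
  forall c : R -> R * R, {within `[0, 1], continuous c} ->
    (forall t, t \in `[0, 1] -> om (c t)) -> c 0 = c 1 ->
    exists H : R * R -> R * R,
      [/\ {within (`[0, 1] `*` `[0, 1]), continuous H},
          forall s t, s \in `[0, 1] -> t \in `[0, 1] -> om (H (s, t)),
          forall t, t \in `[0, 1] -> H (0, t) = c t /\ H (1, t) = c 0 &
          forall s, s \in `[0, 1] -> H (s, 0) = c 0 /\ H (s, 1) = c 0].

(* Near each boundary point q, and in coordinates (a, b) centred at q and
   rotated by the angle with cosine k and sine l, om is the region above the
   graph of a Lipschitz function. *)
Definition Lipschitz_domain (R : realType) (om : set (R * R)) : Prop :=
  [/\ open om, connected om &
    forall q : R * R, closure om q -> ~ om q ->
    exists k l r rho K : R, exists phi : R -> R,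
      [/\ k ^+ 2 + l ^+ 2 = 1, 0 < r, 0 < rho, K.-lipschitz phi &
        forall a b, `|a| < r -> `|b| < rho ->
          om (q.1 + k * a - l * b, q.2 + l * a + k * b) <-> phi a < b]].

Definition cross_section (R : realType) (om : set (R * R)) : Prop :=
  [/\ bounded_set om, simply_connected om & Lipschitz_domain om] /\
  [/\ leb2 om = 1%E,
      \int[leb2]_(p in om) p.1 = 0,
      \int[leb2]_(p in om) p.2 = 0 &
      \int[leb2]_(p in om) (p.1 * p.2) = 0].

(** * Energy densities *)

Definition energy_density (R : realType) (W : 'M[R]_3 -> R) : Prop :=
  [/\ forall F, 0 <= W F,
      exists U : set 'M[R]_3, [/\ open U, @SO3 R `<=` U & C2_on U W],
      W 1%:M = 0,
      exists C : R, 0 < C /\ forall F, C * dist_SO3 F ^+ 2 <= W F &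
      forall F P, SO3 P -> W (P *m F) = W F].

Definition hessQ (R : realType) (W : 'M[R]_3 -> R) (F : 'M[R]_3) : R :=
  'D_F ('D_F W) 1%:M.

Definition elasticity_tensor (R : realType) (W : 'M[R]_3 -> R)
    (LL : {linear 'M[R]_3 -> 'M[R]_3}) : Prop :=
  (forall F G, mxdot (LL F) G = mxdot F (LL G)) /\
  (forall F, hessQ W F = mxdot (LL F) F).

Definition catmx (R : realType) (a : 'cV[R]_3) (B : 'M[R]_(3, 2)) : 'M[R]_3 :=
  row_mx a B.

Definition Qxi (R : realType) (om : set (R * R)) (Q : 'M[R]_3 -> R)
    (xi : R * R -> 'cV[R]_3) (b : R * R -> 'cV[R]_3) : \bar R :=
  if `[< \forall p \ae leb2, om p -> \tr (catmx (xi p) (wgrad om b p)) = 0 >]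
  then (\int[leb2]_(p in om) (Q (catmx (xi p) (wgrad om b p)))%:E)%E
  else +oo%E.

Definition xi_of (R : realType) (F : 'M[R]_3) (t : R) (p : R * R) : 'cV[R]_3 :=
  F *m (p.1 *: evec R 2 + p.2 *: evec R 3) + t *: evec R 1.

Definition Qstar (R : realType) (om : set (R * R)) (Q : 'M[R]_3 -> R)
    (F : 'M[R]_3) (t : R) : \bar R :=
  ereal_inf [set Qxi om Q (xi_of F t) b | b in is_H1_om om].

Definition is_minimizer (R : realType) (om : set (R * R)) (Q : 'M[R]_3 -> R)
    (F : 'M[R]_3) (t : R) (b : R * R -> 'cV[R]_3) : Prop :=
  is_H1_om om b /\ Qxi om Q (xi_of F t) b = Qstar om Q F t.

(** * Rods *)

Definition frame (R : realType) (L : R) (u : R -> 'cV[R]_3)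
    (D : R -> 'M[R]_(3, 2)) (x : R) : 'M[R]_3 := catmx (wder L u x) (D x).

Definition admissible (R : realType) (L : R) (u : R -> 'cV[R]_3)
    (D : R -> 'M[R]_(3, 2)) : Prop :=
  [/\ is_H2 L u, is_H1 L D &
      \forall x \ae leb, x \in `]0, L[ -> SO3 (frame L u D x)].

Definition curvature (R : realType) (L : R) (P : R -> 'M[R]_3) (x : R) : 'M[R]_3 :=
  (P x)^T *m wder L P x.

Definition primitive (R : realType) (f : R -> 'cV[R]_3) (t : R) : 'cV[R]_3 :=
  \col_i \int[leb]_(x in `]0, t[) f x i 0.

Definition energy_frame (R : realType) (L : R) (om : set (R * R))
    (W : 'M[R]_3 -> R) (h : R -> 'cV[R]_3) (P : R -> 'M[R]_3) : \bar R :=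
  ((2^-1)%:E * \int[leb]_(x in `]0%R, L[) Qstar om (hessQ W) (curvature L P x) 0%R
   + (\int[leb]_(x in `]0, L[) mxdot (h x) (P x *m evec R 1))%:E)%E.

Definition energy (R : realType) (L : R) (om : set (R * R))
    (W : 'M[R]_3 -> R) (h : R -> 'cV[R]_3)
    (u : R -> 'cV[R]_3) (D : R -> 'M[R]_(3, 2)) : \bar R :=
  ((2^-1)%:E * \int[leb]_(x in `]0%R, L[)
       Qstar om (hessQ W) (curvature L (frame L u D) x) 0%R
   + (\int[leb]_(x in `]0, L[) mxdot (h x) (wder L u x))%:E)%E.

Lemma energyE (R : realType) (L : R) (om : set (R * R))
    (W : 'M[R]_3 -> R) (h : R -> 'cV[R]_3)
    (u : R -> 'cV[R]_3) (D : R -> 'M[R]_(3, 2)) :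
  energy L om W h u D = energy_frame L om W h (frame L u D).
Proof.
rewrite /energy /energy_frame; congr (_ + (Rintegral _ _ _)%:E)%E.
apply/funext => x; congr mxdot; apply/colP => i.
rewrite /evec -colE mxE /frame /catmx.
rewrite (_ : ix 1 = lshift 2 (0 : 'I_1)); first by rewrite (@row_mxEl _ _ 1 2).
by apply: val_inj; rewrite /= inordK.
Qed.

(* gam is a continuously differentiable curve (-1, 1) -> H^1(0, L; SO(3)) with
   derivative dgam. *)
Definition C1_curve (R : realType) (L : R) (gam dgam : R -> R -> 'M[R]_3) : Prop :=
  forall s : R, -1 < s < 1 ->
  [/\ is_H1 L (gam s), \forall x \ae leb, x \in `]0, L[ -> SO3 (gam s x),
      is_H1 L (dgam s),
      H1norm L (fun x => k^-1 *: (gam (s + k) x - gam s x) - dgam s x)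
        @[k --> 0^'] --> (0 : R) &
      H1norm L (fun x => dgam (s + k) x - dgam s x) @[k --> (0 : R)] --> (0 : R)].

(* Stationarity of a functional J on H^1(0, L; SO(3)) at P. *)
Definition stationary (R : realType) (L : R) (J : (R -> 'M[R]_3) -> \bar R)
    (P : R -> 'M[R]_3) : Prop :=
  forall (B : R -> 'M[R]_3) (gam dgam : R -> R -> 'M[R]_3),
    is_H1 L B -> (\forall x \ae leb, x \in `]0, L[ -> skew (B x)) ->
    C1_curve L gam dgam ->
    (\forall x \ae leb, x \in `]0, L[ -> gam 0 x = P x) ->
    (\forall x \ae leb, x \in `]0, L[ -> dgam 0 x = P x *m B x) ->
    is_derive (0 : R) (1 : R) (fun s => fine (J (gam s))) 0.

(** * Stress, moments and the weak form of the equations *)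

Definition stress (R : realType) (LL : {linear 'M[R]_3 -> 'M[R]_3})
    (A : R -> 'M[R]_3) (G : R -> R * R -> 'M[R]_(3, 2)) (x : R) (p : R * R) :
    'M[R]_3 :=
  LL (catmx (xi_of (A x) 0 p) (G x p)).

Definition moment2 (R : realType) (om : set (R * R))
    (M : R -> R * R -> 'M[R]_3) (x : R) : 'M[R]_3 :=
  \matrix_(i, j) \int[leb2]_(p in om) (p.1 * M x p i j).

Definition moment3 (R : realType) (om : set (R * R))
    (M : R -> R * R -> 'M[R]_3) (x : R) : 'M[R]_3 :=
  \matrix_(i, j) \int[leb2]_(p in om) (p.2 * M x p i j).

(* Weak form of the boundary value problem
     w' = g in (0, L),  w(0) = w0,  w(L) = wL.
   The test functions are C^1 up to the boundary and do not vanish there, so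
   that the identity encodes the equation and both boundary conditions. *)
Definition weak_bvp (R : realType) (L : R) (w g : R -> R) (w0 wL : R) : Prop :=
  forall phi : R -> R, C1_on setT phi ->
    \int[leb]_(x in `]0, L[) (w x * derive1 phi x) +
    \int[leb]_(x in `]0, L[) (g x * phi x) = wL * phi L - w0 * phi 0.

(* Main.v *)
Require Import Defs.
From HB Require Import structures.
From mathcomp Require Import all_boot all_order all_algebra.
From mathcomp Require Import all_classical all_reals all_analysis.
From mathcomp Require Import measurable_realfun.
From mathcomp Require Import ring lra.
Set Implicit Arguments.
Unset Strict Implicit.
Unset Printing Implicit Defensive.
Import Order.TTheory GRing.Theory Num.Theory.
Import numFieldNormedType.Exports.
Local Open Scope classical_set_scope.
Local Open Scope ring_scope.

(** Write P for the frame, A = P^T P' for its curvature and Q* for the reduced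
    energy density. A curve of frames leaving P with velocity P B changes A with
    velocity B' + A B - B A ([dcurv_commutator]). The function Q* is itself the
    value of a minimisation problem, but its derivative in a skew direction is
    explicit: if X is the optimal strain for A and X' the strain of any admissible
    field for the direction F', then the competitor X + X' bounds Q*(A + F') from
    above by a quadratic polynomial, and the convexity of the problem gives the
    matching lower bound ([Qstar_upper], [Qstar_lower]). So the derivative is
    twice the integral of M : X' over the cross-section, whatever the admissible
    X'. For F' with entries a, b, c at (1,2), (1,3), (2,3), the trace
    a x_2 + b x_3 of the bending strain is compensated by the in-plane field
    - (a x_2^2 / 2, b x_3^2 / 2), a polynomial on which M acts through its first
    moments. This gives M_hat_11 - M_hat_22, M_check_11 - M_check_33 and
    M_check_21 - M_hat_31 as the coefficients of a, b and c ([bil_testF]).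

    The two bounds differ by a quadratic remainder that is uniform in x_1, hence
    they can be integrated ([elastic_expansion]); the derivative of the energy
    along the curve then follows from the convergence of the difference quotients
    of the curvature in L^2, a consequence of the embedding of H^1 into bounded
    functions ([curvature_null], [energy_derive]). With w_12, w_13, w_23 for the
    three combinations of moments, the commutator A B - B A and the load
    h . P B e_1 turn this derivative into the sum of the integrals of
    w_ij B_ij' + g_ij B_ij, where the g_ij are the right-hand sides of the three
    equations ([variation_formula]).

    If the equations hold weakly, then testing with functions that do not vanish
    at the ends shows that w_ij is the primitive of g_ij vanishing at 0 and at L,
    and integration by parts cancels the sum for every B in H^1
    ([weak_bvp_test]). Conversely, rotate the frame about a fixed material axis K
    by the angle s phi(x), with phi continuously differentiable up to the ends.
    By Rodrigues' formula this is a curve in H^1(0, L; SO(3)) with velocity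
    phi P K at s = 0 ([spin_C1_curve]), and the three coordinate axes K give the
    three equations tested with phi ([stationary_spin]).

    Along the way come the facts about weak derivatives on which this rests: their
    uniqueness, on the interval and in the plane ([fundamental_lemma_itv],
    [fundamental_lemma_open]), and the identification of H^1 functions on the
    interval with primitives of L^2 functions ([wder1_acrep]). *)

(** * Integration *)

Section Integrable.
Context d (T : measurableType d) (R : realType).
Variables (mu : {measure set T -> \bar R}) (D : set T).
Hypothesis mD : measurable D.
Implicit Types f g h : T -> R.

Definition intble f := mu.-integrable D (EFin \o f).

Lemma intble_meas f : intble f -> measurable_fun D f.
Proof. by move=> /measurable_int/measurable_EFinP. Qed.

Lemma intbleD f g : intble f -> intble g -> intble (fun x => f x + g x).
Proof. exact: integrableD mD _ _. Qed.

Lemma intbleZ k f : intble f -> intble (fun x => k * f x).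
Proof. exact: integrableZl mD _ _. Qed.

Lemma intbleB f g : intble f -> intble g -> intble (fun x => f x - g x).
Proof. exact: integrableB mD _ _. Qed.

Lemma eq_intble f g : (forall x, D x -> f x = g x) -> intble f -> intble g.
Proof.
by move=> fg; apply: eq_integrable => // x /set_mem Dx /=; rewrite fg.
Qed.

Lemma le_intble f g : measurable_fun D f -> (forall x, D x -> `|f x| <= g x) ->
  intble g -> intble f.
Proof.
move=> mf fg; apply: le_integrable => //; first exact/measurable_EFinP.
move=> x Dx; rewrite /= lee_fin (le_trans (fg _ Dx))//; exact: ler_norm.
Qed.

Lemma intble_sum (I : finType) (F : I -> T -> R) :
  (forall i, intble (F i)) -> intble (fun x => \sum_i F i x).
Proof.
move=> iF; apply: (@eq_integrable _ _ _ _ _ _ (fun x => \sum_i (F i x)%:E)%E) => //.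
  by move=> x _; rewrite /= sumEFin.
by apply: integrable_sum => // i _; exact: iF.
Qed.

Lemma ae_le_intble f g : measurable_fun D f ->
  {ae mu, forall x, D x -> `|f x| <= g x} -> intble g -> intble f.
Proof.
move=> mf fg ig; apply/integrableP; split; first exact/measurable_EFinP.
have /integrableP[mg] := ig; apply: le_lt_trans.
apply: ae_ge0_le_integral => //.
- by apply: measurableT_comp => //; exact/measurable_EFinP.
- by apply: measurableT_comp.
- apply: filterS fg => x fg Dx /=.
  by rewrite lee_fin (le_trans (fg Dx))// ler_norm.
Qed.

Lemma ae_eq_Rintegral f g : measurable_fun D f -> measurable_fun D g ->
  {ae mu, forall x, D x -> f x = g x} ->
  \int[mu]_(x in D) f x = \int[mu]_(x in D) g x.
Proof.
move=> mf mg fg; congr fine; apply: ae_eq_integral => //;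
  try exact/measurable_EFinP.
by apply: filterS fg => x fg Dx; rewrite fg.
Qed.

Lemma ae_eq_intble f g : measurable_fun D g ->
  {ae mu, forall x, D x -> f x = g x} -> intble f -> intble g.
Proof.
move=> mg fg fi; apply: (ae_le_intble (g := fun x => `|f x|)) => //.
  by apply: filterS fg => x fg Dx; rewrite fg.
exact: integrable_norm.
Qed.

Lemma ae_le_Rintegral f g : intble f -> intble g ->
  {ae mu, forall x, D x -> f x <= g x} ->
  \int[mu]_(x in D) f x <= \int[mu]_(x in D) g x.
Proof.
move=> fi gi fg; rewrite -subr_ge0 -RintegralB//.
have mfg : measurable_fun D (fun x => g x - f x).
  by apply: measurable_funB; apply: intble_meas.
rewrite (@ae_eq_Rintegral _ (fun x => `|g x - f x|))//.
- by apply: Rintegral_ge0.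
- exact: measurableT_comp.
- by apply: filterS fg => x fg Dx; rewrite ger0_norm// subr_ge0 fg.
Qed.

Lemma EFin_Rintegral f : intble f ->
  (\int[mu]_(x in D) (f x)%:E)%E = (\int[mu]_(x in D) f x)%:E.
Proof. by move=> fi; rewrite /Rintegral fineK//; exact: integrable_fin_num. Qed.

Import HBNNSimple.

(** The integral of a nonnegative function being the supremum of the
    integrals of the simple functions below it, it is monotone as soon as one
    of the two functions is measurable. This spares a proof that the reduced
    energy density is measurable along a curve of frames. *)
Lemma ae_ge0_le_integral_measl (f g : T -> \bar R) : (forall x, D x -> 0 <= f x)%E ->
  (forall x, D x -> 0 <= g x)%E -> measurable_fun D f ->
  {ae mu, forall x, D x -> (f x <= g x)%E} ->
  (\int[mu]_(x in D) f x <= \int[mu]_(x in D) g x)%E.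
Proof.
move=> f0 g0 mf [N [mN N0 sN]].
rewrite (ge0_negligible_integral mN)//.
rewrite integral_mkcond [leRHS]integral_mkcond.
have fgN x : ((f \_ (D `\` N)) x <= (g \_ D) x)%E.
  rewrite !patchE; case: ifPn => [/set_mem[Dx Nx]|_].
    rewrite mem_set//; apply: contrapT => fg; apply/Nx/sN => /=.
    by move=> /(_ Dx).
  by case: ifPn => // /set_mem; exact: g0.
have f0' x : (0 <= (f \_ (D `\` N)) x)%E.
  by rewrite patchE; case: ifPn => // /set_mem[] /f0.
rewrite !ge0_integralTE//; last by move=> x; rewrite (le_trans (f0' x)).
apply: ereal_sup_le => _ [h /= hf <-]; exists h => // x.
by rewrite (le_trans (hf x)).
Qed.

Lemma ae_ge0_le_integral_measr (f g : T -> \bar R) : (forall x, D x -> 0 <= f x)%E ->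
  (forall x, D x -> 0 <= g x)%E -> measurable_fun D g ->
  {ae mu, forall x, D x -> (f x <= g x)%E} ->
  (\int[mu]_(x in D) f x <= \int[mu]_(x in D) g x)%E.
Proof.
move=> f0 g0 mg fg.
rewrite integral_mkcond [leRHS]integral_mkcond.
have mg' : measurable_fun setT (g \_ D) by exact: (measurable_restrictT g mD).1 mg.
have f0' x : (0 <= (f \_ D) x)%E.
  by rewrite patchE; case: ifPn => // /set_mem /f0.
have g0' x : (0 <= (g \_ D) x)%E.
  by rewrite patchE; case: ifPn => // /set_mem /g0.
rewrite [leLHS]ge0_integralTE//.
apply: ge_ereal_sup => _ [h /= hf <-].
rewrite (_ : sintegral mu h = \int[mu]_x (h x)%:E)%E; last first.
  by rewrite integralT_nnsfun.
apply: ae_ge0_le_integral => //.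
- by move=> x _; rewrite lee_fin.
- exact/measurable_EFinP.
- apply: filterS fg => x fg _; rewrite (le_trans (hf x))// !patchE.
  by case: ifPn => // /set_mem /fg.
Qed.

End Integrable.

Section Intble_subset.
Context d (T : measurableType d) (R : realType) (mu : {measure set T -> \bar R}).

Lemma intbleS (D E : set T) (f : T -> R) : measurable D -> measurable E ->
  D `<=` E -> intble mu E f -> intble mu D f.
Proof. by move=> mD mE DE; apply: integrableS. Qed.

Lemma intble_patch (D E : set T) (f : T -> R) : measurable D -> measurable E ->
  E `<=` D -> intble mu E f <-> intble mu D (f \_ E).
Proof.
move=> mD mE ED; rewrite /intble -{1}(setIidr ED).
rewrite -restrict_EFin; exact: integrable_restrict.
Qed.

Lemma Rintegral_patch (D E : set T) (f : T -> R) : E `<=` D ->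
  \int[mu]_(x in D) (f \_ E) x = \int[mu]_(x in E) f x.
Proof. by move=> ED; rewrite -Rintegral_mkcondr setIidr. Qed.

End Intble_subset.

(** * Square-integrable functions *)

Section SquareIntegrable.
Context d (T : measurableType d) (R : realType).
Variables (mu : {measure set T -> \bar R}) (D : set T).
Hypothesis mD : measurable D.
Implicit Types f g h b : T -> R.

Definition sqint f := measurable_fun D f /\ intble mu D (fun x => f x ^+ 2).

Lemma sqint_meas f : sqint f -> measurable_fun D f. Proof. by case. Qed.

Lemma sqint_intble2 f : sqint f -> intble mu D (fun x => f x ^+ 2).
Proof. by case. Qed.

Lemma sqintM f g : sqint f -> sqint g -> intble mu D (fun x => f x * g x).
Proof.
move=> [mf f2] [mg g2]; apply: (le_intble mD (g := fun x => f x ^+ 2 + g x ^+ 2)) => //.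
- exact: measurable_funM.
- move=> x _; rewrite ler_norml; apply/andP; split; first nra.
  nra.
- exact: intbleD.
Qed.

Lemma sqintZ k f : sqint f -> sqint (fun x => k * f x).
Proof.
move=> [mf f2]; split; first exact: measurable_funM.
apply: (eq_intble mD (f := fun x => k ^+ 2 * f x ^+ 2)) => //; last exact: intbleZ.
by move=> x _; rewrite exprMn.
Qed.

Lemma sqintD f g : sqint f -> sqint g -> sqint (fun x => f x + g x).
Proof.
move=> sf sg; have [mf f2] := sf; have [mg g2] := sg.
split; first exact: measurable_funD.
apply: (eq_intble mD (f := fun x => (f x ^+ 2 + 2 * (f x * g x)) + g x ^+ 2)) => //.
  by move=> x _; ring.
by apply: intbleD => //; apply: intbleD => //; apply: intbleZ => //; exact: sqintM.
Qed.

Lemma eq_sqint f g : (forall x, D x -> f x = g x) -> sqint f -> sqint g.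
Proof.
move=> fg [mf f2]; split.
  by apply: eq_measurable_fun mf => x /set_mem Dx; rewrite fg.
by apply: eq_intble f2 => // x Dx; rewrite fg.
Qed.

Lemma sqintN f : sqint f -> sqint (fun x => - f x).
Proof. by move=> /(sqintZ (-1)); apply: eq_sqint => x _; rewrite mulN1r. Qed.

Lemma sqintB f g : sqint f -> sqint g -> sqint (fun x => f x - g x).
Proof. by move=> sf sg; apply: sqintD => //; exact: sqintN. Qed.

Lemma sqint0 : sqint (fun=> 0).
Proof.
split; first exact: measurable_cst.
by rewrite expr0n /=; exact: integrable0.
Qed.

Lemma sqint_sum (I : finType) (F : I -> T -> R) :
  (forall i, sqint (F i)) -> sqint (fun x => \sum_i F i x).
Proof.
move=> sF; elim: (index_enum I) => [|i s IH].
  by apply: eq_sqint sqint0 => x _; rewrite big_nil.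
apply: eq_sqint (sqintD (sF i) IH) => x _; by rewrite big_cons.
Qed.

Lemma ae_eq_sqint f g : measurable_fun D g ->
  {ae mu, forall x, D x -> f x = g x} -> sqint f -> sqint g.
Proof.
move=> mg fg [mf f2]; split => //; apply: ae_eq_intble f2 => //.
  by apply: measurable_funX.
by apply: filterS fg => x fg Dx; rewrite fg.
Qed.

Lemma ae_le_sqint f g : measurable_fun D f ->
  {ae mu, forall x, D x -> `|f x| <= `|g x|} -> sqint g -> sqint f.
Proof.
move=> mf fg [mg g2]; split => //; apply: ae_le_intble g2 => //.
  by apply: measurable_funX.
apply: filterS fg => x fg Dx; rewrite normrX -[leRHS]ger0_norm ?sqr_ge0//.
by rewrite normrX lerXn2r ?nnegrE// fg.
Qed.

Lemma sqint_bM (K : R) b f : measurable_fun D b ->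
  {ae mu, forall x, D x -> `|b x| <= K} -> sqint f -> sqint (fun x => b x * f x).
Proof.
move=> mb bK sf; have [mf _] := sf.
apply: (ae_le_sqint (g := fun x => `|K| * f x)); [| |exact: sqintZ].
  exact: measurable_funM.
apply: filterS bK => x bK Dx; rewrite !normrM ler_wpM2r// normr_id.
by rewrite (le_trans (bK Dx))// ler_norm.
Qed.

Definition nsq f : R := \int[mu]_(x in D) (f x ^+ 2).

Lemma nsq_ge0 f : 0 <= nsq f.
Proof. by apply: Rintegral_ge0 => x _; exact: sqr_ge0. Qed.

Lemma nsqZ k f : sqint f -> nsq (fun x => k * f x) = k ^+ 2 * nsq f.
Proof.
move=> [mf f2]; rewrite /nsq -RintegralZl//.
by apply: eq_Rintegral => x _; rewrite exprMn.
Qed.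

Lemma nsqD f g : sqint f -> sqint g ->
  nsq (fun x => f x + g x) <= 2 * (nsq f + nsq g).
Proof.
move=> sf sg; have [mf f2] := sf; have [mg g2] := sg.
have h1 : nsq (fun x => f x + g x) =
    nsq f + 2 * \int[mu]_(x in D) (f x * g x) + nsq g.
  rewrite /nsq -RintegralZl//; last exact: sqintM.
  rewrite -RintegralD//; last by apply: intbleZ => //; exact: sqintM.
  rewrite -RintegralD//; last first.
    by apply: intbleD => //; apply: intbleZ => //; exact: sqintM.
  by apply: eq_Rintegral => x _; ring.
have h2 : 0 <= nsq f - 2 * \int[mu]_(x in D) (f x * g x) + nsq g.
  rewrite /nsq -RintegralZl//; last exact: sqintM.
  rewrite -RintegralB//; last by apply: intbleZ => //; exact: sqintM.
  rewrite -RintegralD//; last first.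
    by apply: intbleB => //; apply: intbleZ => //; exact: sqintM.
  apply: Rintegral_ge0 => x _.
  by rewrite (_ : _ + _ = (f x - g x) ^+ 2) ?sqr_ge0//; ring.
by rewrite h1; lra.
Qed.

Lemma ae_eq_nsq f g : measurable_fun D f -> measurable_fun D g ->
  {ae mu, forall x, D x -> f x = g x} -> nsq f = nsq g.
Proof.
move=> mf mg fg; apply: ae_eq_Rintegral => //; try exact: measurable_funX.
by apply: filterS fg => x fg Dx; rewrite fg.
Qed.

Lemma nsq_bM (K : R) b f : measurable_fun D b ->
  {ae mu, forall x, D x -> `|b x| <= K} -> sqint f ->
  nsq (fun x => b x * f x) <= K ^+ 2 * nsq f.
Proof.
move=> mb bK sf; rewrite -nsqZ//; apply: ae_le_Rintegral => //.
- by have [] := sqint_bM mb bK sf.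
- by have [] := sqintZ K sf.
- apply: filterS bK => x bK Dx; rewrite !exprMn ler_wpM2r ?sqr_ge0//.
  by rewrite -[_ ^+ 2]ger0_norm ?sqr_ge0// normrX lerXn2r ?nnegrE ?(le_trans _ (bK Dx))//; exact: bK.
Qed.

(** Cauchy-Schwarz, from the sign of the quadratic polynomial
    t |-> nsq (t f + g). *)
Lemma CauchySchwarz f g : sqint f -> sqint g ->
  (\int[mu]_(x in D) (f x * g x)) ^+ 2 <= nsq f * nsq g.
Proof.
move=> sf sg; have [mf f2] := sf; have [mg g2] := sg.
set p := \int[mu]_(x in D) _.
have quad t : 0 <= t ^+ 2 * nsq f + 2 * t * p + nsq g.
  rewrite /nsq /p -RintegralZl//.
  rewrite -[X in _ + X + _]RintegralZl//; last exact: sqintM.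
  rewrite -RintegralD//; [|exact: intbleZ|by apply: intbleZ => //; exact: sqintM].
  rewrite -RintegralD//; last first.
    by apply: intbleD => //; apply: intbleZ => //; exact: sqintM.
  apply: Rintegral_ge0 => x _.
  by rewrite (_ : _ + _ = (t * f x + g x) ^+ 2) ?sqr_ge0//; ring.
have [f0|f0] := eqVneq (nsq f) 0; last first.
  have fpos : 0 < nsq f by rewrite lt_def f0 nsq_ge0.
  have := quad (- p / nsq f); rewrite (_ : _ + _ = nsq g - p ^+ 2 / nsq f).
    by rewrite subr_ge0 ler_pdivrMr// mulrC.
  by field.
rewrite f0 mul0r; have [->|p0] := eqVneq p 0; first by rewrite expr0n.
have := quad (- (nsq g + 1) / (2 * p)).
rewrite f0 mulr0 add0r (_ : _ + _ = -1); first by rewrite oppr_ge0 ler10.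
by field.
Qed.

End SquareIntegrable.

Section Finite.
Context d (T : measurableType d) (R : realType).
Variables (mu : {measure set T -> \bar R}) (D : set T).
Hypothesis mD : measurable D.
Hypothesis muD : (mu D < +oo)%E.
Implicit Types f g h b : T -> R.

Lemma intble_cst k : intble mu D (fun=> k).
Proof.
apply/integrableP; split; first exact/measurable_EFinP/measurable_cst.
by rewrite /= integral_cst// lte_mul_pinfty.
Qed.

Lemma bounded_intble (K : R) f : measurable_fun D f ->
  {ae mu, forall x, D x -> `|f x| <= K} -> intble mu D f.
Proof. by move=> mf fK; apply: (ae_le_intble mD (g := fun=> K)) => //; exact: intble_cst. Qed.

Lemma sqint_cst k : sqint mu D (fun=> k).
Proof. by split; [exact: measurable_cst|exact: intble_cst]. Qed.

Lemma bounded_sqint (K : R) f : measurable_fun D f ->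
  {ae mu, forall x, D x -> `|f x| <= K} -> sqint mu D f.
Proof.
move=> mf fK; apply: (ae_le_sqint mD (g := fun=> K)) => //; last exact: sqint_cst.
by apply: filterS fK => x fK Dx; rewrite (le_trans (fK Dx))// ler_norm.
Qed.

Lemma sqint_intble f : sqint mu D f -> intble mu D f.
Proof.
move=> sf; apply: eq_intble (sqintM mD (sqint_cst 1) sf) => // x _.
by rewrite mul1r.
Qed.

End Finite.

(** * Functions whose integrals vanish on a generating family *)

Section Vanishing.
Context d (T : measurableType d) (R : realType).
Variables (mu : {measure set T -> \bar R}) (D : set T).
Hypothesis mD : measurable D.

(** By Dynkin's theorem: the sets over which g has zero integral are stable under
    complements and countable disjoint unions. *)
Lemma vanishing_generated d' (S : measurableType d') (p : T -> S)
    (G : set (set S)) (g : T -> R) :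
  measurable_fun setT p -> @measurable _ S = <<s G >> -> setI_closed G ->
  intble mu D g -> \int[mu]_(x in D) g x = 0 ->
  (forall A, G A -> \int[mu]_(x in D `&` p @^-1` A) g x = 0) ->
  forall A, measurable A -> \int[mu]_(x in D `&` p @^-1` A) g x = 0.
Proof.
move=> mp GE GI gi g0 gG A mA.
have mpre B : measurable B -> measurable (D `&` p @^-1` B).
  by move=> mB; apply: measurableI => //; rewrite -[X in measurable X]setTI; exact: mp.
apply: (dynkin_induction (P := fun A => \int[mu]_(x in D `&` p @^-1` A) g x = 0)
  GE GI) => //; last by rewrite -GE.
- by rewrite preimage_setT setIT.
- move=> S' mS gS.
  have := @Rintegral_setU _ _ _ mu (D `&` p @^-1` S') (D `&` p @^-1` (~` S')) g
    (mpre _ mS) (mpre _ (measurableC mS)).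
  rewrite -setIUr preimage_setC setUv setIT g0 gS add0r => /(_ gi) <- //.
  apply/disj_setPS => x [[_ h1] [_ h2]]; exact: h2.
- move=> F mF tF gF.
  rewrite preimage_bigcup setI_bigcupr /Rintegral integral_bigcup//.
  + apply: (@eq_trans _ _ (fine 0%E)); last by [].
    congr fine; apply: eseries0 => k _ _.
    rewrite (@EFin_Rintegral _ _ _ _ _ _ g) ?gF//.
      exact: mpre.
    by apply: intbleS gi => //; exact: mpre.
  + apply/trivIsetP => i j _ _ ij; rewrite setIACA setIid -preimage_setI.
    have /trivIsetP/(_ i j Logic.I Logic.I ij) -> := tF.
    by rewrite preimage_set0 setI0.
  + by move=> k; exact: mpre.
  + apply: (intbleS (E := D)) gi => //.
      by apply: bigcup_measurable => k _; exact: mpre.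
    by apply: bigcup_sub => k _; exact: subIsetl.
Qed.

Lemma vanishing_ae0 (g : T -> R) : intble mu D g ->
  (forall A, measurable A -> \int[mu]_(x in D `&` A) g x = 0) ->
  {ae mu, forall x, D x -> g x = 0}.
Proof.
move=> gi g0; have := @integral_ae_eq _ _ _ mu D mD (cst 0%E) (EFin \o g) gi.
move=> /(_ (measurable_cst _)); rewrite /ae_eq => h.
have /h : forall E, E `<=` D -> measurable E ->
    (\int[mu]_(x in E) (EFin \o g) x = \int[mu]_(x in E) cst 0 x)%E.
  move=> E ED mE; have := g0 E mE; rewrite setIidr// => gE.
  rewrite integral0 [LHS](@EFin_Rintegral _ _ _ _ _ _ g) ?gE//.
  exact: intbleS gi.
by apply: filterS => x + Dx => /(_ Dx) [].
Qed.

End Vanishing.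

(** * Continuously differentiable functions of one variable and bumps *)

Section C1.
Variable R : realType.
Implicit Types (f g phi : R -> R) (x v df : R).

Lemma is_derive_D f x v df : is_derive x 1 f df -> is_derive x v f (v * df).
Proof.
move=> [/derivable1_diffP df1 <-]; split; first exact: diff_derivable.
by rewrite !deriveE// -[in LHS](mulr1 v) -[v * 1]/(v *: 1) linearZ.
Qed.

Lemma C1_onI f f' : (forall x, is_derive x 1 f (f' x)) -> continuous f' ->
  C1_on setT f.
Proof.
move=> ff' cf' v; split => [x _|x _].
  by have [] := is_derive_D v (ff' x).
rewrite (_ : 'D_v f = fun x => v * f' x); first by apply: cvgM; [exact: cvg_cst|exact: cf'].
by apply/funext => y; have [] := is_derive_D v (ff' y).
Qed.

Lemma C1_on_derive f : C1_on setT f -> forall x, is_derive x 1 f (derive1 f x).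
Proof.
move=> Cf x; rewrite derive1E; apply/derivableP.
by have [/(_ x Logic.I)] := Cf 1.
Qed.

Lemma C1_on_continuous_derive f : C1_on setT f -> continuous (derive1 f).
Proof.
move=> Cf x; have [_ /(_ x Logic.I)] := Cf 1.
by rewrite (_ : derive1 f = 'D_1 f)//; apply/funext => y; rewrite derive1E.
Qed.

Lemma C1_on_continuous f : C1_on setT f -> continuous f.
Proof.
move=> Cf x; apply/differentiable_continuous/derivable1_diffP.
by have [] := C1_on_derive Cf x.
Qed.

Lemma derive1_val f x df : is_derive x 1 f df -> derive1 f x = df.
Proof. by move=> h; rewrite derive1E; apply: derive_val. Qed.

Lemma is_derive_quad f x d C :
  (forall h : R, `|f (x + h) - f x - h * d| <= C * h ^+ 2) ->
  is_derive x (1 : R) f d.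
Proof.
move=> fh.
have h : (fun h : R => h^-1 *: (f (h *: (1 : R) + x) - f x)) @ 0^' --> d.
  apply/cvgrPdist_le => e e0; near=> z.
  have z0 : z != 0 by near: z; exact: nbhs_dnbhs_neq.
  rewrite -[z *: 1]/(z * 1) mulr1 -[_ *: _]/(_ * _) distrC.
  rewrite (_ : _ - d = z^-1 * (f (x + z) - f x - z * d)); last first.
    by rewrite (addrC x) [in RHS]mulrBr mulKf.
  have z0' : 0 < `|z| by rewrite normr_gt0.
  rewrite normrM normfV ler_pdivrMl// (le_trans (fh z))//.
  rewrite -[z ^+ 2]ger0_norm ?sqr_ge0// normrX expr2 mulrCA ler_pM2l//.
  apply: (@le_trans _ _ (`|C| * `|z|)); first by rewrite ler_wpM2r// ler_norm.
  have C1 : 0 < `|C| + 1 by rewrite ltr_wpDl.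
  apply: (@le_trans _ _ ((`|C| + 1) * `|z|)); first by rewrite ler_wpM2r// lerDl.
  rewrite mulrC -ler_pdivlMr//; near: z; apply: dnbhs0_le.
  exact: divr_gt0.
split; first by apply/cvg_ex; exists d.
exact: (cvg_lim _ h).
Unshelve. all: by end_near. Qed.

Lemma derD f g x df dg : is_derive x (1 : R) f df -> is_derive x (1 : R) g dg ->
  is_derive x (1 : R) (fun y => f y + g y) (df + dg).
Proof. by move=> hf hg; exact: is_deriveD. Qed.

Lemma derB f g x df dg : is_derive x (1 : R) f df -> is_derive x (1 : R) g dg ->
  is_derive x (1 : R) (fun y => f y - g y) (df - dg).
Proof. by move=> hf hg; exact: is_deriveB. Qed.

Lemma derZ k f x df : is_derive x (1 : R) f df ->
  is_derive x (1 : R) (fun y => k * f y) (k * df).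
Proof. by move=> hf; exact: is_deriveZ. Qed.

Lemma derM f g x df dg : is_derive x (1 : R) f df -> is_derive x (1 : R) g dg ->
  is_derive x (1 : R) (fun y => f y * g y) (df * g x + f x * dg).
Proof.
move=> hf hg; rewrite addrC [df * _]mulrC; exact: is_deriveM.
Qed.

Definition pos2 (y : R) := (Num.max 0 y) ^+ 2.

Lemma is_derive_pos2 y : is_derive y (1 : R) pos2 (2 * Num.max 0 y).
Proof.
apply: (@is_derive_quad _ _ _ 1) => h; rewrite /pos2 mul1r ler_norml.
by case: (leP 0 y) => hy; case: (leP 0 (y + h)) => hyh; apply/andP; split; nra.
Qed.

Lemma continuous_pos2 : continuous pos2.
Proof.
move=> x; apply/differentiable_continuous/derivable1_diffP.
by have [] := is_derive_pos2 x.
Qed.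

(** [bump n a b] increases with n to the indicator of ]a, b[; subtracting
    1 / (n + 1) keeps its support at a positive distance from a and b. *)
Definition bumpq (n : nat) (a b x : R) : R := (x - a) * (b - x) - n.+1%:R^-1.
Definition bump (n : nat) (a b x : R) : R :=
  1 - (1 + n.+1%:R * pos2 (bumpq n a b x))^-1.
Definition dbump (n : nat) (a b x : R) : R :=
  (1 + n.+1%:R * pos2 (bumpq n a b x)) ^- 2 *
  (n.+1%:R * ((b - x - (x - a)) * (2 * Num.max 0 (bumpq n a b x)))).

Lemma pos2_ge0 y : 0 <= pos2 y. Proof. exact: sqr_ge0. Qed.

Lemma bump_den_gt0 n a b x : 0 < 1 + n.+1%:R * pos2 (bumpq n a b x).
Proof. by rewrite ltr_wpDr// mulr_ge0// pos2_ge0. Qed.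

Lemma is_derive_bumpq n a b x :
  is_derive x (1 : R) (bumpq n a b) (b - x - (x - a)).
Proof.
apply: (@is_derive_quad _ _ _ 1) => h; rewrite /bumpq mul1r.
by rewrite (_ : _ - _ - _ = - h ^+ 2) ?normrN ?ger0_norm ?sqr_ge0//; ring.
Qed.

Lemma is_derive_bump n a b x : is_derive x (1 : R) (bump n a b) (dbump n a b x).
Proof.
have d1 := is_derive_pos2 (bumpq n a b x).
have d2 := is_derive1_comp d1 (is_derive_bumpq n a b x).
have d0 := bump_den_gt0 n a b x.
have den : 1 + n.+1%:R * pos2 (bumpq n a b x) != 0 by rewrite gt_eqF.
pose den_ (y : R) := 1 + n.+1%:R * (pos2 \o bumpq n a b) y.
have d3 : is_derive x (1 : R) den_
    (n.+1%:R * (2 * Num.max 0 (bumpq n a b x) * (b - x - (x - a)))).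
  rewrite -[X in is_derive _ _ _ X]add0r.
  exact: (derD (is_derive_cst _ _ _) (derZ _ d2)).
have d4 : is_derive x (1 : R) (fun y => (den_ y)^-1)
   (- (den_ x) ^- 2 *: (n.+1%:R * (2 * Num.max 0 (bumpq n a b x) * (b - x - (x - a))))).
  exact: is_deriveV.
have := derB (is_derive_cst (1 : R) x (1 : R)) d4; set e := (X in is_derive _ _ _ X).
suff -> : e = dbump n a b x by [].
rewrite /e sub0r /dbump /den_ /= -[_ *: _]/(_ * _) mulNr opprK.
by congr (_ * (_ * _)); rewrite mulrC.
Qed.

Lemma continuous_bumpq n a b : continuous (bumpq n a b).
Proof.
move=> x; apply/differentiable_continuous/derivable1_diffP.
by have [] := is_derive_bumpq n a b x.
Qed.

Lemma continuous_bump n a b : continuous (bump n a b).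
Proof.
move=> x; apply/differentiable_continuous/derivable1_diffP.
by have [] := is_derive_bump n a b x.
Qed.

Lemma continuous_dbump n a b : continuous (dbump n a b).
Proof.
have c1 : continuous (fun x => 1 + n.+1%:R * pos2 (bumpq n a b x)).
  move=> x; apply: cvgD; first exact: cvg_cst.
  apply: cvgM; first exact: cvg_cst.
  apply: continuous_comp; first exact: continuous_bumpq.
  exact: continuous_pos2.
have c2 : continuous (fun x => (1 + n.+1%:R * pos2 (bumpq n a b x)) ^+ 2).
  by move=> x; exact: (continuous_comp (c1 x) (@exprn_continuous _ 2 _)).
have c3 : continuous (fun x => Num.max 0 (bumpq n a b x)).
  by move=> x; apply: continuous_max; [exact: cst_continuous|exact: continuous_bumpq].
move=> x; apply: cvgM.
  apply: cvgV; first by rewrite expf_neq0// gt_eqF// bump_den_gt0.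
  exact: c2.
apply: cvgM; first exact: cvg_cst.
apply: cvgM; first by apply: cvgB; apply: cvgB; try exact: cvg_cst; exact: cvg_id.
apply: cvgM; first exact: cvg_cst.
exact: c3.
Qed.

Lemma C1_on_bump n a b : C1_on setT (bump n a b).
Proof. by apply: C1_onI; [exact: is_derive_bump|exact: continuous_dbump]. Qed.

Lemma bump_ge0 n a b x : 0 <= bump n a b x.
Proof.
rewrite subr_ge0 invf_le1 ?bump_den_gt0// lerDl.
by rewrite mulr_ge0// pos2_ge0.
Qed.

Lemma bump_le1 n a b x : bump n a b x <= 1.
Proof. by rewrite gerBl invr_ge0 ltW// bump_den_gt0. Qed.

Lemma bump_eq0 n a b x : (x - a) * (b - x) <= n.+1%:R^-1 -> bump n a b x = 0.
Proof.
move=> h; rewrite /bump /pos2 max_l ?subr_le0// expr0n mulr0 addr0 invr1.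
by rewrite subrr.
Qed.

Lemma bump_cvg a b x : a < b -> bump n a b x @[n --> \oo] --> (\1_(`]a, b[) x : R).
Proof.
move=> ab; rewrite indicE; case: (boolP (x \in `]a, b[%classic)) => [|xab]; last first.
  apply: cvg_near_cst; apply: nearW => n.
  rewrite bump_eq0//; apply: (@le_trans _ _ 0); rewrite ?invr_ge0//.
  have : ~ (a < x < b) by move=> h; move/negP: xab; apply; rewrite inE/= in_itv.
  move=> h; have [xa|ax] := leP x a; first nra.
  have [bx|xb] := leP b x; first nra.
  by exfalso; apply: h; rewrite ax xb.
move=> /set_mem; rewrite /= in_itv/= => /andP[ax xb].
set c := (x - a) * (b - x); have c0 : 0 < c by rewrite mulr_gt0// subr_gt0.
rewrite -[X in _ --> X]subr0; apply: cvgB; first exact: cvg_cst.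
apply: (@squeeze_cvgr _ _ _ _ (fun=> 0) (fun n : nat => (4 / c ^+ 2) * n.+1%:R^-1)).
- near=> n.
  have n0 : (0 : R) < n.+1%:R by [].
  have nc : n.+1%:R^-1 <= c / 2.
    rewrite invf_ple ?posrE ?divr_gt0// invf_div.
    apply: (@le_trans _ _ n%:R); last by rewrite ler_nat.
    by near: n; exact: nbhs_infty_ger.
  rewrite invr_ge0 (ltW (bump_den_gt0 _ _ _ _))/=.
  rewrite -[4 / _]invf_div -invfM lef_pV2 ?posrE ?bump_den_gt0//; last first.
    by rewrite mulr_gt0// divr_gt0// exprn_gt0.
  apply: (@le_trans _ _ (n.+1%:R * pos2 (bumpq n a b x))); last by rewrite lerDr.
  rewrite mulrC ler_pM2l// /pos2 /bumpq -/c.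
  move: nc; set i := n.+1%:R^-1 => nc.
  rewrite max_r; [nra|lra].
- exact: cvg_cst.
- rewrite -[X in _ --> X](mulr0 (4 / c ^+ 2)); apply: cvgM; first apply: cvg_cst.
  exact: cvg_harmonic.
Unshelve. all: by end_near. Qed.

Lemma test_fun_bump (U : set R) n a b : a < b -> `]a, b[ `<=` U ->
  test_fun U (bump n a b).
Proof.
move=> ab abU; split; first exact: C1_on_bump.
exists [set x | x \in `[a, b] /\ n.+1%:R^-1 <= (x - a) * (b - x)]; split.
- apply: (@subclosed_compact _ _ `[a, b]).
  + have cl : closed [set x | n.+1%:R^-1 <= (x - a) * (b - x)].
      have -> : [set x | n.+1%:R^-1 <= (x - a) * (b - x)] =
          bumpq n a b @^-1` [set y | 0 <= y].
        by apply/seteqP; split => x /=; rewrite /bumpq subr_ge0.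
      by apply: (preimage_closed _ (@closed_ge _ _)) => ? _; exact: continuous_bumpq.
    by apply: closedI => //; exact: itv_closed.
  + exact: segment_compact.
  + by move=> x [].
- move=> x [+ h]; rewrite in_itv/= => /andP[ax xb]; apply: abU.
  have h0 : 0 < (x - a) * (b - x) by rewrite (lt_le_trans _ h)// invr_gt0.
  by rewrite /= in_itv/=; apply/andP; split; nra.
- move=> x /= h; apply: bump_eq0; rewrite leNgt; apply/negP => h1; apply: h.
  have h0 : 0 < (x - a) * (b - x) by rewrite (lt_trans _ h1)// invr_gt0.
  split; last exact: ltW.
  by rewrite in_itv/=; apply/andP; split; nra.
Qed.

End C1.

(** * The fundamental lemma and primitives on an interval *)

Section Line.
Variable R : realType.
Notation mu := (@lebesgue_measure R).
Implicit Types (f g phi : R -> R) (x y c L : R).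

(** By dominated convergence: the bumps tend to the indicator of ]a, b[. *)
Lemma Rintegral_bump_lim (D : set R) g a b : measurable D -> intble mu D g ->
  a < b -> (forall n, \int[mu]_(x in D) (g x * bump n a b x) = 0) ->
  \int[mu]_(x in D `&` `]a, b[) g x = 0.
Proof.
move=> mD gi ab g0.
have mg := intble_meas gi.
have mb n : measurable_fun D (bump n a b).
  by apply: measurable_funTS; apply: continuous_measurable_fun; exact: continuous_bump.
have mi : measurable_fun D (\1_(`]a, b[) : R -> R).
  by apply: measurable_indic; exact: measurable_itv.
have gbi n : intble mu D (fun x => g x * bump n a b x).
  apply: (@le_intble _ _ _ mu _ _ _ (fun x => `|g x|)) => //.
  - apply: measurable_funM. exact: mg. exact: mb.
  - move=> x _; rewrite normrM ler_piMr// ger0_norm ?bump_ge0//; exact: bump_le1.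
  - exact: integrable_norm.
have [] := @dominated_convergence _ _ _ mu D mD
  (fun n x => (g x * bump n a b x)%:E) (fun x => (g x * \1_(`]a, b[) x)%:E)
  (fun x => `|g x|%:E).
- by move=> n; apply/measurable_EFinP; exact: intble_meas.
- apply/measurable_EFinP; apply: measurable_funM; first exact: mg.
  exact: mi.
- apply: aeW => x _; apply: cvg_EFin; first exact: nearW.
  by apply: cvgM; [exact: cvg_cst|exact: bump_cvg].
- exact: integrable_norm.
- apply: aeW => x n _ /=; rewrite lee_fin normrM ler_piMr// ger0_norm ?bump_ge0//.
  exact: bump_le1.
move=> _ _ /=; rewrite (_ : (fun _ => _) = fun=> 0%E); last first.
  by apply/funext => n; rewrite EFin_Rintegral ?g0.
move=> h; have {}h := cvg_unique (@ereal_hausdorff R) h (cvg_cst _).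
rewrite Rintegral_mkcondr /Rintegral.
rewrite (_ : integral _ _ _ = integral mu D (fun x => (g x * \1_(`]a, b[) x)%:E)).
  by rewrite h.
apply: eq_integral => x _; rewrite patchE indicE.
by case: ifPn => _; rewrite ?mulr1 ?mulr0.
Qed.

(** The open intervals generate the Borel sets, so it is enough that g has zero
    integral over each of them, and bumps approximate their indicators. *)
Lemma fundamental_lemma_itv L g : intble mu `]0, L[ g ->
  (forall n a b, 0 <= a -> a < b -> b <= L ->
    \int[mu]_(x in `]0, L[) (g x * bump n a b x) = 0) ->
  {ae mu, forall x, `]0, L[%classic x -> g x = 0}.
Proof.
move=> gi g0.
have mI : measurable (`]0, L[ : set R) by exact: measurable_itv.
have gab a b : 0 <= a -> b <= L -> \int[mu]_(x in `]0, L[ `&` `]a, b[) g x = 0.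
  move=> a0 bL; have [ab|ba] := ltP a b.
    by apply: Rintegral_bump_lim => // n; exact: g0.
  have -> : `]a, b[%classic = set0 :> set R.
    by apply: set_itv_ge; rewrite bnd_simp -leNgt.
  by rewrite setI0 Rintegral_set0.
apply: vanishing_ae0 => // A mA.
rewrite -[A]/((@id (measurableTypeR R)) @^-1` A).
refine (@vanishing_generated _ _ _ mu _ _ _ (measurableTypeR R) id (@RGenOpens.G R) g _ _ _ _ _ _ A mA) => //.
- exact: RGenOpens.measurableE.
- move=> _ _ [a [b ->]] [c [d ->]].
  exists (Num.max a c), (Num.min b d); apply/seteqP; split => x /=.
    rewrite !in_itv/= => -[/andP[ax xb] /andP[cx xd]].
    by rewrite gt_max lt_min ax xb cx xd.
  by rewrite !in_itv/= gt_max lt_min => /andP[/andP[-> ->] /andP[-> ->]].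
- by have := gab 0 L (lexx _) (lexx _); rewrite setIid.
- move=> _ [a [b ->]]; rewrite preimage_id.
  rewrite (_ : _ `&` _ = `]0, L[%classic `&` `](Num.max 0 a), (Num.min L b)[%classic).
    by apply: gab; [rewrite le_max lexx|rewrite ge_min lexx].
  apply/seteqP; split => x /=; rewrite !in_itv/= gt_max lt_min.
    by move=> [/andP[-> ->] /andP[-> ->]].
  by move=> [_ /andP[/andP[-> ->] /andP[-> ->]]].
Qed.

Definition prim g x : R := \int[mu]_(y in `]0, x[) g y.

Lemma prim0 g : prim g 0 = 0.
Proof. by rewrite /prim set_itv_ge ?bnd_simp ?ltxx// Rintegral_set0. Qed.

Section Primitive.
Variable L : R.
Notation I := (`]0, L[%classic : set R).

Let mI : measurable I. Proof. exact: measurable_itv. Qed.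

Lemma mu_itv_lty : (mu I < +oo)%E.
Proof. by rewrite lebesgue_measure_itv/=; case: ifP => _; rewrite ?ltry. Qed.

Lemma subset_itv0 x : x <= L -> (`]0, x[ : set R) `<=` I.
Proof.
move=> xL y /=; rewrite !in_itv/= => /andP[-> yx]; exact: lt_le_trans xL.
Qed.

Lemma prim_intble g x : x <= L -> intble mu I g -> intble mu `]0, x[ g.
Proof.
move=> xL; apply: intbleS; [exact: measurable_itv|exact: mI|exact: subset_itv0].
Qed.

Lemma prim_bound g x : x <= L -> intble mu I g ->
  `|prim g x| <= \int[mu]_(y in I) `|g y|.
Proof.
move=> xL gi; have gx := prim_intble xL gi.
apply: (@le_trans _ _ (\int[mu]_(y in `]0, x[) `|g y|)).
  exact: le_normr_Rintegral.
rewrite -[leLHS](@Rintegral_patch _ _ _ mu I)//; last exact: subset_itv0.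
apply: le_Rintegral => //.
- apply: (@intble_patch _ _ _ mu I `]0, x[%classic (fun y => `|g y|) mI
    (measurable_itv _) (@subset_itv0 x xL)).1.
  exact: integrable_norm.
- exact: integrable_norm.
- by move=> y _; rewrite patchE; case: ifP => _ /=; [exact: lexx|exact: normr_ge0].
Qed.

Lemma primD g1 g2 x : x <= L -> intble mu I g1 -> intble mu I g2 ->
  prim (fun y => g1 y + g2 y) x = prim g1 x + prim g2 x.
Proof. by move=> xL i1 i2; rewrite /prim RintegralD//; exact: prim_intble. Qed.

(* The integrand on the triangle y < x; its two iterated integrals give the
   two terms of the integration by parts. *)
Let tri g1 g2 (z : R * R) : R :=
  (g2 \_ I) z.1 * (g1 \_ I) z.2 * (z.2 < z.1)%R%:R.

Let patch_meas g : intble mu I g -> measurable_fun setT (g \_ I).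
Proof. by move=> i1; exact: (measurable_restrictT g mI).1 (intble_meas i1). Qed.

Let tri_meas g1 g2 : intble mu I g1 -> intble mu I g2 ->
  measurable_fun [set: measurableTypeR R * measurableTypeR R] (tri g1 g2).
Proof.
move=> i1 i2; have m1 := patch_meas i1; have m2 := patch_meas i2.
apply: measurable_funM; first apply: measurable_funM.
- exact: (measurableT_comp m2 (@measurable_fst _ _ _ _)).
- exact: (measurableT_comp m1 (@measurable_snd _ _ _ _)).
- have h := @measurable_fun_ltr _ _ R setT snd fst
    (@measurable_snd _ _ (measurableTypeR R) (measurableTypeR R))
    (@measurable_fst _ _ (measurableTypeR R) (measurableTypeR R)).
  have hb : measurable_fun [set: bool] (fun b : bool => b%:R : R).
    by [].
  exact: (measurableT_comp hb h).
Qed.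

Let intble_patchT g : intble mu I g -> intble mu setT (g \_ I).
Proof.
move=> i1; apply: (@intble_patch _ _ _ mu setT I g _ mI _).1 => //.
Qed.

Let tri_intble g1 g2 : intble mu I g1 -> intble mu I g2 ->
  (mu \x mu)%E.-integrable setT (EFin \o tri g1 g2).
Proof.
move=> i1 i2; have mt := tri_meas i1 i2.
apply/integrable12ltyP; first exact/measurable_EFinP.
have ig1 := integrable_norm (intble_patchT i1).
have ig2 := integrable_norm (intble_patchT i2).
set K := \int[mu]_y `|(g1 \_ I) y|.
apply: (@le_lt_trans _ _ (\int[mu]_x (K * `|(g2 \_ I) x|)%:E)%E).
  apply: ge0_le_integral => //.
  - by move=> x _; apply: integral_ge0.
  - apply: (@measurable_fun_fubini_tonelli_F _ _ _ _ _ mu (fun z => `|(tri g1 g2 z)%:E|)%E) => //.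
    by apply: measurableT_comp => //; exact/measurable_EFinP.
  - apply/measurable_EFinP; apply: measurable_funM; first exact: measurable_cst.
    exact: (intble_meas ig2).
  - move=> x _; rewrite /K EFinM muleC -(EFin_Rintegral measurableT ig1).
    rewrite -ge0_integralZl//. 2: exact: (measurable_int mu ig1).
    apply: ge0_le_integral => //.
    + apply: measurableT_comp => //; apply/measurable_EFinP.
      exact: (measurableT_comp mt (@pair1_measurable _ _ _ _ x)).
    + apply: emeasurable_funM; first exact: measurable_cst.
      exact: (measurable_int mu ig1).
    + move=> y _; rewrite lee_fin /tri /= !normrM ler_piMr ?mulr_ge0//.
      by case: (y < x)%R; rewrite ?normr1 ?normr0.
  by move=> y _; rewrite lee_fin normr_ge0.
exact: (integrable_lty measurableT (intbleZ measurableT K ig2)).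
Qed.

Let tri_inner1 g1 g2 x : intble mu I g1 ->
  (\int[mu]_y (tri g1 g2 (x, y))%:E)%E = ((g2 \_ I) x * prim g1 x)%:E.
Proof.
move=> i1; rewrite /tri /= !patchE; case: ifPn => [/set_mem xI|_]; last first.
  by under eq_integral do rewrite !mul0r; rewrite mul0r integral0.
have xL : x <= L by move: xI; rewrite /= in_itv/= => /andP[_ /ltW].
transitivity (\int[mu]_y (g2 x * (g1 \_ (`]0, x[)) y)%:E)%E.
  apply: eq_integral => y _; rewrite -mulrA !patchE; congr (_ * _)%:E.
  have [yx|xy] := ltP y x.
    rewrite mulr1; have [y0|y0] := ltP 0 y.
      by rewrite !mem_set //= in_itv/= y0//= (lt_le_trans yx).
    by rewrite !memNset //= in_itv/= ltNge y0.
  by rewrite mulr0 memNset //= in_itv/= (ltNge y x) xy andbF.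
have ip : intble mu setT (g1 \_ (`]0, x[)).
  apply: (@intble_patch _ _ _ mu setT `]0, x[%classic g1 _ _ _).1 => //.
  exact: prim_intble.
rewrite (EFin_Rintegral measurableT (intbleZ measurableT (g2 x) ip)).
by rewrite (RintegralZl _ measurableT ip) Rintegral_patch.
Qed.

Let tri_inner2 g1 g2 y : intble mu I g2 ->
  (\int[mu]_x (tri g1 g2 (x, y))%:E)%E = ((g1 \_ I) y * (prim g2 L - prim g2 y))%:E.
Proof.
move=> i2; rewrite /tri /= [(g1 \_ I) y]patchE; case: ifPn => [/set_mem yI|_]; last first.
  by under eq_integral do rewrite mulr0 mul0r; rewrite mul0r integral0.
have yL : y <= L by move: yI; rewrite /= in_itv/= => /andP[_ /ltW].
have yL' : y < L by move: yI; rewrite /= in_itv/= => /andP[].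
have y0 : 0 < y by move: yI; rewrite /= in_itv/= => /andP[].
have yLI : (`]y, L[ : set R) `<=` I.
  by move=> x /=; rewrite !in_itv/= => /andP[yx ->]; rewrite (lt_trans y0).
have iyL : intble mu setT (g2 \_ (`]y, L[)).
  apply: (@intble_patch _ _ _ mu setT `]y, L[%classic g2 _ _ _).1 => //.
  by apply: intbleS i2 => //; exact: mI.
transitivity (\int[mu]_x (g1 y * (g2 \_ (`]y, L[)) x)%:E)%E.
  apply: eq_integral => x _; rewrite (mulrC _ (g1 y)) -mulrA !patchE; congr (_ * _)%:E.
  have [yx|xy] := ltP y x.
    rewrite mulr1; have [xL|xL] := ltP x L.
      by rewrite !mem_set //= in_itv/= ?yx// xL (lt_trans y0).
    by rewrite !memNset //= in_itv/= (ltNge x) xL andbF.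
  by rewrite mulr0 memNset //= in_itv/= ltNge xy.
rewrite (EFin_Rintegral measurableT (intbleZ measurableT (g1 y) iyL)).
rewrite (RintegralZl _ measurableT iyL) Rintegral_patch//; congr (_ * _)%:E.
rewrite /prim.
have e : \int[mu]_(x in `]0, y[) g2 x = \int[mu]_(x in `]0, y]) g2 x.
  by apply: Rintegral_itv_bndo_bndc; exact: prim_intble.
by rewrite e Rintegral_itvB ?bnd_simp ?(ltW y0)//.
Qed.

Lemma measurable_prim g : intble mu I g -> measurable_fun I (prim g).
Proof.
move=> i1.
have lt := mu_itv_lty.
have i2 : intble mu I (fun=> 1) by exact: intble_cst.
have m : measurable_fun setT (fun x => ((cst 1 : R -> R) \_ I) x * prim g x).
  apply/measurable_EFinP.
  apply: eq_measurable_fun (measurable_fubini_F (tri_intble i1 i2)) => x _.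
  exact: (tri_inner1 _ x i1).
apply: eq_measurable_fun (measurable_funTS m) => x xI.
by rewrite patchE xI mul1r.
Qed.

Lemma prim_Fubini g1 g2 : intble mu I g1 -> intble mu I g2 ->
  \int[mu]_(x in I) (g2 x * prim g1 x) =
  \int[mu]_(y in I) (g1 y * (prim g2 L - prim g2 y)).
Proof.
move=> i1 i2.
have := Fubini (tri_intble i1 i2).
under eq_integral do rewrite /= tri_inner1//.
under [X in _ = X -> _]eq_integral do rewrite /= tri_inner2//.
move=> /(congr1 fine) e.
rewrite -(@Rintegral_patch _ _ _ mu setT I)// -[RHS](@Rintegral_patch _ _ _ mu setT I)//.
rewrite (@eq_Rintegral _ _ _ mu setT (fun x => (g2 \_ I) x * prim g1 x)); last first.
  by move=> x _; rewrite !patchE; case: ifP => // _; rewrite mul0r.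
rewrite [RHS](@eq_Rintegral _ _ _ mu setT (fun y => (g1 \_ I) y * (prim g2 L - prim g2 y))).
  exact: e.
by move=> x _; rewrite !patchE; case: ifP => // _; rewrite mul0r.
Qed.

Lemma intbleM_prim g1 g2 : intble mu I g1 -> intble mu I g2 ->
  intble mu I (fun x => g2 x * prim g1 x).
Proof.
move=> i1 i2; set K := \int[mu]_(y in I) `|g1 y|.
apply: (@le_intble _ _ _ mu _ _ _ (fun x => K * `|g2 x|)) => //.
- apply: measurable_funM; first exact: (intble_meas i2).
  exact: measurable_prim.
- move=> x xI; rewrite normrM mulrC ler_wpM2r//; apply: prim_bound => //.
  by move: xI; rewrite /= in_itv/= => /andP[_ /ltW].
- by apply: intbleZ => //; exact: integrable_norm.
Qed.

(** Integration by parts: both sides are the integral of g1(x) g2(y) over the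
    square, split along its diagonal. *)
Lemma prim_by_parts g1 g2 : intble mu I g1 -> intble mu I g2 ->
  \int[mu]_(x in I) (g2 x * prim g1 x + g1 x * prim g2 x) = prim g1 L * prim g2 L.
Proof.
move=> i1 i2.
rewrite RintegralD//; [|exact: intbleM_prim|exact: intbleM_prim].
rewrite prim_Fubini//.
rewrite -RintegralD//; [| |exact: intbleM_prim]; last first.
  apply: (@eq_intble _ _ _ mu _ _ (fun x => prim g2 L * g1 x - g1 x * prim g2 x)) => //.
    by move=> x _; rewrite mulrBr (mulrC (prim g2 L)).
  by apply: intbleB => //; [exact: intbleZ|exact: intbleM_prim].
rewrite (@eq_Rintegral _ _ _ mu _ (fun x => prim g2 L * g1 x)); last first.
  by move=> x _; rewrite -mulrDr subrK mulrC.
by rewrite RintegralZl// mulrC.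
Qed.

End Primitive.
End Line.

(** * Weak derivatives on an interval *)

#[global] Instance ae_leb_filter (R : realType) :
  Filter (nbhs (almost_everywhere (@lebesgue_measure R))).
Proof. exact: (ae_filter_ringOfSetsType (@lebesgue_measure R)). Qed.

Section WeakDerivative.
Variables (R : realType) (L : R).
Hypothesis L0 : 0 < L.
Notation mu := (@lebesgue_measure R).
Notation I := (`]0, L[%classic : set (measurableTypeR R)).
Implicit Types (f g h phi : R -> R) (x y c : R).

Let mI : measurable I. Proof. exact: measurable_itv. Qed.
Let I_lty : (mu I < +oo)%E. Proof. exact: mu_itv_lty. Qed.

Lemma fine_mu_itv : fine (mu I) = L.
Proof. by rewrite lebesgue_measure_itv/= lte_fin L0/= subr0. Qed.

Lemma measurable_continuous f : continuous f -> measurable_fun I f.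
Proof. by move=> cf; apply: measurable_funTS; exact: continuous_measurable_fun. Qed.

Lemma aeI (P Q S : R -> Prop) : (forall x, I x -> P x -> Q x -> S x) ->
  {ae mu, forall x, I x -> P x} -> {ae mu, forall x, I x -> Q x} ->
  {ae mu, forall x, I x -> S x}.
Proof.
by move=> PQS; apply: filterS2 => x Px Qx Ix; apply: PQS => //; [exact: Px|exact: Qx].
Qed.

Lemma continuous_bounded f : continuous f ->
  exists2 K, 0 < K & forall x, 0 <= x <= L -> `|f x| <= K.
Proof.
move=> cf; have [|c _ hc] := @EVT_max R (fun x => `|f x|) 0 L (ltW L0).
  apply: continuous_subspaceT => x; apply: cvg_norm; exact: cf.
exists (`|f c| + 1); first by rewrite ltr_wpDl.
by move=> x xI; rewrite (le_trans (hc x _))// ?in_itv// lerDl.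
Qed.

Lemma continuous_intble f : continuous f -> intble mu I f.
Proof.
move=> cf; have [K _ fK] := continuous_bounded cf.
apply: (@bounded_intble _ _ _ mu _ _ _ K) => //; first exact: measurable_continuous.
apply: aeW => x /=; rewrite in_itv/= => /andP[/ltW x0 /ltW xL].
by apply: fK; rewrite x0 xL.
Qed.

Lemma C1_FTC phi : C1_on setT phi -> forall a b, a < b ->
  (\int[mu]_(y in `]a, b[) (derive1 phi y)%:E)%E = (phi b - phi a)%:E.
Proof.
move=> Cphi a b ab.
have cd := C1_on_continuous_derive Cphi.
rewrite -(@integral_itv_bndoo _ a b _ true false); last first.
  apply/measurable_EFinP; apply: measurable_funTS.
  exact: continuous_measurable_fun.
rewrite EFinB; apply: (@continuous_FTC2 R (derive1 phi) phi a b ab).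
- exact: continuous_subspaceT.
- split => //.
  + by move=> y _; have [] := C1_on_derive Cphi y.
  + by apply: cvg_at_right_filter; exact: C1_on_continuous.
  + by apply: cvg_at_left_filter; exact: C1_on_continuous.
- by [].
Qed.

Lemma C1_prim phi : C1_on setT phi ->
  forall x, 0 <= x -> phi x = phi 0 + prim (derive1 phi) x.
Proof.
move=> Cphi x; rewrite le_eqVlt => /predU1P[<-|x0]; first by rewrite prim0 addr0.
by rewrite /prim /Rintegral (C1_FTC Cphi x0) /= addrC subrK.
Qed.

Lemma test_fun_ends phi : test_fun `]0, L[ phi -> phi 0 = 0 /\ phi L = 0.
Proof.
move=> [_ [K [_ KI K0]]]; split; apply: K0 => /KI/=; rewrite in_itv/=.
  by rewrite ltxx.
by rewrite ltxx andbF.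
Qed.

Definition wder1 f g := forall phi, test_fun `]0, L[ phi ->
  \int[mu]_(x in I) (f x * derive1 phi x) = - \int[mu]_(x in I) (g x * phi x).

(** Absolute continuity of f with derivative g, up to equality almost everywhere. *)
Definition acrep f g := exists c, {ae mu, forall x, I x -> f x = c + prim g x}.

Lemma intbleMC f phi : intble mu I f -> continuous phi ->
  intble mu I (fun x => f x * phi x).
Proof.
move=> fi cphi; have [K _ phiK] := continuous_bounded cphi.
apply: (@le_intble _ _ _ mu _ _ _ (fun x => K * `|f x|)) => //.
- apply: measurable_funM; first exact: (intble_meas fi).
  exact: measurable_continuous.
- move=> x /=; rewrite in_itv/= => /andP[/ltW x0 /ltW xL].
  by rewrite normrM mulrC ler_wpM2r// phiK// x0 xL.
- by apply: intbleZ => //; exact: integrable_norm.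
Qed.

(** Integration by parts against a function that is C^1 up to the ends of the
    interval. *)
Lemma prim_by_parts_C1 c g phi : intble mu I g -> C1_on setT phi ->
  \int[mu]_(x in I) ((c + prim g x) * derive1 phi x) +
  \int[mu]_(x in I) (g x * phi x) = (c + prim g L) * phi L - c * phi 0.
Proof.
move=> gi Cphi; have cphi := C1_on_continuous Cphi.
have cd := C1_on_continuous_derive Cphi.
have di := continuous_intble cd.
have phiE := C1_prim Cphi.
have -> : \int[mu]_(x in I) (g x * phi x) =
    phi 0 * prim g L + \int[mu]_(x in I) (g x * prim (derive1 phi) x).
  rewrite /prim -RintegralZl// -RintegralD//; [|exact: intbleZ|exact: intbleM_prim].
  apply: eq_Rintegral => x /set_mem /=; rewrite in_itv/= => /andP[/ltW x0 _].
  by rewrite [phi x]phiE// mulrDr mulrC.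
have -> : \int[mu]_(x in I) ((c + prim g x) * derive1 phi x) =
    c * prim (derive1 phi) L + \int[mu]_(x in I) (derive1 phi x * prim g x).
  rewrite /prim -RintegralZl// -RintegralD//; [|exact: intbleZ|exact: intbleM_prim].
  by apply: eq_Rintegral => x _; rewrite mulrDl; congr (_ + _); exact: mulrC.
have e := prim_by_parts gi di.
rewrite RintegralD in e; [|by []|exact: intbleM_prim|exact: intbleM_prim].
by rewrite (phiE L) ?ltW//; lra.
Qed.

Lemma prim_wder1 c g : intble mu I g -> wder1 (fun x => c + prim g x) g.
Proof.
move=> gi phi tphi; have [e0 eL] := test_fun_ends tphi.
have := prim_by_parts_C1 c gi (proj1 tphi).
by rewrite e0 eL !mulr0 subrr => /eqP; rewrite addr_eq0 => /eqP.
Qed.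

Lemma measurable_acrep c g : intble mu I g -> measurable_fun I (fun x => c + prim g x).
Proof.
by move=> gi; apply: measurable_funD; [exact: measurable_cst|exact: measurable_prim].
Qed.

Lemma ae_eq_RintegralMC f1 f2 phi : measurable_fun I f1 -> measurable_fun I f2 ->
  continuous phi -> {ae mu, forall x, I x -> f1 x = f2 x} ->
  \int[mu]_(x in I) (f1 x * phi x) = \int[mu]_(x in I) (f2 x * phi x).
Proof.
move=> m1 m2 cphi e; apply: ae_eq_Rintegral => //.
- by apply: measurable_funM => //; exact: measurable_continuous.
- by apply: measurable_funM => //; exact: measurable_continuous.
- by apply: filterS e => x e Ix; rewrite e.
Qed.

Lemma acrep_wder1 f g : measurable_fun I f -> intble mu I g -> acrep f g -> wder1 f g.
Proof.
move=> mf gi [c fE] phi tphi; rewrite -(prim_wder1 c gi tphi).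
apply: ae_eq_RintegralMC => //; first exact: measurable_acrep.
by apply: C1_on_continuous_derive; case: tphi.
Qed.

Lemma wder1_unique f g1 g2 : intble mu I g1 -> intble mu I g2 ->
  wder1 f g1 -> wder1 f g2 -> {ae mu, forall x, I x -> g1 x = g2 x}.
Proof.
move=> i1 i2 w1 w2.
have : {ae mu, forall x, I x -> g1 x - g2 x = 0}.
  apply: fundamental_lemma_itv; first exact: intbleB.
  move=> n a b a0 ab bL.
  have tb : test_fun `]0, L[ (bump n a b).
    apply: test_fun_bump => // x /=; rewrite !in_itv/= => /andP[ax xb].
    by rewrite (le_lt_trans a0 ax) (lt_le_trans xb bL).
  have cb := @continuous_bump R n a b.
  under eq_Rintegral do rewrite mulrBl.
  rewrite RintegralB//; [|exact: intbleMC|exact: intbleMC].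
  have := w1 _ tb; rewrite (w2 _ tb) => /oppr_inj ->; exact: subrr.
by apply: filterS => x + Ix => /(_ Ix) /eqP; rewrite subr_eq0 => /eqP.
Qed.

End WeakDerivative.

Section DuBoisReymond.
Variables (R : realType) (L : R).
Hypothesis L0 : 0 < L.
Notation mu := (@lebesgue_measure R).
Notation I := (`]0, L[%classic : set (measurableTypeR R)).
Implicit Types (f g h phi : R -> R) (x y c : R).

Let mI : measurable I. Proof. exact: measurable_itv. Qed.
Let I_lty : (mu I < +oo)%E. Proof. exact: mu_itv_lty. Qed.

Lemma bump_supp n a b : 0 <= a -> a < b -> b <= L ->
  exists al be, [/\ 0 < al, al <= be, be < L &
    forall x, ~~ (al <= x <= be) -> bump n a b x = 0].
Proof.
move=> a0 ab bL; pose d := Num.min (n.+1%:R^-1 / (b - a)) ((b - a) / 2).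
have ba : 0 < b - a by rewrite subr_gt0.
have d0 : 0 < d by rewrite lt_min !divr_gt0.
have d1 : d * (b - a) <= n.+1%:R^-1.
  by rewrite -ler_pdivlMr// /d ge_min lexx.
have d2 : d <= (b - a) / 2 by rewrite /d ge_min lexx orbT.
move: d d0 d1 d2 => d d0 d1 d2.
exists (a + d), (b - d); split; [lra|lra|lra|] => x; rewrite negb_and -!ltNge => xab.
apply: bump_eq0; apply: le_trans d1.
by case/orP: xab => xab; have [xa|xa] := leP x a; have [bx|bx] := leP b x; nra.
Qed.

(** A continuous function with compact support in the interval and zero mean
    is the derivative of a test function. *)
Lemma zero_mean_test_fun chi al be : continuous chi -> 0 < al -> al <= be -> be < L ->
  (forall x, ~~ (al <= x <= be) -> chi x = 0) ->
  \int[mu]_(x in I) chi x = 0 ->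
  exists2 phi, test_fun `]0, L[ phi & derive1 phi = chi.
Proof.
move=> cchi al0 albe beL chi0 mean0.
pose K : set (measurableTypeR R) := `[al, be]%classic.
have mK : measurable K by exact: measurable_itv.
have KI : K `<=` I.
  move=> x; rewrite /K/= !in_itv/= => /andP[h1 h2].
  by rewrite (lt_le_trans al0 h1) (le_lt_trans h2 beL).
have chiK : chi \_ K = chi.
  apply/funext => x; rewrite patchE; case: ifPn => // /negP xK.
  rewrite chi0//; apply/negP => h; apply: xK; rewrite inE /K/= in_itv/=.
  exact: h.
have iK : intble mu K chi by apply: (intbleS mK mI KI); exact: continuous_intble.
have iT : intble mu setT chi.
  by rewrite -chiK; apply: (@intble_patch _ _ _ mu setT K chi _ _ _).1.
pose phi x := \int[mu]_(t in `]-oo, x]) chi t.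
have dphi x : is_derive x 1 phi (chi x).
  have [] := @continuous_FTC1 R chi -oo%O x (x + 1) _ _ _ (cchi x).
  - by rewrite ltrDl.
  - by apply: intbleS iT => //; exact: measurable_itv.
  - exact: ltNyr.
  by move=> d1 d2; split; [exact: d1|rewrite -derive1E].
have dE : derive1 phi = chi by apply/funext => x; exact: derive1_val.
exists phi => //; split.
  exact: (C1_onI dphi cchi).
exists (`[al, be]%classic); split; first exact: segment_compact.
  exact: KI.
move=> x /=; rewrite in_itv/= => /negP xab; rewrite /phi.
have [xal|alx] := ltP x al.
  rewrite (@eq_Rintegral _ _ _ mu _ (cst 0)).
    by rewrite /Rintegral integral0.
  move=> t /set_mem /=; rewrite in_itv/= => tx; rewrite chi0//.
  by rewrite negb_and -ltNge (le_lt_trans tx xal).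
have bex : be < x by rewrite ltNge; apply/negP => h; move: xab; rewrite alx h.
rewrite -chiK Rintegral_patch; last first.
  move=> t; rewrite /K/= !in_itv/= => /andP[_ tb].
  by rewrite (le_trans tb (ltW bex)).
by rewrite -(@Rintegral_patch _ _ _ mu I)// chiK.
Qed.

Lemma Rintegral_bump_neq0 : exists n, \int[mu]_(x in I) bump n 0 L x != 0.
Proof.
apply: contrapT => h.
have h0 n : \int[mu]_(x in I) bump n 0 L x = 0.
  by apply: contrapT => /eqP hn; apply: h; exists n.
have := @Rintegral_bump_lim R I (cst 1) 0 L mI (intble_cst mI I_lty 1) L0.
rewrite setIid Rintegral_cst// mul1r fine_mu_itv//.
move=> H; have : L = 0.
  apply: H => n; rewrite -[RHS](h0 n); apply: eq_Rintegral => x _; exact: mul1r.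
by move/eqP; rewrite gt_eqF.
Qed.

(** Subtracting a multiple of one fixed bump from any other bump leaves a function
    of zero mean, that is, the derivative of a test function; c is the average of
    h against the fixed bump. *)
Lemma du_Bois_Reymond h : intble mu I h ->
  (forall phi, test_fun `]0, L[ phi -> \int[mu]_(x in I) (h x * derive1 phi x) = 0) ->
  exists c, {ae mu, forall x, I x -> h x = c}.
Proof.
move=> hi htest; have [N rho0] := Rintegral_bump_neq0.
set r := \int[mu]_(x in I) bump N 0 L x in rho0.
pose c := (\int[mu]_(x in I) (h x * bump N 0 L x)) / r.
exists c; suff : {ae mu, forall x, I x -> h x - c = 0}.
  by apply: filterS => x + Ix => /(_ Ix) /eqP; rewrite subr_eq0 => /eqP.
have ic : intble mu I (fun=> c) by exact: intble_cst.
apply: fundamental_lemma_itv; first exact: intbleB.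
move=> n a b a0 ab bL.
have cb : continuous (bump n a b) by exact: continuous_bump.
have cB : continuous (bump N 0 L) by exact: continuous_bump.
set s := \int[mu]_(x in I) bump n a b x.
pose chi x := bump n a b x - (s / r) * bump N 0 L x.
have cchi : continuous chi.
  move=> x; apply: cvgB; first exact: cb.
  by apply: cvgM; [exact: cvg_cst|exact: cB].
have [al1 [be1 [h1 h2 h3 h4]]] := bump_supp n a0 ab bL.
have [al2 [be2 [k1 k2 k3 k4]]] := bump_supp N (lexx 0) L0 (lexx L).
have [] := @zero_mean_test_fun chi (Num.min al1 al2) (Num.max be1 be2) cchi.
- by rewrite lt_min h1.
- by rewrite le_max ge_min h2.
- by rewrite gt_max h3.
- move=> x hx; rewrite /chi h4 ?k4 ?mulr0 ?subr0//.
    apply: contraNN hx => /andP[u v].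
    by rewrite ge_min u orbT/= le_max v orbT.
  by apply: contraNN hx => /andP[u v]; rewrite ge_min u /= le_max v.
- rewrite /chi RintegralB//; [|exact: continuous_intble|].
    rewrite RintegralZl//; last exact: continuous_intble.
    by rewrite -/s -/r divfK// subrr.
  by apply: intbleZ => //; exact: continuous_intble.
move=> phi tphi dphi; have := htest _ tphi; rewrite dphi /chi.
under eq_Rintegral do rewrite mulrBr.
rewrite RintegralB//; [|exact: intbleMC|]; last first.
  apply: (@eq_intble _ _ _ mu _ _ (fun x => (s / r) * (h x * bump N 0 L x))) => //.
    by move=> x _; rewrite mulrCA.
  by apply: intbleZ => //; exact: intbleMC.
under [X in _ - X]eq_Rintegral do rewrite mulrCA.
rewrite RintegralZl//; last exact: intbleMC.
move=> e.
under eq_Rintegral do rewrite mulrBl.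
rewrite RintegralB//; [|exact: intbleMC|exact: intbleMC].
rewrite RintegralZl//; last exact: continuous_intble.
rewrite -/s /c -[RHS]e; congr (_ - _); by field.
Qed.

(** The difference f - prim g has zero weak derivative, hence it is constant. *)
Lemma wder1_acrep f g : intble mu I f -> intble mu I g -> wder1 L f g -> acrep L f g.
Proof.
move=> fi gi fg.
have [|phi tphi|c hc] := @du_Bois_Reymond (fun x => f x - prim g x).
- apply: intbleB => //.
  apply: (@eq_intble _ _ _ mu _ _ (fun x => 1 * prim g x)) => //.
    by move=> x _; rewrite mul1r.
  by apply: intbleM_prim => //; exact: intble_cst.
- have pi : intble mu I (prim g).
    apply: (@eq_intble _ _ _ mu _ _ (fun x => 1 * prim g x)) => //.
      by move=> x _; rewrite mul1r.
    by apply: intbleM_prim => //; exact: intble_cst.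
  have cd := C1_on_continuous_derive (proj1 tphi).
  under eq_Rintegral do rewrite mulrBl.
  rewrite RintegralB//; [|exact: intbleMC|exact: intbleMC].
  rewrite fg//.
  have := prim_wder1 L0 0 gi tphi.
  under eq_Rintegral do rewrite add0r.
  by move=> ->; rewrite subrr.
- exists c; apply: filterS hc => x hx Ix.
  by rewrite -(hx Ix) subrK.
Qed.

Lemma ae_eq_prim g1 g2 x : x <= L -> intble mu I g1 -> intble mu I g2 ->
  {ae mu, forall x, I x -> g1 x = g2 x} -> prim g1 x = prim g2 x.
Proof.
move=> xL i1 i2 e; have j1 := prim_intble xL i1; have j2 := prim_intble xL i2.
apply: (@ae_eq_Rintegral _ _ _ mu).
- exact: measurable_itv.
- exact: (intble_meas j1).
- exact: (intble_meas j2).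
- by apply: filterS e => y e y0; apply: e; exact: subset_itv0 y0.
Qed.

Lemma in_itvW x : I x -> 0 < x /\ x <= L.
Proof. by rewrite /= in_itv/= => /andP[-> /ltW ->]. Qed.

(** The product rule, by integration by parts on each interval ]0, x[. *)
Lemma acrepM f1 g1 f2 g2 : measurable_fun I f1 -> measurable_fun I f2 ->
  intble mu I g1 -> intble mu I g2 ->
  acrep L f1 g1 -> acrep L f2 g2 ->
  intble mu I (fun x => g1 x * f2 x + f1 x * g2 x) /\
  acrep L (fun x => f1 x * f2 x) (fun x => g1 x * f2 x + f1 x * g2 x).
Proof.
move=> m1 m2 i1 i2 [c1 e1] [c2 e2].
have ip g c g' : intble mu I g -> intble mu I g' ->
    intble mu I (fun x => g' x * (c + prim g x)).
  move=> gi g'i.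
  apply: (@eq_intble _ _ _ mu _ _ (fun x => c * g' x + g' x * prim g x)) => //.
    by move=> x _; rewrite mulrDr (mulrC c).
  by apply: intbleD => //; [exact: intbleZ|exact: intbleM_prim].
have iG : intble mu I (fun x => g1 x * (c2 + prim g2 x) + g2 x * (c1 + prim g1 x)).
  by apply: intbleD => //; exact: ip.
have mG : measurable_fun I (fun x => g1 x * f2 x + f1 x * g2 x).
  apply: measurable_funD; apply: measurable_funM => //.
  - exact: (intble_meas i1).
  - exact: (intble_meas i2).
have eG : {ae mu, forall x, I x ->
    g1 x * (c2 + prim g2 x) + g2 x * (c1 + prim g1 x) = g1 x * f2 x + f1 x * g2 x}.
  by apply: aeI e1 e2 => x _ -> ->; rewrite (mulrC (g2 x)).
have iG' : intble mu I (fun x => g1 x * f2 x + f1 x * g2 x) by apply: ae_eq_intble eG iG.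
split => //; exists (c1 * c2); apply: aeI e1 e2 => x Ix -> ->.
have [x0 xL] := in_itvW Ix.
rewrite -(ae_eq_prim xL iG iG' eG).
have j1 := prim_intble xL i1; have j2 := prim_intble xL i2.
have jp g g' : intble mu `]0, x[ g -> intble mu `]0, x[ g' ->
    intble mu `]0, x[ (fun y => g' y * prim g y) by exact: intbleM_prim.
have mx : measurable (`]0, x[%classic : set (measurableTypeR R)) by exact: measurable_itv.
have e := prim_by_parts j1 j2.
rewrite [X in _ = _ + X](_ : _ = c2 * prim g1 x + c1 * prim g2 x + prim g1 x * prim g2 x).
  by ring.
rewrite -e /prim -!RintegralZl// -RintegralD//; [|exact: intbleZ|exact: intbleZ].
rewrite -RintegralD//.
- by apply: eq_Rintegral => y _; ring.
- by apply: intbleD => //; exact: intbleZ.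
- by apply: intbleD => //; exact: jp.
Qed.

Lemma sqint_intble1 f : sqint mu I f -> intble mu I f.
Proof. exact: sqint_intble. Qed.

Let sup_arith (p S nf ng : R) : 0 <= nf -> 0 <= ng -> S <= L * ng ->
  L * p <= 2 * nf + 8 * L * S -> p <= (2 / L + 8 * L) * (nf + ng).
Proof.
move=> nf0 ng0 SL pS.
rewrite -(ler_pM2l L0).
have -> : L * ((2 / L + 8 * L) * (nf + ng)) = (2 + 8 * (L * L)) * (nf + ng).
  by field; rewrite gt_eqF.
have LS : L * S <= L * (L * ng) by rewrite ler_pM2l.
have LL : 0 <= L * L by rewrite mulr_ge0 ?ltW.
have : 0 <= L * L * nf by rewrite mulr_ge0.
nra.
Qed.

(** The one-dimensional Sobolev inequality: compare the value at x with the
    values at all other points y and average over y. *)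
Lemma acrep_sup f g : sqint mu I f -> sqint mu I g -> acrep L f g ->
  {ae mu, forall x, I x ->
    `|f x| ^+ 2 <= (2 / L + 8 * L) * (nsq mu I f + nsq mu I g)}.
Proof.
move=> sf sg [c e].
have gi := sqint_intble1 sg.
set S := \int[mu]_(y in I) `|g y|.
have S2 : S ^+ 2 <= L * nsq mu I g.
  have [mg g2] := sg.
  have sng : sqint mu I (fun y => `|g y|).
    apply: (@ae_le_sqint _ _ _ mu _ _ _ g) => //; first exact: measurableT_comp.
    by apply: aeW => y _; rewrite normr_id.
  have := CauchySchwarz mI (sqint_cst mI I_lty 1) sng.
  rewrite (_ : nsq mu I (fun=> 1) = L); last first.
    rewrite /nsq expr1n Rintegral_cst// mul1r.
    by exact: fine_mu_itv.
  rewrite (_ : nsq mu I (fun x => `|g x|) = nsq mu I g); last first.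
    by apply: eq_Rintegral => y _; rewrite real_normK// num_real.
  by rewrite (@eq_Rintegral _ _ _ mu _ (fun y => `|g y|))// => y _; rewrite mul1r.
apply: filterS (e) => x ex Ix.
have [x0 xL] := in_itvW Ix.
have bnd y : I y -> `|f x| ^+ 2 <= 2 * (c + prim g y) ^+ 2 + 8 * S ^+ 2.
  move=> Iy; have [y0 yL] := in_itvW Iy.
  have px := prim_bound xL gi; have py := prim_bound yL gi.
  rewrite -/S in px py.
  have S0 : 0 <= S by rewrite (le_trans _ px).
  rewrite (ex Ix) real_normK ?num_real//.
  have := ler_normB (prim g x) (prim g y).
  set u := prim g x in px *; set v := prim g y in py *.
  move=> uv; have : (u - v) ^+ 2 <= 4 * S ^+ 2.
    have h : `|u - v| <= 2 * S by lra.
    have -> : 4 * S ^+ 2 = (2 * S) ^+ 2 by ring.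
    by rewrite -(real_normK (num_real (u - v))) lerXn2r// nnegrE// (le_trans _ h).
  have := sqr_ge0 (c + v - (u - v)); nra.
have sF : sqint mu I (fun y => c + prim g y).
  by apply: (ae_eq_sqint _ _ _ sf); [exact: mI|exact: measurable_acrep|exact: e].
have nF : nsq mu I (fun y => c + prim g y) = nsq mu I f.
  apply: ae_eq_nsq; [exact: mI|exact: (sqint_meas sF)|exact: (sqint_meas sf)|].
  by apply: filterS (e) => y ey Iy; rewrite ey.
have : L * `|f x| ^+ 2 <= 2 * nsq mu I f + 8 * L * S ^+ 2.
  have := @le_Rintegral _ _ _ mu I (fun=> `|f x| ^+ 2)
     (fun y => 2 * (c + prim g y) ^+ 2 + 8 * S ^+ 2) mI.
  rewrite RintegralD//; [|by apply: intbleZ => //; exact: (sqint_intble2 sF)|exact: intble_cst].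
  rewrite RintegralZl//; last exact: (sqint_intble2 sF).
  rewrite !Rintegral_cst// -/(nsq mu I (fun y => c + prim g y)) nF.
  rewrite (fine_mu_itv L0) => h; rewrite mulrC (le_trans (h _ _ _))//; last by lra.
  - exact: intble_cst.
  - apply: intbleD => //; last exact: intble_cst.
    by apply: intbleZ => //; exact: (sqint_intble2 sF).
move=> h; have ng := nsq_ge0 mu I g; have nf := nsq_ge0 mu I f.
exact: (sup_arith nf ng S2 h).
Qed.

End DuBoisReymond.

(** * The plane: fundamental lemma and uniqueness of weak gradients *)

Section Plane.
Variable R : realType.
Notation T2 := (measurableTypeR R * measurableTypeR R)%type.
Notation mu2 := (@leb2 R).
Implicit Types (U V : set (R * R)) (g : R * R -> R).

Definition rect (a b c d : R) : set T2 := `]a, b[%classic `*` `]c, d[%classic.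

Lemma measurable_rect a b c d : measurable (rect a b c d).
Proof. by apply: measurableX; exact: measurable_itv. Qed.

Definition ratrect (q : rat * rat * (rat * rat)) : set T2 :=
  rect (ratr q.1.1) (ratr q.1.2) (ratr q.2.1) (ratr q.2.2).

Definition ratrect_in U (n : nat) : set T2 :=
  if unpickle n is Some q then
    if `[< ratrect q `<=` U >] then ratrect q else set0
  else set0.

Lemma measurable_ratrect_in U n : measurable (ratrect_in U n).
Proof.
rewrite /ratrect_in; case: unpickle => // q.
by case: ifP => // _; exact: measurable_rect.
Qed.

Lemma open_bigcup_ratrect U : open U -> U = \bigcup_n ratrect_in U n.
Proof.
move=> oU; apply/seteqP; split => [p Up|p [n _]]; last first.
  rewrite /ratrect_in; case: unpickle => // q; case: ifPn => // /asboolP; exact.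
have : nbhs p U by exact: open_nbhs_nbhs.
rewrite -nbhs_ballE => -[e /= e0 eU].
have lte (x : R) : x - e < x by rewrite ltrBlDr ltrDl.
have gte (x : R) : x < x + e by rewrite ltrDl.
have [a] := rat_in_itvoo (lte p.1); have [b] := rat_in_itvoo (gte p.1).
have [c] := rat_in_itvoo (lte p.2); have [d] := rat_in_itvoo (gte p.2).
rewrite !in_itv/= => /andP[d1 d2] /andP[c1 c2] /andP[b1 b2] /andP[a1 a2].
have [n nE] : exists n, unpickle n = Some ((a, b), (c, d)).
  by exists (pickle ((a, b), (c, d))); exact: pickleK.
exists n; first exact: Logic.I.
rewrite /ratrect_in nE.
case: ifPn => [_|/asboolP[]].
  by rewrite /ratrect /rect; split; rewrite /= in_itv/= ?a2 ?c2.
move=> [x y] [/=]; rewrite !in_itv/= => /andP[x1 x2] /andP[y1 y2].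
apply: eU; split; rewrite /ball/= ltr_distl; apply/andP; split.
- by rewrite ltrBlDr (lt_trans x2).
- by rewrite -ltrBlDr (lt_trans a1).
- by rewrite ltrBlDr (lt_trans y2).
- by rewrite -ltrBlDr (lt_trans c1).
Qed.

Lemma open_measurable2 U : open U -> measurable (U : set T2).
Proof.
by move=> /open_bigcup_ratrect ->; apply: bigcup_measurable => n _;
  exact: measurable_ratrect_in.
Qed.

Lemma continuous_measurable2 g : continuous g -> measurable_fun [set: T2] (g : T2 -> R).
Proof.
move=> cg; apply: (measurability (@RGenOpens.G R)).
  exact: RGenOpens.measurableE.
move=> _ [_ [a [b ->]] <-]; rewrite setTI; apply: open_measurable2.
by apply: open_comp; [move=> ? _; exact: cg|exact: interval_open].
Qed.

Lemma Rintegral_bump2_lim (D : set T2) g a b c d : measurable D -> intble mu2 D g ->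
  a < b -> c < d ->
  (forall n, \int[mu2]_(p in D) (g p * (bump n a b p.1 * bump n c d p.2)) = 0) ->
  \int[mu2]_(p in D `&` rect a b c d) g p = 0.
Proof.
move=> mD gi ab cd g0.
have mg := intble_meas gi.
have mb n x y : measurable_fun setT (bump n x y : measurableTypeR R -> R).
  by apply: continuous_measurable_fun; exact: continuous_bump.
have mbb n : measurable_fun D (fun p : T2 => bump n a b p.1 * bump n c d p.2).
  apply: measurable_funTS; apply: measurable_funM.
    exact: (measurableT_comp (mb n a b) (@measurable_fst _ _ _ _)).
  exact: (measurableT_comp (mb n c d) (@measurable_snd _ _ _ _)).
have bb1 n (p : T2) : `|bump n a b p.1 * bump n c d p.2| <= 1.
  rewrite ger0_norm ?mulr_ge0 ?bump_ge0//.
  by rewrite mulr_ile1 ?bump_ge0 ?bump_le1.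
have mi : measurable_fun D (\1_(rect a b c d) : T2 -> R).
  by apply: measurable_indic; exact: measurable_rect.
have gbi n : intble mu2 D (fun p => g p * (bump n a b p.1 * bump n c d p.2)).
  apply: (@le_intble _ _ _ mu2 _ _ _ (fun x => `|g x|)) => //.
  - by apply: measurable_funM; [exact: mg|exact: mbb].
  - by move=> x _; rewrite normrM ler_piMr.
  - exact: integrable_norm.
have [] := @dominated_convergence _ _ _ mu2 D mD
  (fun n p => (g p * (bump n a b p.1 * bump n c d p.2))%:E)
  (fun x => (g x * \1_(rect a b c d) x)%:E)
  (fun x => `|g x|%:E).
- by move=> n; apply/measurable_EFinP; exact: intble_meas.
- apply/measurable_EFinP; apply: measurable_funM; first exact: mg.
  exact: mi.
- apply: aeW => x _; apply: cvg_EFin; first exact: nearW.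
  apply: cvgM; first exact: cvg_cst.
  rewrite (_ : \1_(rect a b c d) x = \1_(`]a, b[) x.1 * \1_(`]c, d[) x.2).
    by apply: cvgM; exact: bump_cvg.
  by rewrite !indicE -natrM mulnb /rect; case: x => x y; rewrite in_setX.
- exact: integrable_norm.
- by apply: aeW => x n _ /=; rewrite lee_fin normrM ler_piMr.
move=> _ _ /=; rewrite (_ : (fun _ => _) = fun=> 0%E); last first.
  by apply/funext => n; rewrite EFin_Rintegral ?g0.
move=> h; have {}h := cvg_unique (@ereal_hausdorff R) h (cvg_cst _).
rewrite Rintegral_mkcondr /Rintegral.
rewrite (_ : integral _ _ _ = integral mu2 D (fun x => (g x * \1_(rect a b c d) x)%:E)).
  by rewrite h.
apply: eq_integral => x _; rewrite patchE indicE.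
by case: ifPn => _; rewrite ?mulr1 ?mulr0.
Qed.

Lemma rectI a b c d a' b' c' d' : rect a b c d `&` rect a' b' c' d' =
  rect (Num.max a a') (Num.min b b') (Num.max c c') (Num.min d d').
Proof.
apply/seteqP; split => -[x y]; rewrite /rect/= !in_itv/= !gt_max !lt_min.
  by move=> [[/andP[-> ->] /andP[-> ->]] [/andP[-> ->] /andP[-> ->]]].
by move=> [/andP[/andP[-> ->] /andP[-> ->]] /andP[/andP[-> ->] /andP[-> ->]]].
Qed.

Lemma setI_closed_G : setI_closed (@RGenOpens.G R).
Proof.
move=> _ _ [a [b ->]] [c [d ->]].
exists (Num.max a c), (Num.min b d); apply/seteqP; split => x /=.
  rewrite !in_itv/= => -[/andP[ax xb] /andP[cx xd]].
  by rewrite gt_max lt_min ax xb cx xd.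
by rewrite !in_itv/= gt_max lt_min => /andP[/andP[-> ->] /andP[-> ->]].
Qed.

(** Integrals over products of intervals vanish by approximation with products of
    bumps; the class of sets is then enlarged one factor at a time, and last to
    the product sigma-algebra. *)
Lemma fundamental_lemma_rect g a b c d : intble mu2 (rect a b c d) g ->
  (forall n a' b' c' d', a' < b' -> c' < d' -> rect a' b' c' d' `<=` rect a b c d ->
    \int[mu2]_(p in rect a b c d) (g p * (bump n a' b' p.1 * bump n c' d' p.2)) = 0) ->
  {ae mu2, forall p, rect a b c d p -> g p = 0}.
Proof.
move=> gi g0; set Q := rect a b c d in gi g0 *.
have mQ : measurable Q by exact: measurable_rect.
have gsub a' b' c' d' : \int[mu2]_(p in Q `&` rect a' b' c' d') g p = 0.
  have -> : Q `&` rect a' b' c' d' = Q `&` (Q `&` rect a' b' c' d') by rewrite setIA setIid.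
  have := @subIsetl _ Q (rect a' b' c' d').
  rewrite /Q rectI; move: (Num.max a a') (Num.min b b') (Num.max c c') (Num.min d d').
  move=> {a' b' c' d'} a' b' c' d' sub; rewrite -/Q.
  have [ab|ba] := ltP a' b'; last first.
    have -> : rect a' b' c' d' = set0.
      apply/seteqP; split => // -[x y] [/=]; rewrite in_itv/= => /andP[h1 h2] _.
      by move: (lt_trans h1 h2); rewrite ltNge ba.
    by rewrite setI0 Rintegral_set0.
  have [cd|dc] := ltP c' d'; last first.
    have -> : rect a' b' c' d' = set0.
      apply/seteqP; split => // -[x y] [/= _]; rewrite in_itv/= => /andP[h1 h2].
      by move: (lt_trans h1 h2); rewrite ltNge dc.
    by rewrite setI0 Rintegral_set0.
  apply: Rintegral_bump2_lim => // n; exact: g0.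
have gQ : \int[mu2]_(p in Q) g p = 0 by have := gsub a b c d; rewrite setIid.
have mI1 x y : measurable (Q `&` fst @^-1` (`]x, y[%classic : set R)).
  apply: measurableI => //; rewrite -[X in measurable X]setTI.
  by apply: (@measurable_fst _ _ (measurableTypeR R) (measurableTypeR R)) => //; exact: measurable_itv.
have step1 x y (B : set (measurableTypeR R)) : measurable B ->
    \int[mu2]_(p in (Q `&` fst @^-1` `]x, y[%classic) `&` snd @^-1` B) g p = 0.
  move=> mB; apply: (@vanishing_generated _ _ _ mu2 _ (mI1 x y) _ (measurableTypeR R) snd
    (@RGenOpens.G R) g _ _ _ _ _ _ B mB).
  - exact: measurable_snd.
  - exact: RGenOpens.measurableE.
  - exact: setI_closed_G.
  - apply: (intbleS (mI1 x y) mQ) gi; exact: subIsetl.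
  - rewrite (_ : _ `&` _ = Q `&` rect x y c d); first exact: gsub.
    by apply/seteqP; split => -[u v] [[/= h1 h2]] => [h3|[h3 h4]]; split.
  - move=> _ [z [w ->]]; rewrite -setIA; exact: gsub.
have step2 (A B : set (measurableTypeR R)) : measurable A -> measurable B ->
    \int[mu2]_(p in (Q `&` snd @^-1` B) `&` fst @^-1` A) g p = 0.
  move=> mA mB.
  have mQB : measurable (Q `&` snd @^-1` B).
    apply: measurableI => //; rewrite -[X in measurable X]setTI.
    by apply: (@measurable_snd _ _ (measurableTypeR R) (measurableTypeR R)).
  apply: (@vanishing_generated _ _ _ mu2 _ mQB _ (measurableTypeR R) fst
    (@RGenOpens.G R) g _ _ _ _ _ _ A mA).
  - exact: measurable_fst.
  - exact: RGenOpens.measurableE.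
  - exact: setI_closed_G.
  - apply: (intbleS mQB mQ) gi; exact: subIsetl.
  - rewrite -[RHS](step1 a b B mB); congr Rintegral; congr (_ `&` _).
    by apply/seteqP; split => [[u v] [/= h1 h2]|p []].
  - by move=> _ [z [w ->]]; rewrite setIAC; exact: step1.
apply: (vanishing_ae0 mQ gi) => A mA.
rewrite -[A]/((@id T2) @^-1` A).
apply: (@vanishing_generated _ _ _ mu2 _ mQ _ T2 id
  [set A `*` B | A in measurable & B in measurable] g _ _ _ _ _ _ A mA) => //.
- exact: measurable_prod_measurableType.
- move=> _ _ [A1 mA1 [B1 mB1 <-]] [A2 mA2 [B2 mB2 <-]].
  exists (A1 `&` A2); first exact: measurableI.
  by exists (B1 `&` B2); [exact: measurableI|rewrite setXI].
- move=> _ [A1 mA1 [B1 mB1 <-]]; rewrite -[RHS](step2 A1 B1 mA1 mB1).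
  by congr Rintegral; apply/seteqP; split => -[u v] => [[h1 [h2 h3]]|[[h1 h2] h3]].
Qed.

End Plane.

(** ** Test functions of the plane *)

#[global] Instance ae_leb2_filter (R : realType) :
  Filter (nbhs (almost_everywhere (@leb2 R))).
Proof. exact: (ae_filter_ringOfSetsType (@leb2 R)). Qed.

Section PlaneTest.
Variable R : realType.
Notation T2 := (measurableTypeR R * measurableTypeR R)%type.
Notation mu2 := (@leb2 R).
Implicit Types (om U V : set (R * R)) (phi g : R * R -> R).

Lemma is_derive_fst (f : R -> R) (p v : R * R) df :
  is_derive p.1 (1 : R) f df -> is_derive p v (fun q => f q.1) (v.1 * df).
Proof.
by move=> /(is_derive_D v.1) [h1 h2]; split; [exact: h1|exact: h2].
Qed.

Lemma is_derive_snd (f : R -> R) (p v : R * R) df :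
  is_derive p.2 (1 : R) f df -> is_derive p v (fun q => f q.2) (v.2 * df).
Proof.
by move=> /(is_derive_D v.2) [h1 h2]; split; [exact: h1|exact: h2].
Qed.

Lemma is_derive_tensor (f f' h h' : R -> R) (p v : R * R) :
  is_derive p.1 (1 : R) f (f' p.1) -> is_derive p.2 (1 : R) h (h' p.2) ->
  is_derive p v (fun q => f q.1 * h q.2)
    (v.1 * (f' p.1 * h p.2) + v.2 * (f p.1 * h' p.2)).
Proof.
move=> df dh.
have := is_deriveM (is_derive_fst v df) (is_derive_snd v dh).
set e := (X in is_derive _ _ _ X) => H.
by rewrite (_ : _ + _ = e)// /e -![_ *: _]/(_ * _) /=; ring.
Qed.

Lemma C1_on_tensor (f f' h h' : R -> R) :
  (forall x, is_derive x (1 : R) f (f' x)) -> continuous f' ->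
  (forall x, is_derive x (1 : R) h (h' x)) -> continuous h' ->
  C1_on setT (fun q : R * R => f q.1 * h q.2).
Proof.
move=> df cf' dh ch' v.
have cf : continuous f := C1_on_continuous (C1_onI df cf').
have ch : continuous h := C1_on_continuous (C1_onI dh ch').
have c1 (k : R -> R) : continuous k -> continuous (fun q : R * R => k q.1).
  by move=> ck q; apply: (@continuous_comp _ _ _ fst k); [exact: cvg_fst|exact: ck].
have c2 (k : R -> R) : continuous k -> continuous (fun q : R * R => k q.2).
  by move=> ck q; apply: (@continuous_comp _ _ _ snd k); [exact: cvg_snd|exact: ck].
have d p := is_derive_tensor v (df p.1) (dh p.2).
split=> [p _|p _]; first by have [] := d p.
rewrite (_ : 'D_v _ = fun p => v.1 * (f' p.1 * h p.2) + v.2 * (f p.1 * h' p.2)); last first.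
  by apply/funext => q; have [] := d q.
apply: cvgD; apply: cvgM; try exact: cvg_cst; apply: cvgM.
- exact: c1.
- exact: c2.
- exact: c1.
- exact: c2.
Qed.

Lemma test_fun_bump2 om n a b c d : a < b -> c < d -> rect a b c d `<=` om ->
  test_fun om (fun p => bump n a b p.1 * bump n c d p.2).
Proof.
move=> ab cd sub; split.
  apply: C1_on_tensor; [exact: is_derive_bump|exact: continuous_dbump|
    exact: is_derive_bump|exact: continuous_dbump].
have [_ [K1 [cK1 K1s K10]]] := test_fun_bump n ab (@subset_refl _ `]a, b[).
have [_ [K2 [cK2 K2s K20]]] := test_fun_bump n cd (@subset_refl _ `]c, d[).
exists (K1 `*` K2); split.
- exact: compact_setX.
- by move=> [x y] [/= /K1s hx /K2s hy]; apply: sub.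
- move=> [x y] h /=; have [h1|h1] := pselect (K1 x); last by rewrite K10// mul0r.
  by rewrite (K20 y) ?mulr0// => h2; exact: h.
Qed.

(** An open set is a countable union of rectangles with rational corners. *)
Lemma fundamental_lemma_open om g : open om -> intble mu2 om g ->
  (forall phi, test_fun om phi -> \int[mu2]_(p in om) (g p * phi p) = 0) ->
  {ae mu2, forall p, om p -> g p = 0}.
Proof.
move=> oom gi g0; have mom := open_measurable2 oom.
have h n : {ae mu2, forall p, ratrect_in om n p -> g p = 0}.
  rewrite /ratrect_in; case: unpickle => [q|]; last by apply: aeW.
  case: ifPn => [/asboolP qom|_]; last by apply: aeW.
  have mq := measurable_rect (ratr q.1.1 : R) (ratr q.1.2) (ratr q.2.1) (ratr q.2.2).
  apply: fundamental_lemma_rect; first exact: (intbleS mq mom qom gi).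
  move=> k a b c d ab cd sub; rewrite -/(ratrect q).
  rewrite -[RHS](g0 _ (test_fun_bump2 k ab cd (subset_trans sub qom))).
  rewrite -(@Rintegral_patch _ _ _ mu2 om)//; apply: eq_Rintegral => p _.
  rewrite patchE; case: ifPn => // /negP pq.
  suff -> : bump k a b p.1 * bump k c d p.2 = 0 by rewrite mulr0.
  have [_ [K1 [_ K1s K10]]] := test_fun_bump k ab (@subset_refl _ `]a, b[).
  have [_ [K2 [_ K2s K20]]] := test_fun_bump k cd (@subset_refl _ `]c, d[).
  have [h1|h1] := pselect (K1 p.1); last by rewrite K10// mul0r.
  rewrite (K20 p.2) ?mulr0// => h2; apply: pq; rewrite inE; apply: sub.
  by split; [exact: K1s|exact: K2s].
apply: filterS (ae_foralln h) => p hp omp.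
move: omp; rewrite {1}(open_bigcup_ratrect oom) => -[n _]; exact: hp.
Qed.

End PlaneTest.

(** ** Integration by parts in the plane *)

Section PlaneParts.
Variable R : realType.
Notation T1 := (measurableTypeR R).
Notation T2 := (measurableTypeR R * measurableTypeR R)%type.
Notation mu := (@lebesgue_measure R).
Notation mu2 := (@leb2 R).
Implicit Types (om K : set (R * R)) (phi g F : R * R -> R).

Lemma slice1E (p : R * R) (h : R) : h *: ((1, 0) : R * R) + p = (h *: (1 : R) + p.1, p.2).
Proof. by case: p => x y; congr pair; rewrite /= scaler0 add0r. Qed.

Lemma slice2E (p : R * R) (h : R) : h *: ((0, 1) : R * R) + p = (p.1, h *: (1 : R) + p.2).
Proof. by case: p => x y; congr pair; rewrite /= scaler0 add0r. Qed.

Lemma is_derive_slice1 phi (x y : R) : derivable phi (x, y) (1, 0) ->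
  is_derive x (1 : R) (fun t => phi (t, y)) ('D_((1, 0) : R * R) phi (x, y)).
Proof.
rewrite /derivable => dphi; split.
  rewrite /derivable; set d1 := (fun h => _).
  set d := (fun h => _) in dphi.
  by have -> : d1 = d by apply/funext => k; rewrite /d /d1 /= slice1E.
rewrite /derive; set d1 := (fun h => _); set d := (fun h => _ *: ((phi \o _) _ - _)).
by have -> : d1 = d by apply/funext => k; rewrite /d /d1 /= slice1E.
Qed.

Lemma is_derive_slice2 phi (x y : R) : derivable phi (x, y) (0, 1) ->
  is_derive y (1 : R) (fun t => phi (x, t)) ('D_((0, 1) : R * R) phi (x, y)).
Proof.
rewrite /derivable => dphi; split.
  rewrite /derivable; set d1 := (fun h => _).
  set d := (fun h => _) in dphi.
  by have -> : d1 = d by apply/funext => k; rewrite /d /d1 /= slice2E.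
rewrite /derive; set d1 := (fun h => _); set d := (fun h => _ *: ((phi \o _) _ - _)).
by have -> : d1 = d by apply/funext => k; rewrite /d /d1 /= slice2E.
Qed.

Lemma compact_supp_bounded K F : compact K -> continuous F ->
  (forall p, ~ K p -> F p = 0) -> exists C, forall p, `|F p| <= C.
Proof.
move=> cK cF F0.
have /compact_bounded[C [_ hC]] : compact [set F p | p in K].
  by apply: continuous_compact => //; exact: continuous_subspaceT.
exists (`|C| + 1) => p; have [Kp|nKp] := pselect (K p); last first.
  by rewrite F0// normr0.
by apply: (hC (`|C| + 1)); [rewrite (le_lt_trans (ler_norm _))// ltrDl|exists p].
Qed.

Lemma derive_supp K phi v : compact K -> (forall p, ~ K p -> phi p = 0) ->
  forall p, ~ K p -> 'D_v phi p = 0.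
Proof.
move=> cK phi0 p Kp; rewrite -(@derive_cst _ _ _ (0 : R) p v).
apply: near_eq_derive.
have : open (~` K) by apply: closed_openC; apply: compact_closed => //; exact: norm_hausdorff.
by rewrite openE => /(_ p Kp); apply: filterS => q; exact: phi0.
Qed.

Lemma MVT_bound (f f' : R -> R) C : (forall x, is_derive x (1 : R) f (f' x)) ->
  (forall x, `|f' x| <= C) -> forall x y, `|f x - f y| <= C * `|x - y|.
Proof.
move=> df fC.
have cf : continuous f.
  by move=> x; apply/differentiable_continuous/derivable1_diffP; have [] := df x.
have main x y : y <= x -> `|f x - f y| <= C * `|x - y|.
  move=> yx.
  have [c _ ->] := @MVT_segment R f f' y x yx (fun z _ => df z) (continuous_subspaceT cf).
  by rewrite normrM ler_wpM2r.
move=> x y; have [yx|xy] := leP y x; first exact: main.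
by rewrite distrC (distrC x); exact: main (ltW xy).
Qed.

Lemma test_fun_slices om phi : test_fun om phi ->
  (forall x y, is_derive x (1 : R) (fun t => phi (t, y)) ('D_((1, 0) : R * R) phi (x, y))) /\
  (forall x y, is_derive y (1 : R) (fun t => phi (x, t)) ('D_((0, 1) : R * R) phi (x, y))).
Proof.
move=> [C1 _]; split => x y.
  by apply: is_derive_slice1; have [/(_ (x, y) Logic.I)] := C1 (1, 0).
by apply: is_derive_slice2; have [/(_ (x, y) Logic.I)] := C1 (0, 1).
Qed.

Lemma test_fun_continuousD om phi v : test_fun om phi -> continuous ('D_v phi).
Proof. by move=> [C1 _] p; have [_ /(_ p Logic.I)] := C1 v. Qed.

(** Continuity of a function of two variables from bounded partial derivatives, by
    the mean value theorem on each slice. *)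
Lemma test_fun_continuous om phi : test_fun om phi -> continuous phi.
Proof.
move=> tphi; have [d1 d2] := test_fun_slices tphi.
have [_ [K [cK _ K0]]] := tphi.
have [A hA] := compact_supp_bounded cK (@test_fun_continuousD om phi (1, 0) tphi)
  (@derive_supp K phi (1, 0) cK K0).
have [B hB] := compact_supp_bounded cK (@test_fun_continuousD om phi (0, 1) tphi)
  (@derive_supp K phi (0, 1) cK K0).
move=> [x y]; apply/cvgrPdist_lt => e e0.
have C0 : 0 < `|A| + `|B| + 1 by rewrite ltr_wpDl// addr_ge0.
have d0 : 0 < e / (`|A| + `|B| + 1) by rewrite divr_gt0.
near=> q.
have [hx hy] : `|x - q.1| < e / (`|A| + `|B| + 1) /\ `|y - q.2| < e / (`|A| + `|B| + 1).
  have : ball (x, y) (e / (`|A| + `|B| + 1)) q.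
    near: q; exact: (@nbhsx_ballx _ _ ((x,y) : R * R) _ d0).
  by move=> [].
have -> : phi (x, y) - phi q = (phi (x, y) - phi (q.1, y)) + (phi (q.1, y) - phi (q.1, q.2)).
  by rewrite -surjective_pairing addrA subrK.
rewrite (le_lt_trans (ler_normD _ _))//.
have h1 : `|phi (x, y) - phi (q.1, y)| <= `|A| * `|x - q.1|.
  apply: (@MVT_bound (fun t => phi (t, y)) (fun t => 'D_((1, 0) : R * R) phi (t, y)) `|A|) => t.
  by rewrite (le_trans (hA _))// ler_norm.
have h2 : `|phi (q.1, y) - phi (q.1, q.2)| <= `|B| * `|y - q.2|.
  apply: (@MVT_bound (fun t => phi (q.1, t)) (fun t => 'D_((0, 1) : R * R) phi (q.1, t)) `|B|) => t.
  by rewrite (le_trans (hB _))// ler_norm.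
apply: (@le_lt_trans _ _ (`|A| * (e / (`|A| + `|B| + 1)) + `|B| * (e / (`|A| + `|B| + 1)))).
  apply: lerD; [apply: (le_trans h1)|apply: (le_trans h2)]; by rewrite ler_wpM2l// ltW.
rewrite -mulrDl mulrCA gtr_pMr// ltr_pdivrMr// mul1r ltrDl//.
Unshelve. all: by end_near. Qed.

Lemma integral_derive0 (f f' : R -> R) M : 0 < M ->
  (forall x, is_derive x (1 : R) f (f' x)) -> continuous f' ->
  (forall x, M <= `|x| -> f x = 0 /\ f' x = 0) ->
  (\int[mu]_x (f' x)%:E)%E = 0%E.
Proof.
move=> M0 df cf' f0.
have C1 := C1_onI df cf'.
have dE : derive1 f = f' by apply/funext => x; exact: derive1_val.
have Mn : M <= `|M| by exact: ler_norm.
have Mn' : M <= `|- M| by rewrite normrN.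
have NM : - M < M by lra.
have := C1_FTC C1 NM; rewrite dE (proj1 (f0 _ Mn)) (proj1 (f0 _ Mn')) subrr => h.
rewrite -[RHS]/(0%:E) -h.
rewrite [RHS]integral_mkcond; apply: eq_integral => x _.
rewrite patchE; case: ifPn => // /negP xM.
have [|_ ->//] := f0 x; rewrite leNgt; apply/negP => h1; apply: xM.
by rewrite inE /= in_itv/= -ltr_norml.
Qed.

Lemma compact_in_box K : compact K -> exists2 M, 0 < M &
  K `<=` rect (- M) M (- M) M.
Proof.
move=> /compact_bounded[C [_ hC]]; exists (`|C| + 2); first by rewrite ltr_wpDl.
move=> p /(hC (`|C| + 1)) h.
have : `|p| <= `|C| + 1 by apply: h; rewrite (le_lt_trans (ler_norm _))// ltrDl.
rewrite prod_normE ge_max => /andP[h1 h2].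
by split; rewrite /= in_itv/= -ltr_norml; apply: (le_lt_trans _ (_ : `|C| + 1 < _)); rewrite // ltrD2l ltr1n.
Qed.

Lemma leb2_rect_lty a b c d : (mu2 (rect a b c d) < +oo)%E.
Proof.
have fin (x y : R) : (mu (`]x, y[ : set R) < +oo)%E.
  by rewrite lebesgue_measure_itv/=; case: ifP => _; rewrite ?ltry.
rewrite /leb2 /rect product_measure1E; [|exact: measurable_itv|exact: measurable_itv].
apply: lte_mul_pinfty; [exact: measure_ge0| |exact: fin].
by rewrite ge0_fin_numE ?fin ?measure_ge0.
Qed.

Lemma compact_supp_intble K F : compact K -> continuous F ->
  (forall p, ~ K p -> F p = 0) -> intble mu2 setT F.
Proof.
move=> cK cF F0; have [C hC] := compact_supp_bounded cK cF F0.
have [M M0 KM] := compact_in_box cK.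
have mr := measurable_rect (- M) M (- M) M.
have FE : F \_ (rect (- M) M (- M) M) = F.
  apply/funext => p; rewrite patchE; case: ifPn => // /negP pM.
  by rewrite F0// => /KM h; apply: pM; rewrite inE.
rewrite -FE; apply: (@intble_patch _ _ _ mu2 setT _ F measurableT mr _).1 => //.
apply: (@bounded_intble _ _ _ mu2 _ mr (leb2_rect_lty _ _ _ _) C).
  by apply: measurable_funTS; exact: continuous_measurable2.
by apply: aeW => p _.
Qed.

Section ByParts.
Variables (om : set (R * R)) (phi : R * R -> R) (f f' h h' : R -> R).
Hypothesis oom : open om.
Hypothesis tphi : test_fun om phi.
Hypotheses (df : forall x, is_derive x (1 : R) f (f' x)) (cf' : continuous f').
Hypotheses (dh : forall x, is_derive x (1 : R) h (h' x)) (ch' : continuous h').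

Let cf : continuous f := C1_on_continuous (C1_onI df cf').
Let ch : continuous h := C1_on_continuous (C1_onI dh ch').

Let tensor_continuous (k l : R -> R) : continuous k -> continuous l ->
  continuous (fun q : R * R => k q.1 * l q.2).
Proof.
move=> ck cl q; apply: cvgM.
  by apply: (@continuous_comp _ _ _ fst k); [exact: cvg_fst|exact: ck].
by apply: (@continuous_comp _ _ _ snd l); [exact: cvg_snd|exact: cl].
Qed.

Let add0_of_slices (F1 F2 : R * R -> R) (K : set (R * R)) : compact K -> K `<=` om ->
  continuous F1 -> continuous F2 ->
  (forall p, ~ K p -> F1 p = 0) -> (forall p, ~ K p -> F2 p = 0) ->
  \int[mu2]_p (F1 p + F2 p) = 0 ->
  \int[mu2]_(p in om) F1 p = - \int[mu2]_(p in om) F2 p.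
Proof.
move=> cK Kom cF1 cF2 F10 F20 e; apply/eqP; rewrite -addr_eq0 -RintegralD.
- rewrite -(@Rintegral_patch _ _ _ mu2 setT)// -[X in _ == X]e; apply/eqP.
  apply: eq_Rintegral => p _; rewrite patchE; case: ifPn => // /negP pom.
  by rewrite F10 ?F20 ?addr0// => /Kom h0; apply: pom; rewrite inE.
- exact: open_measurable2.
- apply: (@intbleS _ _ _ mu2 om setT) => //; first exact: open_measurable2.
  exact: compact_supp_intble cK cF1 F10.
- apply: (@intbleS _ _ _ mu2 om setT) => //; first exact: open_measurable2.
  exact: compact_supp_intble cK cF2 F20.
Qed.

(** By Fubini the identity reduces to slices, on each of which it says that the
    derivative of f h phi has zero integral. *)
Lemma by_parts_tensor1 :
  \int[mu2]_(p in om) (f p.1 * h p.2 * 'D_((1, 0) : R * R) phi p) =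
  - \int[mu2]_(p in om) (f' p.1 * h p.2 * phi p).
Proof.
have [_ [K [cK Kom K0]]] := tphi.
have cphi := test_fun_continuous tphi.
have cD := @test_fun_continuousD om phi (1, 0) tphi.
have D0 := @derive_supp K phi (1, 0) cK K0.
have [d1 _] := test_fun_slices tphi.
have c1 : continuous (fun p : R * R => f p.1 * h p.2 * 'D_((1, 0) : R * R) phi p).
  by move=> p; apply: cvgM; [exact: tensor_continuous|exact: cD].
have c2 : continuous (fun p : R * R => f' p.1 * h p.2 * phi p).
  by move=> p; apply: cvgM; [exact: tensor_continuous|exact: cphi].
have z1 p : ~ K p -> f p.1 * h p.2 * 'D_((1, 0) : R * R) phi p = 0.
  by move=> /D0 ->; rewrite mulr0.
have z2 p : ~ K p -> f' p.1 * h p.2 * phi p = 0 by move=> /K0 ->; rewrite mulr0.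
apply: (add0_of_slices cK Kom c1 c2 z1 z2).
set F := fun p : R * R => _.
have cF : continuous F by move=> p; apply: cvgD; [exact: c1|exact: c2].
have zF p : ~ K p -> F p = 0 by move=> Kp; rewrite /F z1 ?z2 ?addr0.
have iF := compact_supp_intble cK cF zF.
rewrite /Rintegral -(integral21_prod_meas1 iF).
rewrite integral0_eq// => y _.
have [M M0 KM] := compact_in_box cK.
apply: (@integral_derive0 (fun x => f x * h y * phi (x, y)) (fun x => F (x, y)) M) => //.
- move=> x; rewrite /F /= addrC; apply: (derM _ (d1 x y)).
  have -> : (fun x => f x * h y) = (fun x => h y * f x) by apply/funext => t; exact: mulrC.
  rewrite [f' x * _]mulrC; exact: derZ.
- have cs : continuous (fun x : R => (x, y)).
    by move=> t; exact: (@cvg_pair _ _ _ (nbhs t) (nbhs t) (nbhs y) _ _ _ id (cst y) cvg_id (cvg_cst y)).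
  by move=> x; exact: (continuous_comp (cs x) (cF _)).
- move=> x Mx; have nK : ~ K (x, y).
    by move=> /KM[/=]; rewrite in_itv/= -ltr_norml ltNge Mx.
  by split; [rewrite K0// mulr0|exact: zF].
Qed.

Lemma by_parts_tensor2 :
  \int[mu2]_(p in om) (f p.1 * h p.2 * 'D_((0, 1) : R * R) phi p) =
  - \int[mu2]_(p in om) (f p.1 * h' p.2 * phi p).
Proof.
have [_ [K [cK Kom K0]]] := tphi.
have cphi := test_fun_continuous tphi.
have cD := @test_fun_continuousD om phi (0, 1) tphi.
have D0 := @derive_supp K phi (0, 1) cK K0.
have [_ d2] := test_fun_slices tphi.
have c1 : continuous (fun p : R * R => f p.1 * h p.2 * 'D_((0, 1) : R * R) phi p).
  by move=> p; apply: cvgM; [exact: tensor_continuous|exact: cD].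
have c2 : continuous (fun p : R * R => f p.1 * h' p.2 * phi p).
  by move=> p; apply: cvgM; [exact: tensor_continuous|exact: cphi].
have z1 p : ~ K p -> f p.1 * h p.2 * 'D_((0, 1) : R * R) phi p = 0.
  by move=> /D0 ->; rewrite mulr0.
have z2 p : ~ K p -> f p.1 * h' p.2 * phi p = 0 by move=> /K0 ->; rewrite mulr0.
apply: (add0_of_slices cK Kom c1 c2 z1 z2).
set F := fun p : R * R => _.
have cF : continuous F by move=> p; apply: cvgD; [exact: c1|exact: c2].
have zF p : ~ K p -> F p = 0 by move=> Kp; rewrite /F z1 ?z2 ?addr0.
have iF := compact_supp_intble cK cF zF.
rewrite /Rintegral -(integral12_prod_meas1 iF).
rewrite integral0_eq// => x _.
have [M M0 KM] := compact_in_box cK.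
apply: (@integral_derive0 (fun y => f x * h y * phi (x, y)) (fun y => F (x, y)) M) => //.
- move=> y; rewrite /F /= addrC; apply: (derM _ (d2 x y)).
- have cs : continuous (fun y : R => (x, y)).
    by move=> t; exact: (@cvg_pair _ _ _ (nbhs t) (nbhs x) (nbhs t) _ _ _ (cst x) id (cvg_cst x) cvg_id).
  by move=> y; exact: (continuous_comp (cs y) (cF _)).
- move=> y My; have nK : ~ K (x, y).
    by move=> /KM[/= _]; rewrite in_itv/= -ltr_norml ltNge My.
  by split; [rewrite K0// mulr0|exact: zF].
Qed.

End ByParts.
End PlaneParts.

(** * Three-by-three matrices *)

Section Matrix3.
Variable R : realType.
Implicit Types (A B F : 'M[R]_3).

Lemma ord3_cases (i : 'I_3) : [\/ i = ix 1, i = ix 2 | i = ix 3].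
Proof.
case: i => [[|[|[|//]]] h]; [apply: Or31|apply: Or32|apply: Or33];
  by apply: val_inj; rewrite /= inordK.
Qed.

Lemma ix_neq : (ix 1 == ix 2 = false) * (ix 2 == ix 1 = false) *
  (ix 1 == ix 3 = false) * (ix 3 == ix 1 = false) *
  (ix 2 == ix 3 = false) * (ix 3 == ix 2 = false).
Proof. by do !split; apply/eqP => /(congr1 val); rewrite /= !inordK. Qed.

Lemma sum3 (V : nmodType) (f : 'I_3 -> V) : \sum_i f i = f (ix 1) + f (ix 2) + f (ix 3).
Proof.
rewrite !big_ord_recl big_ord0 addr0 addrA; congr (f _ + f _ + f _);
  by apply: val_inj; rewrite /= inordK.
Qed.

Lemma catmx1 (a : 'cV[R]_3) (B : 'M[R]_(3, 2)) i : catmx a B i (ix 1) = a i 0.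
Proof.
rewrite /catmx (_ : ix 1 = lshift 2 (0 : 'I_1)); first by rewrite (@row_mxEl _ _ 1 2).
by apply: val_inj; rewrite /= inordK.
Qed.

Lemma catmx2 (a : 'cV[R]_3) (B : 'M[R]_(3, 2)) i : catmx a B i (ix 2) = B i 0.
Proof.
rewrite /catmx (_ : ix 2 = rshift 1 (0 : 'I_2)); first by rewrite (@row_mxEr _ _ 1 2).
by apply: val_inj; rewrite /= inordK.
Qed.

Lemma catmx3 (a : 'cV[R]_3) (B : 'M[R]_(3, 2)) i : catmx a B i (ix 3) = B i 1.
Proof.
rewrite /catmx (_ : ix 3 = rshift 1 (1 : 'I_2)); first by rewrite (@row_mxEr _ _ 1 2).
by apply: val_inj; rewrite /= inordK.
Qed.

Definition catE := (catmx1, catmx2, catmx3).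

Lemma matrix3P (A B : 'M[R]_3) : (forall i, A i (ix 1) = B i (ix 1)) ->
  (forall i, A i (ix 2) = B i (ix 2)) -> (forall i, A i (ix 3) = B i (ix 3)) -> A = B.
Proof.
by move=> h1 h2 h3; apply/matrixP => i j; case: (ord3_cases j) => ->.
Qed.

Lemma mxdotE (m n : nat) (A B : 'M[R]_(m, n)) :
  mxdot A B = \sum_i \sum_j A i j * B i j.
Proof.
rewrite /mxdot /mxtrace; apply: eq_bigr => i _; rewrite mxE.
by apply: eq_bigr => j _; rewrite mxE.
Qed.

Lemma mxdotC (m n : nat) (A B : 'M[R]_(m, n)) : mxdot A B = mxdot B A.
Proof.
by rewrite !mxdotE; apply: eq_bigr => i _; apply: eq_bigr => j _; rewrite mulrC.
Qed.

Lemma mxdotDl (m n : nat) (A B C : 'M[R]_(m, n)) :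
  mxdot (A + B) C = mxdot A C + mxdot B C.
Proof. by rewrite /mxdot mulmxDl mxtraceD. Qed.

Lemma mxdotZl (m n : nat) k (A C : 'M[R]_(m, n)) : mxdot (k *: A) C = k * mxdot A C.
Proof. by rewrite /mxdot -scalemxAl mxtraceZ. Qed.

Lemma mxdotDr (m n : nat) (A B C : 'M[R]_(m, n)) :
  mxdot C (A + B) = mxdot C A + mxdot C B.
Proof. by rewrite mxdotC mxdotDl !(mxdotC C). Qed.

Lemma mxdotZr (m n : nat) k (A C : 'M[R]_(m, n)) : mxdot C (k *: A) = k * mxdot C A.
Proof. by rewrite mxdotC mxdotZl mxdotC. Qed.

Lemma xi_ofE F (p : R * R) i : xi_of F 0 p i 0 = F i (ix 2) * p.1 + F i (ix 3) * p.2.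
Proof.
rewrite /xi_of scale0r addr0 mxE sum3 /evec !mxE !eqxx ?ix_neq /=; ring.
Qed.

Lemma linear_mxE (LL : {linear 'M[R]_3 -> 'M[R]_3}) F i j :
  LL F i j = \sum_k \sum_l F k l * LL (delta_mx k l) i j.
Proof.
rewrite {1}[F]matrix_sum_delta linear_sum summxE; apply: eq_bigr => k _.
rewrite linear_sum summxE; apply: eq_bigr => l _.
by rewrite linearZ mxE.
Qed.

Definition skew3 (a b c : R) : 'M[R]_3 :=
  a *: (delta_mx (ix 1) (ix 2) - delta_mx (ix 2) (ix 1)) +
  b *: (delta_mx (ix 1) (ix 3) - delta_mx (ix 3) (ix 1)) +
  c *: (delta_mx (ix 2) (ix 3) - delta_mx (ix 3) (ix 2)).

Lemma skew3E a b c :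
  (((skew3 a b c)_{1, 1} = 0) * ((skew3 a b c)_{2, 2} = 0) * ((skew3 a b c)_{3, 3} = 0)) *
  (((skew3 a b c)_{1, 2} = a) * ((skew3 a b c)_{2, 1} = - a)) *
  (((skew3 a b c)_{1, 3} = b) * ((skew3 a b c)_{3, 1} = - b)) *
  (((skew3 a b c)_{2, 3} = c) * ((skew3 a b c)_{3, 2} = - c)).
Proof. by do !split; rewrite !mxE !eqxx ?ix_neq /=; ring. Qed.

Lemma skew_skew3 F : Defs.skew F -> F = skew3 (F _{1, 2}) (F _{1, 3}) (F _{2, 3}).
Proof.
move=> sF; have sFE i j : F j i = - F i j.
  by have := congr1 (fun M : 'M[R]_3 => M i j) sF; rewrite !mxE.
have F0 i : F i i = 0 by have := sFE i i; lra.
by apply: matrix3P => i; case: (ord3_cases i) => ->; rewrite skew3E ?F0// -sFE.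
Qed.

Lemma skew3_skew a b c : Defs.skew (skew3 a b c).
Proof.
by apply/matrixP => i j; rewrite [LHS]mxE [RHS]mxE;
  case: (ord3_cases i) => ->; case: (ord3_cases j) => ->; rewrite !skew3E ?opprK ?oppr0.
Qed.

End Matrix3.

(** * The cell problem *)

Lemma ord2_cases (j : 'I_2) : j = 0 \/ j = 1.
Proof. by case: j => [[|[|//]]] h; [left|right]; exact: val_inj. Qed.

Section MatrixL2.
Context d (T : measurableType d) (R : realType).
Variables (mu : {measure set T -> \bar R}) (D : set T).
Hypothesis mD : measurable D.

Lemma is_L2_linear (LL : {linear 'M[R]_3 -> 'M[R]_3}) (X : T -> 'M[R]_3) :
  is_L2 mu D X -> is_L2 mu D (fun p => LL (X p)).
Proof.
move=> sX i j.
apply: (@eq_sqint _ _ _ mu D mD (fun p => \sum_k \sum_l LL (delta_mx k l) i j * X p k l)).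
  move=> p _; rewrite linear_mxE; apply: eq_bigr => k _; apply: eq_bigr => l _.
  exact: mulrC.
apply: (@sqint_sum _ _ _ mu D mD _
  (fun k p => \sum_l LL (delta_mx k l) i j * X p k l)) => k.
apply: (@sqint_sum _ _ _ mu D mD _ (fun l p => LL (delta_mx k l) i j * X p k l)) => l.
exact: (sqintZ mD _ (sX k l)).
Qed.

Lemma intble_mxdot m n (X Y : T -> 'M[R]_(m, n)) : is_L2 mu D X -> is_L2 mu D Y ->
  intble mu D (fun p => mxdot (X p) (Y p)).
Proof.
move=> sX sY.
apply: (@eq_intble _ _ _ mu D mD (fun p => \sum_i \sum_j X p i j * Y p i j)).
  by move=> p _; rewrite mxdotE.
apply: (@intble_sum _ _ _ mu D mD _ (fun i p => \sum_j X p i j * Y p i j)) => i.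
apply: (@intble_sum _ _ _ mu D mD _ (fun j p => X p i j * Y p i j)) => j.
exact: (sqintM mD (sX i j) (sY i j)).
Qed.

End MatrixL2.

Section Cell.
Variables (R : realType) (om : set (R * R)) (LL : {linear 'M[R]_3 -> 'M[R]_3}).
Notation T2 := (measurableTypeR R * measurableTypeR R)%type.
Notation mu2 := (@leb2 R).
Hypothesis oom : open om.
Hypothesis om1 : leb2 om = 1%E.
Variable rad : R.
Hypothesis om_rad : forall p, om p -> `|p.1| <= rad /\ `|p.2| <= rad.
Hypothesis LL_sym : forall F G, mxdot (LL F) G = mxdot F (LL G).
Hypothesis LL_ge0 : forall F, 0 <= mxdot (LL F) F.

Let mom : measurable (om : set T2). Proof. exact: open_measurable2. Qed.
Let om_lty : (mu2 om < +oo)%E. Proof. by rewrite om1 ltry. Qed.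

Lemma is_L2D m n (X Y : R * R -> 'M[R]_(m, n)) k l : is_L2 leb2 om X -> is_L2 leb2 om Y ->
  is_L2 leb2 om (fun p => k *: X p + l *: Y p).
Proof.
move=> sX sY i j; have := sqintD mom (sqintZ mom k (sX i j)) (sqintZ mom l (sY i j)).
by apply: eq_sqint => // p _; rewrite !mxE.
Qed.

Let is_L2_LL (X : R * R -> 'M[R]_3) : is_L2 leb2 om X -> is_L2 leb2 om (fun p => LL (X p)).
Proof. exact: is_L2_linear. Qed.

Let mxdot_intble m n (X Y : R * R -> 'M[R]_(m, n)) : is_L2 leb2 om X -> is_L2 leb2 om Y ->
  intble mu2 om (fun p => mxdot (X p) (Y p)).
Proof. exact: intble_mxdot. Qed.

(** The bilinear form that polarises the integral of Q over the cross-section. *)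
Definition bil (X Y : R * R -> 'M[R]_3) : R := \int[mu2]_(p in om) mxdot (LL (X p)) (Y p).

Lemma bilDr X Y Z k l : is_L2 leb2 om X -> is_L2 leb2 om Y -> is_L2 leb2 om Z ->
  bil X (fun p => k *: Y p + l *: Z p) = k * bil X Y + l * bil X Z.
Proof.
move=> sX sY sZ; have sLX := is_L2_LL sX.
rewrite /bil -!RintegralZl//; try exact: mxdot_intble.
rewrite -RintegralD//; try by apply: intbleZ => //; exact: mxdot_intble.
by apply: eq_Rintegral => p _; rewrite mxdotDr !mxdotZr.
Qed.

Lemma bilC X Y : bil X Y = bil Y X.
Proof. by apply: eq_Rintegral => p _; rewrite LL_sym mxdotC. Qed.

Lemma bil_ge0 X : 0 <= bil X X.
Proof. by apply: Rintegral_ge0 => p _; exact: LL_ge0. Qed.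

Lemma bil_quad X Y k l : is_L2 leb2 om X -> is_L2 leb2 om Y ->
  bil (fun p => k *: X p + l *: Y p) (fun p => k *: X p + l *: Y p) =
  k ^+ 2 * bil X X + 2 * k * l * bil X Y + l ^+ 2 * bil Y Y.
Proof.
move=> sX sY; have sXY := is_L2D k l sX sY.
rewrite bilDr// (bilC _ X) (bilC _ Y) !bilDr// (bilC Y X); ring.
Qed.

(** ** Weak gradients *)

Lemma test_intble (b : R * R -> R) (phi : R * R -> R) : sqint mu2 om b -> continuous phi ->
  (exists C, forall p, `|phi p| <= C) -> intble mu2 om (fun p => b p * phi p).
Proof.
move=> sb cphi [C hC]; apply: sqintM => //.
apply: (@bounded_sqint _ _ _ mu2 om mom om_lty C).
  by apply: measurable_funTS; exact: continuous_measurable2.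
by apply: aeW => p _.
Qed.

Lemma test_fun_bounded phi : test_fun om phi -> exists C, forall p, `|phi p| <= C.
Proof.
move=> tphi; have [_ [K [cK _ K0]]] := tphi.
exact: (compact_supp_bounded cK (test_fun_continuous tphi) K0).
Qed.

Lemma test_funD_bounded phi v : test_fun om phi -> exists C, forall p, `|'D_v phi p| <= C.
Proof.
move=> tphi; have [_ [K [cK _ K0]]] := tphi.
exact: (compact_supp_bounded cK (@test_fun_continuousD _ om phi v tphi) (@derive_supp _ K phi v cK K0)).
Qed.

Lemma is_wgradD b1 b2 G1 G2 k l : is_L2 leb2 om b1 -> is_L2 leb2 om b2 ->
  is_L2 leb2 om G1 -> is_L2 leb2 om G2 -> is_wgrad om b1 G1 -> is_wgrad om b2 G2 ->
  is_wgrad om (fun p => k *: b1 p + l *: b2 p) (fun p => k *: G1 p + l *: G2 p).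
Proof.
move=> s1 s2 t1 t2 w1 w2 i phi tphi.
have [h1 h2] := w1 i phi tphi; have [h3 h4] := w2 i phi tphi.
have cphi := test_fun_continuous tphi; have bphi := test_fun_bounded tphi.
have lin (u v w : R * R -> R) : sqint mu2 om u -> sqint mu2 om v -> continuous w ->
    (exists C, forall p, `|w p| <= C) ->
    \int[mu2]_(p in om) ((k * u p + l * v p) * w p) =
    k * \int[mu2]_(p in om) (u p * w p) + l * \int[mu2]_(p in om) (v p * w p).
  move=> su sv cw bw.
  rewrite -!RintegralZl//; try exact: test_intble.
  rewrite -RintegralD//; try by apply: intbleZ => //; exact: test_intble.
  by apply: eq_Rintegral => p _; ring.
have cD v : continuous ('D_v phi) := @test_fun_continuousD _ om phi v tphi.
have bD v := test_funD_bounded v tphi.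
split.
- under eq_Rintegral do rewrite !mxE.
  under [in RHS]eq_Rintegral do rewrite !mxE.
  rewrite !lin//; [|exact: t1|exact: t2|exact: s1|exact: s2].
  by rewrite h1 h3; ring.
- under eq_Rintegral do rewrite !mxE.
  under [in RHS]eq_Rintegral do rewrite !mxE.
  rewrite !lin//; [|exact: t1|exact: t2|exact: s1|exact: s2].
  by rewrite h2 h4; ring.
Qed.

(** The difference of the gradients is orthogonal to all products of bumps. *)
Lemma is_wgrad_unique b G1 G2 : is_L2 leb2 om G1 -> is_L2 leb2 om G2 ->
  is_wgrad om b G1 -> is_wgrad om b G2 -> {ae mu2, forall p, om p -> G1 p = G2 p}.
Proof.
move=> s1 s2 w1 w2.
have u i j : {ae mu2, forall p, om p -> G1 p i j - G2 p i j = 0}.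
  apply: fundamental_lemma_open => //.
    apply: (sqint_intble mom om_lty).
    exact: (sqintB mom (s1 i j) (s2 i j)).
  move=> phi tphi; have [h1 h2] := w1 i phi tphi; have [h3 h4] := w2 i phi tphi.
  have cphi := test_fun_continuous tphi; have bphi := test_fun_bounded tphi.
  under eq_Rintegral do rewrite mulrBl.
  rewrite RintegralB//; [|exact: (test_intble (s1 i j))|exact: (test_intble (s2 i j))].
  apply/eqP; rewrite subr_eq0; apply/eqP; apply: oppr_inj.
  by case: (ord2_cases j) => ->; [rewrite -h1 -h3|rewrite -h2 -h4].
have := filter_forall (ae_leb2_filter R) (fun i => filter_forall (ae_leb2_filter R) (u i)).
apply: filterS => p h omp; apply/matrixP => i j.
by apply/eqP; rewrite -subr_eq0 h.
Qed.

Lemma wgradP b : is_H1_om om b ->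
  is_L2 leb2 om (wgrad om b) /\ is_wgrad om b (wgrad om b).
Proof.
move=> [_ [G [sG wG]]]; rewrite /wgrad; case: xgetP => [G' _ [//]|/(_ G)[]].
by split.
Qed.

(** ** Admissible strain fields *)

Definition strain (F : 'M[R]_3) (G : R * R -> 'M[R]_(3, 2)) (p : R * R) : 'M[R]_3 :=
  catmx (xi_of F 0 p) (G p).

Lemma coord_sqint1 : sqint mu2 om (fun p => p.1).
Proof.
apply: (@bounded_sqint _ _ _ mu2 om mom om_lty rad).
  by apply: measurable_funTS; exact: measurable_fst.
by apply: aeW => p /om_rad[].
Qed.

Lemma coord_sqint2 : sqint mu2 om (fun p => p.2).
Proof.
apply: (@bounded_sqint _ _ _ mu2 om mom om_lty rad).
  by apply: measurable_funTS; exact: measurable_snd.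
by apply: aeW => p /om_rad[].
Qed.

Lemma strain_L2 F G : is_L2 leb2 om G -> is_L2 leb2 om (strain F G).
Proof.
move=> sG i j; case: (ord3_cases j) => ->.
- apply: (@eq_sqint _ _ _ mu2 om mom (fun p => F i (ix 2) * p.1 + F i (ix 3) * p.2)).
    by move=> p _; rewrite catmx1 xi_ofE.
  by apply: (sqintD mom); apply: (sqintZ mom); [exact: coord_sqint1|exact: coord_sqint2].
- by apply: (@eq_sqint _ _ _ mu2 om mom _ _ _ (sG i 0)) => p _; rewrite catmx2.
- by apply: (@eq_sqint _ _ _ mu2 om mom _ _ _ (sG i 1)) => p _; rewrite catmx3.
Qed.

Lemma strainD F1 F2 G1 G2 k l : strain (k *: F1 + l *: F2) (fun p => k *: G1 p + l *: G2 p) =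
  (fun p => k *: strain F1 G1 p + l *: strain F2 G2 p).
Proof.
apply/funext => p; apply: matrix3P => i.
- by rewrite /strain catmx1 [RHS]mxE [in RHS]mxE [X in _ = _ + X]mxE !catmx1 !xi_ofE !mxE; ring.
- by rewrite /strain catmx2 [RHS]mxE [in RHS]mxE [X in _ = _ + X]mxE !catmx2 !mxE.
- by rewrite /strain catmx3 [RHS]mxE [in RHS]mxE [X in _ = _ + X]mxE !catmx3 !mxE.
Qed.

Definition trace_free (X : R * R -> 'M[R]_3) :=
  {ae mu2, forall p, om p -> \tr (X p) = 0}.

Definition adm (F : 'M[R]_3) (X : R * R -> 'M[R]_3) := exists b G,
  [/\ is_L2 leb2 om b, is_L2 leb2 om G, is_wgrad om b G, X = strain F G & trace_free X].

Lemma adm_L2 F X : adm F X -> is_L2 leb2 om X.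
Proof. by move=> [b [G [_ sG _ -> _]]]; exact: strain_L2. Qed.

Lemma adm_comb F1 F2 X1 X2 k l : adm F1 X1 -> adm F2 X2 ->
  adm (k *: F1 + l *: F2) (fun p => k *: X1 p + l *: X2 p).
Proof.
move=> [b1 [G1 [s1 t1 w1 -> tr1]]] [b2 [G2 [s2 t2 w2 -> tr2]]].
exists (fun p => k *: b1 p + l *: b2 p), (fun p => k *: G1 p + l *: G2 p).
split; [exact: is_L2D|exact: is_L2D|exact: is_wgradD|by rewrite strainD|].
apply: filterS2 tr1 tr2 => p e1 e2 omp.
by rewrite mxtraceD !mxtraceZ e1// e2// !mulr0 addr0.
Qed.

Variable Q : 'M[R]_3 -> R.
Hypothesis QE : forall F, Q F = mxdot (LL F) F.

Lemma Qxi_strain F b G : is_L2 leb2 om b -> is_L2 leb2 om G -> is_wgrad om b G ->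
  trace_free (strain F G) ->
  Qxi om Q (xi_of F 0) b = (bil (strain F G) (strain F G))%:E.
Proof.
move=> sb sG wG trG.
have [sw ww] := wgradP (conj sb (ex_intro _ G (conj sG wG))).
have e := is_wgrad_unique sw sG ww wG.
rewrite /Qxi; case: ifPn => [_|/asboolP[]]; last first.
  by apply: filterS2 e trG => p e trG omp; rewrite e//; exact: trG.
have sX := strain_L2 F sG; have sY := strain_L2 F sw.
rewrite /bil -EFin_Rintegral//; last by apply: mxdot_intble => //; exact: is_L2_LL.
apply: ae_eq_integral => //.
- apply: (@eq_measurable_fun _ _ _ _ om (fun p => (mxdot (LL (strain F (wgrad om b) p)) (strain F (wgrad om b) p))%:E)).
    by move=> p _; rewrite QE.
  by apply: (measurable_int mu2); apply: mxdot_intble => //; exact: is_L2_LL.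
- by apply: (measurable_int mu2); apply: mxdot_intble => //; exact: is_L2_LL.
- by apply: filterS e => p e omp; rewrite QE /strain e.
Qed.

Lemma Qstar_le F X : adm F X -> (Qstar om Q F 0 <= (bil X X)%:E)%E.
Proof.
move=> [b [G [sb sG wG -> trG]]]; apply: ereal_inf_lbound; exists b; last exact: Qxi_strain.
by split => //; exists G.
Qed.

Lemma Qxi_adm F b : is_H1_om om b ->
  Qxi om Q (xi_of F 0) b = +oo%E \/
  exists2 X, adm F X & Qxi om Q (xi_of F 0) b = (bil X X)%:E.
Proof.
move=> hb; have [sw ww] := wgradP hb; have [sb _] := hb.
have [trG|trG] := pselect (trace_free (strain F (wgrad om b))).
  right; exists (strain F (wgrad om b)); last exact: Qxi_strain.
  by exists b, (wgrad om b).
by left; rewrite /Qxi; case: ifPn => // /asboolP h; exfalso; apply: trG.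
Qed.

(** Competitors of infinite energy do not count, so admissible strain fields decide
    the infimum. *)
Lemma le_Qstar F m : (forall X, adm F X -> m <= bil X X) -> (m%:E <= Qstar om Q F 0)%E.
Proof.
move=> h; apply: le_ereal_inf_tmp => _ [b hb <-].
have [->|[X aX ->]] := Qxi_adm F hb; first exact: leey.
by rewrite lee_fin; exact: h.
Qed.

(** The given gradient G agrees almost everywhere with the chosen weak gradient of
    b, so the stress may be computed from either. *)
Lemma minimizer_strain F b G : is_minimizer om Q F 0 b -> (Qstar om Q F 0 < +oo)%E ->
  is_L2 leb2 om G -> is_wgrad om b G ->
  adm F (strain F G) /\ Qstar om Q F 0 = (bil (strain F G) (strain F G))%:E.
Proof.
move=> [hb e] lt sG wG; have [sw ww] := wgradP hb; have [sb _] := hb.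
have eG := is_wgrad_unique sw sG ww wG.
have trG : trace_free (strain F G).
  move: e lt => <-; rewrite /Qxi; case: ifPn => [/asboolP h _|]; last by rewrite ltxx.
  by apply: filterS2 eG h => p eG h omp; rewrite /strain -eG// h.
split; last by rewrite -e; exact: Qxi_strain.
by exists b, G.
Qed.

(** The reduced density is convex and, at a minimizer, it is touched from above
    by the quadratic polynomial given by a competitor X'. The lower bound uses
    as competitor the midpoint of an arbitrary field for F + F' and of the
    reflected field X - X'. *)
Lemma Qstar_upper F F' X X' : adm F X -> adm F' X' ->
  (Qstar om Q (F + F') 0 <= (bil X X + 2 * bil X X' + bil X' X')%:E)%E.
Proof.
move=> aX aX'; have := Qstar_le (adm_comb 1 1 aX aX').
rewrite !scale1r bil_quad; [|exact: adm_L2 aX|exact: adm_L2 aX'].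
by congr (_ <= _%:E)%E; ring.
Qed.

Lemma Qstar_lower F F' X X' : adm F X -> adm F' X' ->
  Qstar om Q F 0 = (bil X X)%:E ->
  ((bil X X + 2 * bil X X' - bil X' X')%:E <= Qstar om Q (F + F') 0)%E.
Proof.
move=> aX aX' minX; apply: le_Qstar => Y aY.
have aZ := adm_comb 1 (-1) aX aX'.
have := Qstar_le (adm_comb 2^-1 2^-1 aY aZ).
rewrite (_ : 2^-1 *: (F + F') + 2^-1 *: (1 *: F + -1 *: F') = F); last by apply/matrixP => i j; rewrite !mxE; field.
rewrite minX lee_fin; have sY := adm_L2 aY; have sZ := adm_L2 aZ.
have sX := adm_L2 aX; have sX' := adm_L2 aX'.
set Z := (fun p => 1 *: X p + (-1) *: X' p) in aZ sZ *.
have bZ : bil Z Z = bil X X - 2 * bil X X' + bil X' X' by rewrite bil_quad//; ring.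
have par : 0 <= bil Y Y - 2 * bil Y Z + bil Z Z.
  rewrite [leRHS](_ : _ = 1 ^+ 2 * bil Y Y + 2 * 1 * -1 * bil Y Z + (-1) ^+ 2 * bil Z Z).
    by rewrite -bil_quad//; exact: bil_ge0.
  by ring.
rewrite bil_quad//; set u := bil Y Y in par *; set v := bil Y Z in par *.
rewrite bZ in par *.
set a := bil X X in par *; set b := bil X X' in par *; set c := bil X' X' in par *.
move=> h; lra.
Qed.

End Cell.

(** ** A polynomial competitor for every skew matrix *)

Lemma quadform3_le (R : realType) (a b c u1 u2 u3 u4 u5 u6 : R) :
  a ^+ 2 * u1 + b ^+ 2 * u2 + c ^+ 2 * u3 + 2 * a * b * u4 + 2 * a * c * u5 + 2 * b * c * u6 <=
  (`|u1| + `|u2| + `|u3| + `|u4| + `|u5| + `|u6|) * (a ^+ 2 + b ^+ 2 + c ^+ 2).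
Proof.
have sq (x u : R) : x ^+ 2 * u <= `|u| * x ^+ 2 by rewrite mulrC ler_wpM2r ?sqr_ge0// ler_norm.
have cross (x y u : R) : 2 * x * y * u <= `|u| * (x ^+ 2 + y ^+ 2).
  have h : `|2 * x * y| <= x ^+ 2 + y ^+ 2.
    have q1 := sqr_ge0 (x + y); have q2 := sqr_ge0 (x - y).
    by rewrite ler_norml; apply/andP; split; lra.
  apply: (le_trans (ler_norm _)); rewrite normrM mulrC; exact: ler_wpM2l.
have pos (x u : R) : 0 <= `|u| * x ^+ 2 by rewrite mulr_ge0 ?sqr_ge0.
apply: le_trans (lerD (lerD (lerD (lerD (lerD (sq a u1) (sq b u2)) (sq c u3))
  (cross a b u4)) (cross a c u5)) (cross b c u6)) _.
rewrite -subr_ge0; set t := (X in 0 <= X).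
have -> : t = `|u1| * b ^+ 2 + `|u1| * c ^+ 2 + (`|u2| * a ^+ 2 + `|u2| * c ^+ 2) +
    (`|u3| * a ^+ 2 + `|u3| * b ^+ 2) + `|u4| * c ^+ 2 + `|u5| * b ^+ 2 + `|u6| * a ^+ 2.
  by rewrite /t; ring.
by rewrite !addr_ge0.
Qed.

Section Competitor.
Variables (R : realType) (om : set (R * R)) (LL : {linear 'M[R]_3 -> 'M[R]_3}).
Notation T2 := (measurableTypeR R * measurableTypeR R)%type.
Notation mu2 := (@leb2 R).
Hypothesis oom : open om.
Hypothesis om1 : leb2 om = 1%E.
Variable rad : R.
Hypothesis om_rad : forall p, om p -> `|p.1| <= rad /\ `|p.2| <= rad.
Hypothesis LL_sym : forall F G, mxdot (LL F) G = mxdot F (LL G).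

Let mom : measurable (om : set T2). Proof. exact: open_measurable2. Qed.
Let om_lty : (mu2 om < +oo)%E. Proof. by rewrite om1 ltry. Qed.
Let s1 : sqint mu2 om (fun p => p.1) := coord_sqint1 oom om1 om_rad.
Let s2 : sqint mu2 om (fun p => p.2) := coord_sqint2 oom om1 om_rad.

(** The bending strain of [skew3 a b c] has the entry a x_2 + b x_3 in the corner
    (1,1). The in-plane divergence of this field compensates it, so that the sum
    is trace-free. *)
Definition pot (a b : R) (p : R * R) : 'cV[R]_3 :=
  \col_i if i == ix 2 then - a / 2 * p.1 ^+ 2
         else if i == ix 3 then - b / 2 * p.2 ^+ 2 else 0.

Definition grad_pot (a b : R) (p : R * R) : 'M[R]_(3, 2) :=
  \matrix_(i, j) if j == 0 then (if i == ix 2 then - a * p.1 else 0)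
                 else (if i == ix 3 then - b * p.2 else 0).

Definition testF (a b c : R) := strain (skew3 a b c) (grad_pot a b).

Lemma grad_pot_L2 a b : is_L2 leb2 om (grad_pot a b).
Proof.
move=> i j; have z : sqint mu2 om (fun=> 0) by exact: sqint0.
apply: (@eq_sqint _ _ _ mu2 om mom (fun p => if j == 0 then (if i == ix 2 then - a * p.1 else 0)
                 else (if i == ix 3 then - b * p.2 else 0))).
  by move=> p _; rewrite mxE.
by case: (j == 0); [case: (i == ix 2)|case: (i == ix 3)] => //; apply: (sqintZ mom).
Qed.

Lemma pot_L2 a b : is_L2 leb2 om (pot a b).
Proof.
move=> i j; have z : sqint mu2 om (fun=> 0) by exact: sqint0.
have sq1 : sqint mu2 om (fun p => p.1 * p.1).
  apply: (@sqint_bM _ _ _ mu2 om mom rad); [exact: sqint_meas s1| |exact: s1].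
  by apply: aeW => p /om_rad[].
have sq2 : sqint mu2 om (fun p => p.2 * p.2).
  apply: (@sqint_bM _ _ _ mu2 om mom rad); [exact: sqint_meas s2| |exact: s2].
  by apply: aeW => p /om_rad[].
apply: (@eq_sqint _ _ _ mu2 om mom (fun p => if i == ix 2 then - a / 2 * (p.1 * p.1)
         else if i == ix 3 then - b / 2 * (p.2 * p.2) else 0)).
  by move=> p _; rewrite mxE !expr2.
by case: (i == ix 2); [|case: (i == ix 3) => //]; apply: (sqintZ mom).
Qed.

Let dsq (k x : R) : is_derive x (1 : R) (fun y => k / 2 * y ^+ 2) (k * x).
Proof.
apply: (@is_derive_quad _ _ _ _ `|k / 2|) => h.
rewrite (_ : _ - _ - _ = k / 2 * h ^+ 2); last by field.
by rewrite normrM (ger0_norm (sqr_ge0 h)).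
Qed.

Let dc (k x : R) : is_derive x (1 : R) (fun _ : R => k) 0.
Proof. exact: is_derive_cst. Qed.

Let clin (k : R) : continuous (fun x : R => k * x).
Proof. by move=> x; apply: cvgM; [exact: cvg_cst|exact: cvg_id]. Qed.

Let ccst (k : R) : continuous (fun _ : R => k : R).
Proof. by move=> x; exact: cvg_cst. Qed.

Lemma pot_wgrad a b : is_wgrad om (pot a b) (grad_pot a b).
Proof.
move=> i phi tphi.
have b1 k := by_parts_tensor1 oom tphi (dsq k) (@clin k) (dc 1) (@ccst 0).
have b2 k := by_parts_tensor2 oom tphi (dsq k) (@clin k) (dc 1) (@ccst 0).
have b3 k := by_parts_tensor1 oom tphi (dc 1) (@ccst 0) (dsq k) (@clin k).
have b4 k := by_parts_tensor2 oom tphi (dc 1) (@ccst 0) (dsq k) (@clin k).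
have z (F : R * R -> R) : \int[mu2]_(p in om) (0 * F p) = 0.
  by under eq_Rintegral do rewrite mul0r; rewrite Rintegral_cst// mul0r.
case: (ord3_cases i) => ->.
- split; under eq_Rintegral do rewrite mxE !ix_neq;
    under [in RHS]eq_Rintegral do rewrite mxE /= ?ix_neq; by rewrite !z oppr0.
- split; under eq_Rintegral do rewrite mxE eqxx;
    under [in RHS]eq_Rintegral do rewrite mxE /= ?eqxx ?ix_neq.
  + have := b1 (- a); under eq_Rintegral do rewrite mulr1.
    by under [in RHS]eq_Rintegral do rewrite mulr1.
  + have := b2 (- a); under eq_Rintegral do rewrite mulr1.
    by under [in RHS]eq_Rintegral do rewrite mulr0.
- split; under eq_Rintegral do rewrite mxE ix_neq eqxx;
    under [in RHS]eq_Rintegral do rewrite mxE /= ?eqxx ?ix_neq.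
  + have := b3 (- b); under eq_Rintegral do rewrite mul1r.
    by under [in RHS]eq_Rintegral do rewrite mul0r.
  + have := b4 (- b); under eq_Rintegral do rewrite mul1r.
    by under [in RHS]eq_Rintegral do rewrite mul1r.
Qed.

Lemma testF_cols a b c p :
  (forall i, testF a b c p i (ix 1) = (skew3 a b c) i (ix 2) * p.1 + (skew3 a b c) i (ix 3) * p.2) /\
  (forall i, testF a b c p i (ix 2) = if i == ix 2 then - a * p.1 else 0) /\
  (forall i, testF a b c p i (ix 3) = if i == ix 3 then - b * p.2 else 0).
Proof.
split; [|split] => i; rewrite /testF /strain ?catE ?xi_ofE// mxE//.
Qed.

Lemma testF_adm a b c : adm om (skew3 a b c) (testF a b c).
Proof.
exists (pot a b), (grad_pot a b); split.
- exact: pot_L2.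
- exact: grad_pot_L2.
- exact: pot_wgrad.
- by [].
- apply: aeW => p _; have [h1 [h2 h3]] := testF_cols a b c p.
  by rewrite /mxtrace sum3 h1 h2 h3 !eqxx !skew3E; ring.
Qed.

Lemma testF_lin a b c : testF a b c =
  (fun p => 1 *: (a *: testF 1 0 0 p + b *: testF 0 1 0 p) + c *: testF 0 0 1 p).
Proof.
apply/funext => p; apply: matrix3P => i;
  have [h1 [h2 h3]] := testF_cols a b c p; have [k1 [k2 k3]] := testF_cols 1 0 0 p;
  have [l1 [l2 l3]] := testF_cols 0 1 0 p; have [m1 [m2 m3]] := testF_cols 0 0 1 p.
- move: (testF a b c p) (testF 1 0 0 p) (testF 0 1 0 p) (testF 0 0 1 p) h1 k1 l1 m1.
  move=> Y0 Y1 Y2 Y3 h1 k1 l1 m1; rewrite !mxE h1 k1 l1 m1.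
  by case: (ord3_cases i) => ->; rewrite !skew3E; ring.
- move: (testF a b c p) (testF 1 0 0 p) (testF 0 1 0 p) (testF 0 0 1 p) h2 k2 l2 m2.
  move=> Y0 Y1 Y2 Y3 h2 k2 l2 m2; rewrite !mxE h2 k2 l2 m2.
  by case: (i == ix 2); ring.
- move: (testF a b c p) (testF 1 0 0 p) (testF 0 1 0 p) (testF 0 0 1 p) h3 k3 l3 m3.
  move=> Y0 Y1 Y2 Y3 h3 k3 l3 m3; rewrite !mxE h3 k3 l3 m3.
  by case: (i == ix 3); ring.
Qed.

(** The energy of the competitor is a quadratic form in its three parameters. *)
Lemma bil_testF_bound : exists2 C, 0 <= C & forall a b c,
  bil om LL (testF a b c) (testF a b c) <= C * (a ^+ 2 + b ^+ 2 + c ^+ 2).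
Proof.
have t1 := adm_L2 oom om1 om_rad (testF_adm 1 0 0).
have t2 := adm_L2 oom om1 om_rad (testF_adm 0 1 0).
have t3 := adm_L2 oom om1 om_rad (testF_adm 0 0 1).
set Y1 := testF 1 0 0 in t1 *; set Y2 := testF 0 1 0 in t2 *; set Y3 := testF 0 0 1 in t3 *.
pose B := bil om LL.
exists (`|B Y1 Y1| + `|B Y2 Y2| + `|B Y3 Y3| + `|B Y1 Y2| + `|B Y1 Y3| + `|B Y2 Y3|).
  by rewrite !addr_ge0.
move=> a b c; rewrite testF_lin.
have t12 := is_L2D oom a b t1 t2.
rewrite bil_quad// bil_quad//.
rewrite (bilC _ LL_sym _ Y3) bilDr// !(bilC _ LL_sym Y3) -/B.
apply: le_trans (quadform3_le a b c (B Y1 Y1) (B Y2 Y2) (B Y3 Y3) (B Y1 Y2) (B Y1 Y3) (B Y2 Y3)).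
move: (B Y1 Y1) (B Y2 Y2) (B Y3 Y3) (B Y1 Y2) (B Y1 Y3) (B Y2 Y3); clear => u1 u2 u3 u4 u5 u6.
by rewrite le_eqVlt; apply/orP; left; apply/eqP; ring.
Qed.

(** The first variation of the reduced energy only sees three combinations of
    the moments of the stress. *)
Lemma bil_testF X a b c : is_L2 leb2 om X ->
  let m2 i j := \int[mu2]_(p in om) (p.1 * LL (X p) i j) in
  let m3 i j := \int[mu2]_(p in om) (p.2 * LL (X p) i j) in
  bil om LL X (testF a b c) =
  a * (m2 (ix 1) (ix 1) - m2 (ix 2) (ix 2)) + b * (m3 (ix 1) (ix 1) - m3 (ix 3) (ix 3)) +
  c * (m3 (ix 2) (ix 1) - m2 (ix 3) (ix 1)).
Proof.
move=> sX m2 m3; have sL := is_L2_linear mom LL sX.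
have i2 i j : intble mu2 om (fun p => p.1 * LL (X p) i j) by exact: (sqintM mom s1 (sL i j)).
have i3 i j : intble mu2 om (fun p => p.2 * LL (X p) i j) by exact: (sqintM mom s2 (sL i j)).
have j1 := intbleB mom (i2 (ix 1) (ix 1)) (i2 (ix 2) (ix 2)).
have j2 := intbleB mom (i3 (ix 1) (ix 1)) (i3 (ix 3) (ix 3)).
have j3 := intbleB mom (i3 (ix 2) (ix 1)) (i2 (ix 3) (ix 1)).
have e1 := RintegralB mom (i2 (ix 1) (ix 1)) (i2 (ix 2) (ix 2)).
have e2 := RintegralB mom (i3 (ix 1) (ix 1)) (i3 (ix 3) (ix 3)).
have e3 := RintegralB mom (i3 (ix 2) (ix 1)) (i2 (ix 3) (ix 1)).
rewrite /m2 /m3 -e1 -e2 -e3.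
rewrite -(RintegralZl a mom j1) -(RintegralZl b mom j2) -(RintegralZl c mom j3).
have k1 := intbleZ mom a j1; have k2 := intbleZ mom b j2; have k3 := intbleZ mom c j3.
rewrite -(RintegralD mom k1 k2) -(RintegralD mom (intbleD mom k1 k2) k3).
apply: eq_Rintegral => p _; have [h1 [h2 h3]] := testF_cols a b c p.
by rewrite mxdotE !sum3 !h1 !h2 !h3 !eqxx !ix_neq !skew3E; ring.
Qed.

End Competitor.

(** * Nonnegativity of the Hessian *)

Section Hessian.
Variable R : realType.

Lemma line_derive (V : normedModType R) (W : V -> R) (x F : V) (s : R) :
  derivable W (x + s *: F) F ->
  is_derive s (1 : R) (fun t => W (x + t *: F)) ('D_F W (x + s *: F)).
Proof.
have e (h : R) : x + (h *: (1 : R) + s) *: F = h *: F + (x + s *: F).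
  by rewrite -[h *: 1]/(h * 1) mulr1 scalerDl addrCA.
rewrite /derivable => dW; split.
  rewrite /derivable; set d1 := (fun h => _).
  set d := (fun h => _) in dW.
  by have -> : d1 = d by apply/funext => k; rewrite /d /d1 /= e.
rewrite /derive; set d1 := (fun h => _); set d := (fun h => _ *: ((W \o _) _ - _)).
by have -> : d1 = d by apply/funext => k; rewrite /d /d1 /= e.
Qed.

(** At a minimum the second derivative is nonnegative: otherwise, by the mean
    value theorem, f(t) + f(-t) would fall below 2 f(0). *)
Lemma second_derivative_min (f f1 : R -> R) (d l : R) : 0 < d ->
  (forall t, `|t| < d -> is_derive t (1 : R) f (f1 t)) ->
  is_derive (0 : R) (1 : R) f1 l ->
  (forall t, f 0 <= f t) -> 0 <= l.
Proof.
move=> d0 df d1 fmin; rewrite leNgt; apply/negP => l0.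
have [e [e0 he]] : exists e : R, 0 < e /\ forall s, s != 0 -> `|s| < e ->
    s^-1 * (f1 s - f1 0) < 0.
  have [ex lE] := d1.
  have h : (fun h : R => h^-1 *: ((f1 \o shift 0) (h *: (1 : R)) - f1 0)) @ 0^' --> l.
    by rewrite -lE; exact: ex.
  move/cvgrPdist_lt : h => /(_ (- l)); rewrite oppr_gt0 => /(_ l0).
  rewrite /dnbhs/= near_withinE nearE => -[e /= e0 he].
  exists e; split => // s s0 se.
  have : `|l - s^-1 *: (f1 (s *: (1 : R) + 0) - f1 0)| < - l.
    by apply: (he s) => //=; rewrite sub0r normrN.
  rewrite addr0 -[s *: 1]/(s * 1) mulr1 -[_ *: _]/(_ * _).
  by rewrite ltr_distl => /andP[]; lra.
pose t := Num.min d e / 2.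
have t0 : 0 < t by rewrite divr_gt0// lt_min d0.
have td : t < d by rewrite /t ltr_pdivrMr// (@le_lt_trans _ _ d) ?ge_min ?lexx// ltr_pMr// ltr1n.
have te : t < e by rewrite /t ltr_pdivrMr// (@le_lt_trans _ _ e) ?ge_min ?lexx ?orbT// ltr_pMr// ltr1n.
have cf x : `|x| <= t -> {for x, continuous f}.
  move=> xt; apply/differentiable_continuous/derivable1_diffP.
  by have [] := df x (le_lt_trans xt td).
have ctn a b : - t <= a -> b <= t -> {within `[a, b], continuous f}.
  move=> ha hb; apply: continuous_in_subspaceT => x /set_mem /=; rewrite in_itv/= => /andP[ax xb].
  by apply: cf; rewrite ler_norml (le_trans ha)// (le_trans xb).
have dd a b : - t <= a -> b <= t -> forall x, x \in `]a, b[ -> is_derive x (1 : R) f (f1 x).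
  move=> ha hb x; rewrite in_itv/= => /andP[ax xb]; apply: df.
  by rewrite (le_lt_trans _ td)// ler_norml (le_trans ha (ltW ax)) (le_trans (ltW xb)).
have nt : - t <= 0 by rewrite oppr_le0 ltW.
have [x xI fx] := MVT t0 (dd 0 t nt (lexx t)) (ctn 0 t nt (lexx t)).
have nt' : - t < 0 by rewrite oppr_lt0.
have [y yI fy] := MVT nt' (dd (- t) 0 (lexx _) (ltW t0)) (ctn (- t) 0 (lexx _) (ltW t0)).
move: xI yI; rewrite !in_itv/= => /andP[x0 xt] /andP[yt y0].
have hx : f1 x < f1 0.
  have := he x (lt0r_neq0 x0) _; rewrite gtr0_norm// => /(_ (lt_trans xt te)).
  by rewrite pmulr_rlt0 ?invr_gt0// subr_lt0.
have hy : f1 0 < f1 y.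
  have := he y _ _; rewrite lt_eqF// ltr0_norm// => /(_ isT).
  have ye : - y < e by rewrite (lt_trans _ te)// ltrNl.
  by move=> /(_ ye); rewrite nmulr_rlt0 ?invr_lt0// subr_gt0.
have m1 := fmin t; have m2 := fmin (- t).
rewrite subr0 in fx; rewrite sub0r opprK in fy.
have k1 : f1 x * t < f1 0 * t by rewrite ltr_pM2r.
have k2 : f1 0 * t < f1 y * t by rewrite ltr_pM2r.
lra.
Qed.

Lemma SO3_1 : @SO3 R 1%:M.
Proof. by split; [rewrite trmx1 mulmx1|rewrite det1]. Qed.

(** The density is nonnegative and vanishes at the identity. *)
Lemma hessQ_ge0 (W : 'M[R]_3 -> R) F : energy_density W -> 0 <= hessQ W F.
Proof.
move=> [W0 [U [oU SU [C1 C2]]] W1 _ _].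
have U1 : U 1%:M by apply: SU; exact: SO3_1.
have [d d0 hd] : exists2 d : R, 0 < d & forall t : R, `|t| < d -> U (1%:M + t *: F).
  have ct : {for (0 : R), continuous (fun t : R => (1%:M + t *: F : 'M[R]_3))}.
    apply: cvgD; first exact: cvg_cst.
    by apply: cvgZr_tmp; exact: cvg_id.
  have nU : nbhs (1%:M + (0 : R) *: F : 'M[R]_3) U.
    by rewrite scale0r addr0; exact: open_nbhs_nbhs.
  have := ct _ nU; rewrite nbhs_simpl/= => -[e /= e0 he].
  by exists e => // t te; apply: (he t); rewrite /= sub0r normrN.
have W' t : `|t| < d -> is_derive t (1 : R) (fun t => W (1%:M + t *: F)) ('D_F W (1%:M + t *: F)).
  by move=> td; apply: line_derive; have [h _] := C1 F; exact: h (hd t td).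
have W'' : is_derive (0 : R) (1 : R) (fun t => 'D_F W (1%:M + t *: F)) (hessQ W F).
  rewrite /hessQ.
  have -> : 'D_F ('D_F W) 1%:M = 'D_F ('D_F W) (1%:M + 0 *: F) by rewrite scale0r addr0.
  apply: (@line_derive _ ('D_F W)); rewrite scale0r addr0.
  by have [h _] := C2 F F; exact: h.
have Wmin (t : R) : W (1%:M + (0 : R) *: F) <= W (1%:M + t *: F) by rewrite scale0r addr0 W1.
exact: second_derivative_min d0 W' W'' Wmin.
Qed.

End Hessian.

(** * Functions on the rod *)

Section Rod.
Variables (R : realType) (L : R) (om : set (R * R)).
Notation T1 := (measurableTypeR R).
Notation T2 := (measurableTypeR R * measurableTypeR R)%type.
Notation mu := (@lebesgue_measure R).
Notation mu2 := (@leb2 R).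
Notation mu3 := (mu \x mu2)%E.
Hypothesis oom : open om.
Hypothesis om1 : leb2 om = 1%E.
Notation I := (`]0, L[%classic : set (measurableTypeR R)).
Notation rod := (I `*` om : set (T1 * T2)).

Let mom : measurable (om : set T2). Proof. exact: open_measurable2. Qed.
Let om_lty : (mu2 om < +oo)%E. Proof. by rewrite om1 ltry. Qed.
Let mI : measurable I. Proof. exact: measurable_itv. Qed.
Let mrod : measurable rod. Proof. exact: measurableX. Qed.
Implicit Types k : T1 * T2 -> R.

Let patch_rod k x p : (k \_ rod) (x, p) = if x \in I then ((fun q => k (x, q)) \_ om) p else 0.
Proof.
rewrite !patchE in_setX /=; case: (x \in I) => //=; by case: (p \in om).
Qed.

Let rod_patch k : intble mu3 rod k -> mu3.-integrable setT (EFin \o (k \_ rod)).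
Proof. by move=> ik; apply: (@intble_patch _ _ _ mu3 setT rod k _ mrod _).1. Qed.

Lemma section_meas k : measurable_fun rod k -> forall x, I x ->
  measurable_fun om (fun p => k (x, p)).
Proof.
move=> mk x Ix.
have mp : measurable_fun setT (k \_ rod) by exact: (measurable_restrictT k mrod).1.
have h : measurable_fun setT (fun p => (k \_ rod) (x, p)).
  exact: (measurableT_comp mp (@pair1_measurable _ _ _ _ x)).
apply: eq_measurable_fun (measurable_funTS h) => p pom.
by rewrite patch_rod mem_set// patchE pom.
Qed.

Lemma section_intble k : intble mu3 rod k ->
  {ae mu, forall x, I x -> intble mu2 om (fun p => k (x, p))}.
Proof.
move=> ik; have := ae_integrable1 (rod_patch ik).
apply: filterS => x h Ix.
apply: (@intble_patch _ _ _ mu2 setT om _ measurableT mom _).2 => //.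
apply: (@eq_intble _ _ _ mu2 setT measurableT _ _ _ h) => p _ /=.
by rewrite patch_rod mem_set.
Qed.

Lemma intble_section k : intble mu3 rod k ->
  intble mu I (fun x => \int[mu2]_(p in om) k (x, p)).
Proof.
move=> ik; have iF := integrable_fubini_F (rod_patch ik).
set F := fubini_F _ _ in iF.
have FE x : I x -> fine (F x) = \int[mu2]_(p in om) k (x, p).
  move=> Ix; rewrite /F /fubini_F -(@Rintegral_patch _ _ _ mu2 setT)// /Rintegral.
  congr fine; apply: eq_integral => p _ /=.
  by rewrite patch_rod mem_set.
have mF : measurable_fun setT F by exact: measurable_int iF.
have fm : measurable_fun I (fine \o F).
  by apply: measurable_funTS; exact: measurableT_comp.
apply: (@eq_intble _ _ _ mu I mI (fine \o F)); first by move=> x Ix; exact: FE.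
have /integrableP[_ lt] := iF.
apply/integrableP; split; first exact/measurable_EFinP.
apply: le_lt_trans lt; rewrite [leRHS](_ : _ = \int[mu]_(x in setT) `|F x|)%E//.
apply: (@le_trans _ _ (\int[mu]_(x in I) `|F x|)%E).
  apply: ge0_le_integral => //.
  - by apply: measurableT_comp => //; exact/measurable_EFinP.
  - by apply: measurable_funTS; exact: measurableT_comp.
  - by move=> x _ /=; case: (F x) => [r| |] /=; [exact: lexx|exact: leey|exact: leey].
by apply: ge0_subset_integral => //; exact: measurableT_comp.
Qed.

Lemma section_sqint k : sqint mu3 rod k ->
  {ae mu, forall x, I x -> sqint mu2 om (fun p => k (x, p))}.
Proof.
move=> [mk k2]; have := section_intble k2; apply: filterS => x h Ix.
by split; [exact: section_meas|exact: h].
Qed.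

Lemma mu3_rod_lty : (mu3 rod < +oo)%E.
Proof.
rewrite product_measure1E//; apply: lte_mul_pinfty; first exact: measure_ge0.
  by rewrite ge0_fin_numE ?measure_ge0//; exact: mu_itv_lty.
exact: om_lty.
Qed.

(** By the Cauchy-Schwarz inequality on the cross-section, of unit area, the square
    of a moment is at most C^2 times the integral of the square over the section. *)
Lemma sqint_section k (C : R) (c : T2 -> R) : measurable_fun om c ->
  (forall p, om p -> `|c p| <= C) -> sqint mu3 rod k ->
  sqint mu I (fun x => \int[mu2]_(p in om) (c p * k (x, p))).
Proof.
move=> mc cC sk; have [mk k2] := sk.
have mc' : measurable_fun rod (fun z : T1 * T2 => c z.2).
  have mp : measurable_fun setT (c \_ om) by exact: (measurable_restrictT c mom).1.
  have h := measurable_funTS (D := rod) (measurableT_comp mp (@measurable_snd _ _ T1 T2)).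
  by apply: eq_measurable_fun h => -[x p] /set_mem[_ /= omp]; rewrite patchE mem_set.
have sck : sqint mu3 rod (fun z => c z.2 * k z).
  apply: (@sqint_bM _ _ _ mu3 rod mrod C) => //.
  by apply: aeW => -[x p] [_ omp]; exact: cC.
have ick := sqint_intble mrod mu3_rod_lty sck.
have iS := intble_section ick.
have iN := intble_section (sqint_intble2 sck).
have mS := intble_meas iS.
split => //; apply: (@ae_le_intble _ _ _ mu I mI _
  (fun x => \int[mu2]_(p in om) ((c p * k (x, p)) ^+ 2))) => //.
  exact: measurable_funX.
have := section_sqint sck; apply: filterS => x sx Ix.
rewrite ger0_norm ?sqr_ge0//.
have := CauchySchwarz mom (sqint_cst mom om_lty 1) (sx Ix).
rewrite (_ : nsq mu2 om (fun=> 1) = 1); last first.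
  rewrite /nsq expr1n (Rintegral_cst mu2 mom) mul1r.
  by rewrite [X in fine X](om1 : _ = 1%E).
rewrite mul1r /nsq /=.
by under eq_Rintegral do rewrite mul1r.
Qed.

Lemma intble_rod_fst (f : T1 -> R) : intble mu I f -> intble mu3 rod (fun z => f z.1).
Proof.
move=> i_f; apply: (@intble_patch _ _ _ mu3 setT rod _ measurableT mrod _).2 => //.
have mf : measurable_fun setT (f \_ I) by exact: (measurable_restrictT f mI).1 (intble_meas i_f).
have mk : measurable_fun setT ((fun z : T1 * T2 => f z.1) \_ rod).
  apply: (measurable_restrictT _ mrod).1.
  have h := measurable_funTS (D := rod) (measurableT_comp mf (@measurable_fst _ _ T1 T2)).
  by apply: eq_measurable_fun h => -[x p] /set_mem[/= Ix _]; rewrite patchE mem_set.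
apply/integrable12ltyP; first exact/measurable_EFinP.
have E x : (\int[mu2]_p `|(((fun z : T1 * T2 => f z.1) \_ rod) (x, p))%:E| = (`|(f \_ I) x|)%:E)%E.
  have [xI|xI] := boolP (x \in I); last first.
    rewrite patchE (negbTE xI) normr0 integral0_eq// => p _.
    by rewrite patch_rod (negbTE xI) abse0.
  rewrite patchE xI.
  transitivity (\int[mu2]_(p in om) (`|f x|)%:E)%E.
    rewrite [RHS]integral_mkcond; apply: eq_integral => p _.
    by rewrite patch_rod xI !patchE; case: ifP => _ /=; rewrite ?normr0.
  by rewrite integral_cst// [X in (_ * X)%E]om1 mule1.
under eq_integral do rewrite /= E.
have := integrable_norm ((@intble_patch _ _ _ mu setT I f measurableT mI (@subsetT _ _)).1 i_f).
exact: integrable_lty.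
Qed.

Lemma sqint_rod_fst (f : T1 -> R) : sqint mu I f -> sqint mu3 rod (fun z => f z.1).
Proof.
move=> [mf f2]; split; last exact: (intble_rod_fst f2).
have mf' : measurable_fun setT (f \_ I) by exact: (measurable_restrictT f mI).1.
have h := measurable_funTS (D := rod) (measurableT_comp mf' (@measurable_fst _ _ T1 T2)).
by apply: eq_measurable_fun h => -[x p] /set_mem[/= Ix _]; rewrite patchE mem_set.
Qed.

End Rod.

(** * Matrix-valued H^1 functions on an interval *)

Section H1.
Variables (R : realType) (L : R).
Hypothesis L0 : 0 < L.
Notation mu := (@lebesgue_measure R).
Notation I := (`]0, L[%classic : set (measurableTypeR R)).
Let mI : measurable I. Proof. exact: measurable_itv. Qed.
Let I_lty : (mu I < +oo)%E. Proof. exact: mu_itv_lty. Qed.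

Lemma is_L2_meas m n (f : R -> 'M[R]_(m, n)) i j : is_L2 leb `]0, L[ f ->
  measurable_fun I (fun x => f x i j).
Proof. by move=> sf; exact: (sqint_meas (sf i j)). Qed.

Lemma is_L2_intble m n (f : R -> 'M[R]_(m, n)) i j : is_L2 leb `]0, L[ f ->
  intble mu I (fun x => f x i j).
Proof. by move=> sf; exact: (sqint_intble mI I_lty (sf i j)). Qed.

Lemma H1_wder m n (f : R -> 'M[R]_(m, n)) : is_H1 L f ->
  is_L2 leb `]0, L[ (wder L f) /\ is_wder L f (wder L f).
Proof.
move=> [_ [g [sg wg]]]; rewrite /wder; case: xgetP => [g' _ [//]|/(_ g)[]].
by split.
Qed.

Lemma H1_L2 m n (f : R -> 'M[R]_(m, n)) : is_H1 L f -> is_L2 leb `]0, L[ f.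
Proof. by case. Qed.

Lemma ae_mxP m n (f g : R -> 'M[R]_(m, n)) :
  (forall i j, {ae mu, forall x, I x -> f x i j = g x i j}) ->
  {ae mu, forall x, I x -> f x = g x}.
Proof.
move=> h; have := filter_forall (ae_leb_filter R) (fun i => filter_forall (ae_leb_filter R) (h i)).
by apply: filterS => x hx Ix; apply/matrixP => i j; exact: hx.
Qed.

Lemma wder_unique m n (f g : R -> 'M[R]_(m, n)) : is_L2 leb `]0, L[ g ->
  is_L2 leb `]0, L[ f -> is_wder L f g -> {ae mu, forall x, I x -> wder L f x = g x}.
Proof.
move=> sg sf wg; have [sw ww] := H1_wder (conj sf (ex_intro _ g (conj sg wg))).
apply: ae_mxP => i j.
exact: (wder1_unique L0 (is_L2_intble i j sw) (is_L2_intble i j sg) (ww i j) (wg i j)).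
Qed.

Lemma H1_acrep m n (f : R -> 'M[R]_(m, n)) i j : is_H1 L f ->
  acrep L (fun x => f x i j) (fun x => wder L f x i j).
Proof.
move=> hf; have [sw ww] := H1_wder hf.
exact: (wder1_acrep L0 (is_L2_intble i j (H1_L2 hf)) (is_L2_intble i j sw) (ww i j)).
Qed.

(** A criterion that involves no test functions. *)
Lemma acrep_H1 m n (f g : R -> 'M[R]_(m, n)) : is_L2 leb `]0, L[ f ->
  is_L2 leb `]0, L[ g -> (forall i j, acrep L (fun x => f x i j) (fun x => g x i j)) ->
  is_H1 L f /\ {ae mu, forall x, I x -> wder L f x = g x}.
Proof.
move=> sf sg h.
have wg : is_wder L f g.
  move=> i j; exact: (acrep_wder1 L0 (is_L2_meas i j sf) (is_L2_intble i j sg) (h i j)).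
by split; [split => //; exists g|exact: wder_unique].
Qed.

Lemma wder1D f1 f2 g1 g2 k l : intble mu I f1 -> intble mu I f2 ->
  intble mu I g1 -> intble mu I g2 -> wder1 L f1 g1 -> wder1 L f2 g2 ->
  wder1 L (fun x => k * f1 x + l * f2 x) (fun x => k * g1 x + l * g2 x).
Proof.
move=> if1 if2 ig1 ig2 w1 w2 phi tphi.
have cphi := C1_on_continuous (proj1 tphi).
have cd := C1_on_continuous_derive (proj1 tphi).
have lin (u v w : R -> R) : intble mu I u -> intble mu I v -> continuous w ->
    \int[mu]_(p in I) ((k * u p + l * v p) * w p) =
    k * \int[mu]_(p in I) (u p * w p) + l * \int[mu]_(p in I) (v p * w p).
  move=> iu iv cw; have j1 := intbleMC L0 iu cw; have j2 := intbleMC L0 iv cw.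
  rewrite -(RintegralZl k mI j1) -(RintegralZl l mI j2).
  rewrite -(RintegralD mI (intbleZ mI k j1) (intbleZ mI l j2)).
  by apply: eq_Rintegral => p _; ring.
by rewrite !lin// w1// w2//; ring.
Qed.

Lemma acrepD f1 f2 g1 g2 : intble mu I g1 -> intble mu I g2 ->
  acrep L f1 g1 -> acrep L f2 g2 ->
  acrep L (fun x => f1 x + f2 x) (fun x => g1 x + g2 x).
Proof.
move=> i1 i2 [c1 e1] [c2 e2]; exists (c1 + c2).
apply: aeI e1 e2 => x Ix -> ->; have [_ xL] := in_itvW Ix.
by rewrite (primD xL i1 i2) addrACA.
Qed.

Lemma acrep_sum (J : finType) (f g : J -> R -> R) : (forall k, intble mu I (g k)) ->
  (forall k, acrep L (f k) (g k)) ->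
  acrep L (fun x => \sum_k f k x) (fun x => \sum_k g k x).
Proof.
move=> ig h; elim: (index_enum J) => [|k s IH].
  exists 0; apply: aeW => x _; rewrite big_nil add0r /prim.
  by under eq_Rintegral do rewrite big_nil; rewrite /Rintegral integral0.
rewrite (_ : (fun x => _) = (fun x => f k x + \sum_(i <- s) f i x)); last first.
  by apply/funext => x; rewrite big_cons.
rewrite (_ : (fun x => \sum_(i <- _) g i x) = (fun x => g k x + \sum_(i <- s) g i x)); last first.
  by apply/funext => x; rewrite big_cons.
apply: acrepD => //.
elim: s {IH} => [|l s IH].
  by apply: (@eq_intble _ _ _ mu I mI (fun=> 0)); [move=> x _; rewrite big_nil|exact: integrable0].
apply: (@eq_intble _ _ _ mu I mI (fun x => g l x + \sum_(i <- s) g i x)).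
  by move=> x _; rewrite big_cons.
exact: intbleD.
Qed.

Lemma is_L2_comb m n (f g : R -> 'M[R]_(m, n)) k l : is_L2 leb `]0, L[ f ->
  is_L2 leb `]0, L[ g -> is_L2 leb `]0, L[ (fun x => k *: f x + l *: g x).
Proof.
move=> sf sg i j.
apply: (@eq_sqint _ _ _ mu I mI (fun x => k * f x i j + l * g x i j)).
  by move=> x _; rewrite !mxE.
by apply: (sqintD mI); apply: (sqintZ mI); [exact: sf|exact: sg].
Qed.

Lemma H1_comb m n (f g : R -> 'M[R]_(m, n)) k l : is_H1 L f -> is_H1 L g ->
  is_H1 L (fun x => k *: f x + l *: g x) /\
  {ae mu, forall x, I x ->
    wder L (fun x => k *: f x + l *: g x) x = k *: wder L f x + l *: wder L g x}.
Proof.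
move=> hf hg; have [sw1 ww1] := H1_wder hf; have [sw2 ww2] := H1_wder hg.
have sfg := is_L2_comb k l (H1_L2 hf) (H1_L2 hg).
have sww := is_L2_comb k l sw1 sw2.
have w : is_wder L (fun x => k *: f x + l *: g x) (fun x => k *: wder L f x + l *: wder L g x).
  move=> i j phi tphi.
  have := wder1D k l (is_L2_intble i j (H1_L2 hf)) (is_L2_intble i j (H1_L2 hg))
    (is_L2_intble i j sw1) (is_L2_intble i j sw2) (ww1 i j) (ww2 i j) tphi.
  rewrite -(@eq_Rintegral _ _ _ mu I _ (fun x => (k *: f x + l *: g x) i j * derive1 phi x)).
    by move=> ->; congr (- _); apply: eq_Rintegral => x _; rewrite !mxE.
  by move=> x _; rewrite !mxE.
split; last exact: wder_unique.
by split => //; exists (fun x => k *: wder L f x + l *: wder L g x).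
Qed.

Lemma ae_eq_H1 m n (f g : R -> 'M[R]_(m, n)) :
  (forall i j, measurable_fun I (fun x => g x i j)) ->
  {ae mu, forall x, I x -> f x = g x} -> is_H1 L f ->
  is_H1 L g /\ {ae mu, forall x, I x -> wder L g x = wder L f x}.
Proof.
move=> mg fg hf; have [sw _] := H1_wder hf.
apply: acrep_H1 => //.
  move=> i j; apply: (ae_eq_sqint mI (mg i j) _ (H1_L2 hf i j)).
  by apply: filterS fg => x fg Ix; rewrite fg.
move=> i j; have [c e] := H1_acrep i j hf; exists c.
by apply: aeI fg e => x Ix <-.
Qed.

Definition supc : R := 2 / L + 8 * L.

(** Makes products of H^1 functions with square-integrable ones square integrable,
    and turns convergence in H^1 into uniform convergence. *)
Lemma H1_sup m n (f : R -> 'M[R]_(m, n)) i j : is_H1 L f ->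
  {ae mu, forall x, I x -> `|f x i j| ^+ 2 <=
    supc * (nsq mu I (fun x => f x i j) + nsq mu I (fun x => wder L f x i j))}.
Proof.
move=> hf; have [sw _] := H1_wder hf.
exact: (acrep_sup L0 (H1_L2 hf i j) (sw i j) (H1_acrep i j hf)).
Qed.

Lemma H1_bounded m n (f : R -> 'M[R]_(m, n)) : is_H1 L f ->
  exists2 C, 0 <= C & forall i j, {ae mu, forall x, I x -> `|f x i j| <= C}.
Proof.
move=> hf.
pose S i j := supc * (nsq mu I (fun x => f x i j) + nsq mu I (fun x => wder L f x i j)).
have S0 i j : 0 <= S i j.
  rewrite /S /supc mulr_ge0// ?addr_ge0 ?nsq_ge0 ?divr_ge0 ?mulr_ge0 ?ltW//.
exists (\sum_i \sum_j Num.sqrt (S i j)).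
  by apply: sumr_ge0 => i _; apply: sumr_ge0 => j _; exact: sqrtr_ge0.
move=> i j; have := H1_sup i j hf; apply: filterS => x h Ix.
apply: (@le_trans _ _ (Num.sqrt (S i j))).
  by rewrite -(ger0_norm (normr_ge0 (f x i j))) -sqrtr_sqr ler_sqrt ?S0// h.
rewrite (bigD1 i)//= (bigD1 j)//= -addrA lerDl.
apply: addr_ge0; apply: sumr_ge0 => k _; first exact: sqrtr_ge0.
by apply: sumr_ge0 => l _; exact: sqrtr_ge0.
Qed.

Lemma H1_mulmx m n p (f : R -> 'M[R]_(m, n)) (g : R -> 'M[R]_(n, p)) :
  is_H1 L f -> is_H1 L g ->
  is_H1 L (fun x => f x *m g x) /\
  {ae mu, forall x, I x ->
    wder L (fun x => f x *m g x) x = wder L f x *m g x + f x *m wder L g x}.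
Proof.
move=> hf hg; have [sw1 ww1] := H1_wder hf; have [sw2 ww2] := H1_wder hg.
have [C1 C10 b1] := H1_bounded hf; have [C2 C20 b2] := H1_bounded hg.
have prodl i k j : sqint mu I (fun x => wder L f x i k * g x k j).
  apply: (@eq_sqint _ _ _ mu I mI (fun x => g x k j * wder L f x i k)).
    by move=> x _; rewrite mulrC.
  exact: (sqint_bM mI (is_L2_meas k j (H1_L2 hg)) (b2 k j) (sw1 i k)).
have prodr i k j : sqint mu I (fun x => f x i k * wder L g x k j).
  exact: (sqint_bM mI (is_L2_meas i k (H1_L2 hf)) (b1 i k) (sw2 k j)).
have prod0 i k j : sqint mu I (fun x => f x i k * g x k j).
  exact: (sqint_bM mI (is_L2_meas i k (H1_L2 hf)) (b1 i k) (H1_L2 hg k j)).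
apply: acrep_H1.
- move=> i j; apply: (@eq_sqint _ _ _ mu I mI (fun x => \sum_k f x i k * g x k j)).
    by move=> x _; rewrite mxE.
  exact: (@sqint_sum _ _ _ mu I mI _ (fun k x => f x i k * g x k j)).
- move=> i j; apply: (@eq_sqint _ _ _ mu I mI
    (fun x => \sum_k (wder L f x i k * g x k j) + \sum_k (f x i k * wder L g x k j))).
    by move=> x _; rewrite [RHS]mxE; congr (_ + _); rewrite [RHS]mxE.
  apply: (sqintD mI).
    exact: (@sqint_sum _ _ _ mu I mI _ (fun k x => wder L f x i k * g x k j)).
  exact: (@sqint_sum _ _ _ mu I mI _ (fun k x => f x i k * wder L g x k j)).
- move=> i j.
  have key k : acrep L (fun x => f x i k * g x k j)
      (fun x => wder L f x i k * g x k j + f x i k * wder L g x k j).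
    have := acrepM (is_L2_meas i k (H1_L2 hf)) (is_L2_meas k j (H1_L2 hg))
      (is_L2_intble i k sw1) (is_L2_intble k j sw2) (H1_acrep i k hf) (H1_acrep k j hg).
    by case.
  have isum k : intble mu I (fun x => wder L f x i k * g x k j + f x i k * wder L g x k j).
    by apply: intbleD => //; apply: sqint_intble.
  have := acrep_sum isum key.
  rewrite (_ : (fun x => _) = (fun x => (f x *m g x) i j)); last first.
    by apply/funext => x; rewrite mxE.
  rewrite (_ : (fun x => \sum_k _) = (fun x => (wder L f x *m g x + f x *m wder L g x) i j))//.
  apply/funext => x; rewrite [RHS]mxE big_split /=.
  by congr (_ + _); rewrite [RHS]mxE.
Qed.

Definition H1sq m n (f : R -> 'M[R]_(m, n)) : R :=
  \sum_i \sum_j (nsq mu I (fun x => f x i j) + nsq mu I (fun x => wder L f x i j)).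

Lemma frob_sq m n (A : 'M[R]_(m, n)) : frob A ^+ 2 = \sum_i \sum_j A i j ^+ 2.
Proof.
rewrite /frob sqr_sqrtr; last first.
  rewrite /mxdot /mxtrace sumr_ge0// => i _; rewrite mxE sumr_ge0// => j _.
  by rewrite mxE -expr2 sqr_ge0.
rewrite /mxdot /mxtrace; apply: eq_bigr => i _; rewrite mxE; apply: eq_bigr => j _.
by rewrite mxE.
Qed.

Lemma Rintegral_sum2 m n (F : 'I_m -> 'I_n -> R -> R) :
  (forall i j, intble mu I (F i j)) ->
  \int[mu]_(x in I) (\sum_i \sum_j F i j x) = \sum_i \sum_j \int[mu]_(x in I) F i j x.
Proof.
move=> iF.
have one (J : finType) (G : J -> R -> R) : (forall j, intble mu I (G j)) ->
    \int[mu]_(x in I) (\sum_j G j x) = \sum_j \int[mu]_(x in I) G j x.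
  move=> iG; rewrite /Rintegral.
  under eq_integral do rewrite -sumEFin.
  rewrite (integral_sum mI)//.
  have -> : (\sum_j \int[mu]_(x in I) (G j x)%:E)%E =
    (\sum_j (\int[mu]_(x in I) G j x)%:E)%E.
    by apply: eq_bigr => j _; rewrite (EFin_Rintegral mI).
  by rewrite sumEFin.
rewrite (one _ (fun i x => \sum_j F i j x)).
  by apply: eq_bigr => i _; exact: one.
by move=> i; apply: (@intble_sum _ _ _ mu I mI).
Qed.

Lemma H1normE m n (f : R -> 'M[R]_(m, n)) : is_H1 L f -> H1norm L f = Num.sqrt (H1sq f).
Proof.
move=> hf; have [sw _] := H1_wder hf; rewrite /H1norm; congr Num.sqrt.
have i1 i j := sqint_intble2 (H1_L2 hf i j); have i2 i j := sqint_intble2 (sw i j).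
transitivity (\int[mu]_(x in I) (\sum_i \sum_j (f x i j ^+ 2 + wder L f x i j ^+ 2))).
  apply: eq_Rintegral => x _; rewrite !frob_sq -big_split; apply: eq_bigr => i _.
  by rewrite -big_split.
rewrite (Rintegral_sum2 (F := fun i j x => f x i j ^+ 2 + wder L f x i j ^+ 2)).
  by apply: eq_bigr => i _; apply: eq_bigr => j _; rewrite (RintegralD mI (i1 i j) (i2 i j)).
by move=> i j; apply: intbleD.
Qed.

Lemma H1sq_ge0 m n (f : R -> 'M[R]_(m, n)) : 0 <= H1sq f.
Proof.
by apply: sumr_ge0 => i _; apply: sumr_ge0 => j _; rewrite addr_ge0 ?nsq_ge0.
Qed.

Lemma H1sq_ge m n (f : R -> 'M[R]_(m, n)) i j :
  nsq mu I (fun x => f x i j) + nsq mu I (fun x => wder L f x i j) <= H1sq f.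
Proof.
rewrite /H1sq (bigD1 i)//= (bigD1 j)//= -addrA lerDl.
apply: addr_ge0; apply: sumr_ge0 => k _; first by rewrite addr_ge0 ?nsq_ge0.
by apply: sumr_ge0 => l _; rewrite addr_ge0 ?nsq_ge0.
Qed.

End H1.

(** * Curves of frames *)

Section Null.
Variables (R : realType) (L : R).
Hypothesis L0 : 0 < L.
Notation mu := (@lebesgue_measure R).
Notation I := (`]0, L[%classic : set (measurableTypeR R)).
Let mI : measurable I. Proof. exact: measurable_itv. Qed.
Let I_lty : (mu I < +oo)%E. Proof. exact: mu_itv_lty. Qed.
Implicit Types e f b : R -> R -> R.

(** The index only matters near 0, since curves are parametrised by ]-1, 1[. *)
Definition null2 e := (\forall k \near 0^', sqint mu I (e k)) /\
  nsq mu I (e k) @[k --> 0^'] --> (0 : R).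

Lemma null2_squeeze e (h : R -> R) : (\forall k \near 0^', sqint mu I (e k)) ->
  (\forall k \near 0^', nsq mu I (e k) <= h k) -> h k @[k --> 0^'] --> (0 : R) -> null2 e.
Proof.
move=> se le h0; split => //; apply: (@squeeze_cvgr _ _ _ _ (fun=> 0) h) => //.
  by apply: filterS le => k le; rewrite nsq_ge0 le.
exact: cvg_cst.
Qed.

Lemma null2D e f : null2 e -> null2 f -> null2 (fun k x => e k x + f k x).
Proof.
move=> [se e0] [sf f0].
apply: (@null2_squeeze _ (fun k => 2 * (nsq mu I (e k) + nsq mu I (f k)))).
- by apply: filterS2 se sf => k sek sfk; exact: sqintD.
- by apply: filterS2 se sf => k sek sfk; exact: nsqD.
- by rewrite -[X in _ --> X](mulr0 2) -[X in 2 * X](addr0 0); apply: cvgM; [exact: cvg_cst|exact: cvgD].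
Qed.

Lemma null2_sum (J : finType) (e : J -> R -> R -> R) : (forall j, null2 (e j)) ->
  null2 (fun k x => \sum_j e j k x).
Proof.
move=> he; elim: (index_enum J) => [|j s IH].
  rewrite (_ : (fun k x => _) = fun _ _ => 0); last first.
    by apply/funext => k; apply/funext => x; rewrite big_nil.
  apply: (@null2_squeeze _ (fun=> 0)); [|apply: nearW => k|exact: cvg_cst].
    by apply: nearW => k; exact: sqint0.
  by rewrite /nsq expr0n /= Rintegral_cst// mul0r.
rewrite (_ : (fun k x => _) = fun k x => e j k x + \sum_(i <- s) e i k x); last first.
  by apply/funext => k; apply/funext => x; rewrite big_cons.
exact: null2D.
Qed.

Lemma null2_bM (C : R) b e :
  (\forall k \near 0^', measurable_fun I (b k) /\ {ae mu, forall x, I x -> `|b k x| <= C}) ->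
  null2 e -> null2 (fun k x => b k x * e k x).
Proof.
move=> hb [se e0]; apply: (@null2_squeeze _ (fun k => C ^+ 2 * nsq mu I (e k))).
- by apply: filterS2 hb se => k [mb bC] sek; exact: sqint_bM bC sek.
- by apply: filterS2 hb se => k [mb bC] sek; exact: nsq_bM bC sek.
- by rewrite -[X in _ --> X](mulr0 (C ^+ 2)); apply: cvgM; [exact: cvg_cst|exact: e0].
Qed.

Lemma null2_small (m : R -> R) b (g : R -> R) :
  (\forall k \near 0^', measurable_fun I (b k) /\ {ae mu, forall x, I x -> `|b k x| <= m k}) ->
  m k @[k --> 0^'] --> (0 : R) -> sqint mu I g -> null2 (fun k x => b k x * g x).
Proof.
move=> hb m0 sg; apply: (@null2_squeeze _ (fun k => m k * m k * nsq mu I g)).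
- by apply: filterS hb => k [mb bC]; exact: sqint_bM bC sg.
- by apply: filterS hb => k [mb bC]; rewrite -expr2; exact: nsq_bM bC sg.
- rewrite -[X in _ --> X](mul0r (nsq mu I g)); apply: cvgM; last exact: cvg_cst.
  by rewrite -[X in _ --> X](mulr0 0); exact: cvgM.
Qed.

Lemma null2_eq e f : (\forall k \near 0^', measurable_fun I (f k) /\
    {ae mu, forall x, I x -> e k x = f k x}) -> null2 e -> null2 f.
Proof.
move=> h [se e0]; apply: (@null2_squeeze _ (fun k => nsq mu I (e k))) => //.
- by apply: filterS2 h se => k [mf ef] sek; exact: ae_eq_sqint ef sek.
- apply: filterS2 h se => k [mf ef] sek.
  by rewrite (ae_eq_nsq mI (sqint_meas sek) mf ef).
Qed.

(** ** Rotations *)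

Lemma SO3_entry (F : 'M[R]_3) i j : SO3 F -> `|F i j| <= 1.
Proof.
move=> [FF _]; have := congr1 (fun M : 'M[R]_3 => M j j) FF.
rewrite !mxE eqxx mulr1n (bigD1 i)//= mxE => h.
have : F i j ^+ 2 <= 1.
  rewrite -h expr2 lerDl sumr_ge0// => k _; rewrite mxE -expr2; exact: sqr_ge0.
rewrite -(real_normK (num_real (F i j))) => h1.
have h2 : 0 <= `|F i j| by [].
nra.
Qed.

(** ** Difference quotients of a curve *)

Variables gam dgam : R -> R -> 'M[R]_3.
Hypothesis Cg : C1_curve L gam dgam.

Definition quot (k x : R) : 'M[R]_3 := k^-1 *: (gam k x - gam 0 x) - dgam 0 x.

Let C0 : -1 < (0 : R) < 1. Proof. by rewrite oppr_lt0 ltr01. Qed.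

Lemma near_small : \forall k \near (0 : R)^', k != 0 /\ -1 < k < 1.
Proof.
near=> k; split; first by near: k; exact: nbhs_dnbhs_neq.
rewrite -ltr_norml; near: k; apply: dnbhs0_lt; exact: ltr01.
Unshelve. all: by end_near. Qed.

Lemma gam_H1 k : -1 < k < 1 -> is_H1 L (gam k). Proof. by move=> /Cg[]. Qed.

Lemma gam_SO3 k : -1 < k < 1 -> {ae mu, forall x, I x -> SO3 (gam k x)}.
Proof. by move=> /Cg[]. Qed.

Lemma dgam0_H1 : is_H1 L (dgam 0). Proof. by have [] := Cg C0. Qed.

Lemma quot_H1 k : -1 < k < 1 -> is_H1 L (quot k) /\
  {ae mu, forall x, I x -> wder L (quot k) x =
     k^-1 *: (wder L (gam k) x - wder L (gam 0) x) - wder L (dgam 0) x}.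
Proof.
move=> hk; have [h1 w1] := H1_comb L0 1 (-1) (gam_H1 hk) (gam_H1 C0).
have [h2 w2] := H1_comb L0 k^-1 (-1) h1 dgam0_H1.
have -> : quot k = (fun x => k^-1 *: (1 *: gam k x + -1 *: gam 0 x) + -1 *: dgam 0 x).
  by apply/funext => x; rewrite /quot !scaleN1r scale1r.
split=> //; apply: aeI w1 w2 => x Ix e1 ->.
by rewrite e1 !scaleN1r scale1r.
Qed.

Lemma quot_cvg : H1sq L (quot k) @[k --> 0^'] --> (0 : R).
Proof.
have [_ _ _ h _] := Cg C0.
have {}h : H1norm L (quot k) @[k --> 0^'] --> (0 : R).
  apply: cvg_trans h; apply: near_eq_cvg; apply: nearW => k.
  by congr (H1norm L _); apply/funext => x; rewrite /quot add0r.
have h2 : H1norm L (quot k) * H1norm L (quot k) @[k --> 0^'] --> (0 : R).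
  by rewrite -[X in _ --> X](mulr0 0); exact: cvgM.
apply: cvg_trans h2; apply: near_eq_cvg.
have := near_small; apply: filterS => k [_ hk].
by rewrite H1normE//; [rewrite -expr2 sqr_sqrtr// H1sq_ge0|have [] := quot_H1 hk].
Qed.

Lemma quot_null i j : null2 (fun k x => quot k x i j).
Proof.
apply: (@null2_squeeze _ (fun k => H1sq L (quot k))); last exact: quot_cvg.
- have := near_small; apply: filterS => k [_ hk].
  by have [h _] := quot_H1 hk; exact: (H1_L2 h i j).
- apply: nearW => k; apply: le_trans (H1sq_ge L (quot k) i j).
  by rewrite lerDl nsq_ge0.
Qed.

Lemma dquot_null i j : null2 (fun k x => wder L (quot k) x i j).
Proof.
apply: (@null2_squeeze _ (fun k => H1sq L (quot k))); last exact: quot_cvg.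
- have := near_small; apply: filterS => k [_ hk].
  by have [h _] := quot_H1 hk; have [s _] := H1_wder h; exact: (s i j).
- apply: nearW => k; apply: le_trans (H1sq_ge L (quot k) i j).
  by rewrite lerDr nsq_ge0.
Qed.

Definition supq (k : R) : R := Num.sqrt (supc L * H1sq L (quot k)).

Lemma supc_ge0 : 0 <= supc L.
Proof. by rewrite /supc addr_ge0 ?divr_ge0 ?mulr_ge0 ?ltW. Qed.

Lemma quot_sup k i j : -1 < k < 1 -> measurable_fun I (fun x => quot k x i j) /\
  {ae mu, forall x, I x -> `|quot k x i j| <= supq k}.
Proof.
move=> hk; have [h _] := quot_H1 hk; split; first exact: (is_L2_meas i j (H1_L2 h)).
have := H1_sup L0 i j h; apply: filterS => x hx Ix.
have S0 : 0 <= supc L * H1sq L (quot k) by rewrite mulr_ge0 ?supc_ge0 ?H1sq_ge0.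
rewrite -(ger0_norm (normr_ge0 (quot k x i j))) -sqrtr_sqr ler_sqrt//.
rewrite (le_trans (hx Ix))// ler_wpM2l ?supc_ge0//; exact: H1sq_ge.
Qed.

Lemma supq_cvg : supq k @[k --> 0^'] --> (0 : R).
Proof.
have h : supc L * H1sq L (quot k) @[k --> 0^'] --> supc L * 0.
  by apply: cvgM; [exact: cvg_cst|exact: quot_cvg].
have := @cvg_comp _ _ _ _ Num.sqrt _ _ _ h (@sqrt_continuous R _).
by rewrite mulr0 sqrtr0.
Qed.

(** The formal derivative at 0 of the curvature (gam s)^T (gam s)'. *)
Definition dcurv (x : R) : 'M[R]_3 :=
  (dgam 0 x)^T *m wder L (gam 0) x + (gam 0 x)^T *m wder L (dgam 0) x.

Lemma trmx_mulE (A B : 'M[R]_3) i j : (A^T *m B) i j = \sum_l A l i * B l j.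
Proof. by rewrite mxE; apply: eq_bigr => l _; rewrite mxE. Qed.

Lemma curvature_meas k i j : -1 < k < 1 ->
  measurable_fun I (fun x => curvature L (gam k) x i j).
Proof.
move=> hk; have h := gam_H1 hk; have [sw _] := H1_wder h.
rewrite (_ : (fun x => _) = (fun x => \sum_l gam k x l i * wder L (gam k) x l j)).
  apply: measurable_sum => l; apply: measurable_funM.
    exact: (is_L2_meas l i (H1_L2 h)).
  exact: (is_L2_meas l j sw).
by apply/funext => x; rewrite trmx_mulE.
Qed.

Lemma dcurv_meas i j : measurable_fun I (fun x => dcurv x i j).
Proof.
have h := gam_H1 C0; have [sw _] := H1_wder h; have [sz _] := H1_wder dgam0_H1.
rewrite (_ : (fun x => _) = (fun x => \sum_l dgam 0 x l i * wder L (gam 0) x l j +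
   \sum_l gam 0 x l i * wder L (dgam 0) x l j)).
  apply: measurable_funD; apply: measurable_sum => l; apply: measurable_funM.
  - exact: (is_L2_meas l i (H1_L2 dgam0_H1)).
  - exact: (is_L2_meas l j sw).
  - exact: (is_L2_meas l i (H1_L2 h)).
  - exact: (is_L2_meas l j sz).
by apply/funext => x; rewrite /dcurv mxE !trmx_mulE.
Qed.

Lemma dcurv_sqint i j : sqint mu I (fun x => dcurv x i j).
Proof.
have h := gam_H1 C0; have [sw _] := H1_wder h; have [sz _] := H1_wder dgam0_H1.
have [C1 _ b1] := H1_bounded L0 h; have [C2 _ b2] := H1_bounded L0 dgam0_H1.
apply: (@eq_sqint _ _ _ mu I mI (fun x => \sum_l dgam 0 x l i * wder L (gam 0) x l j +
   \sum_l gam 0 x l i * wder L (dgam 0) x l j)).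
  by move=> x _; rewrite /dcurv mxE !trmx_mulE.
apply: (sqintD mI).
  apply: (@sqint_sum _ _ _ mu I mI _ (fun l x => dgam 0 x l i * wder L (gam 0) x l j)) => l.
  exact: (sqint_bM mI (is_L2_meas l i (H1_L2 dgam0_H1)) (b2 l i) (sw l j)).
apply: (@sqint_sum _ _ _ mu I mI _ (fun l x => gam 0 x l i * wder L (dgam 0) x l j)) => l.
exact: (sqint_bM mI (is_L2_meas l i (H1_L2 h)) (b1 l i) (sz l j)).
Qed.

(** With Z the velocity and E the error of the difference quotient,
    (P + k (Z + E))^T (P' + k (Z' + E')) - P^T P' expands into k times the
    derivative of the curvature plus terms in which E or k appears. *)
Lemma curvature_null i j :
  null2 (fun k x => (k^-1 *: (curvature L (gam k) x - curvature L (gam 0) x) - dcurv x) i j).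
Proof.
have h0 := gam_H1 C0; have [sw _] := H1_wder h0; have [sz _] := H1_wder dgam0_H1.
have [C1 C10 b1] := H1_bounded L0 h0; have [C2 C20 b2] := H1_bounded L0 dgam0_H1.
have m1 l m : measurable_fun I (fun x => gam 0 x l m) by exact: (is_L2_meas l m (H1_L2 h0)).
have m2 l m : measurable_fun I (fun x => dgam 0 x l m) by exact: (is_L2_meas l m (H1_L2 dgam0_H1)).
pose E k x l m := quot k x l m. pose E' k x l m := wder L (quot k) x l m.
pose W k x := \sum_l (gam 0 x l i * E' k x l j) + \sum_l (E k x l i * wder L (gam 0) x l j)
  + (\sum_l (k * (dgam 0 x l i + E k x l i)) * wder L (dgam 0) x l j
     + \sum_l (k * (dgam 0 x l i + E k x l i)) * E' k x l j).
have kb l : \forall k \near 0^',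
    measurable_fun I (fun x => k * (dgam 0 x l i + E k x l i)) /\
    {ae mu, forall x, I x -> `|k * (dgam 0 x l i + E k x l i)| <= `|k| * (C2 + supq k)}.
  have := near_small; apply: filterS => k [_ hk]; have [mq bq] := quot_sup l i hk.
  split.
    by apply: measurable_funM; [exact: measurable_cst|exact: measurable_funD].
  apply: aeI (b2 l i) bq => x Ix e1 e2; rewrite normrM ler_wpM2l//.
  by rewrite (le_trans (ler_normD _ _))// lerD.
have kb0 : `|k| * (C2 + supq k) @[k --> 0^'] --> (0 : R).
  rewrite -[X in _ --> X](mul0r (C2 + 0)); apply: cvgM.
    rewrite -[X in _ --> X](@normr0 _ R); apply: cvg_norm.
    by apply: cvg_within_filter; exact: cvg_id.
  by apply: cvgD; [exact: cvg_cst|exact: supq_cvg].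
have nW : null2 W.
  apply: null2D; apply: null2D.
  - apply: (@null2_sum _ (fun l k x => gam 0 x l i * E' k x l j)) => l.
    apply: (@null2_bM C1 (fun _ x => gam 0 x l i)); last exact: dquot_null.
    by apply: nearW => k; split; [exact: m1|exact: b1].
  - apply: (@null2_sum _ (fun l k x => E k x l i * wder L (gam 0) x l j)) => l.
    apply: (@null2_small supq (fun k x => E k x l i)); [|exact: supq_cvg|exact: (sw l j)].
    by have := near_small; apply: filterS => k [_ hk]; exact: quot_sup.
  - apply: (@null2_sum _ (fun l k x => (k * (dgam 0 x l i + E k x l i)) * wder L (dgam 0) x l j)) => l.
    exact: (null2_small (kb l) kb0 (sz l j)).
  - apply: (@null2_sum _ (fun l k x => (k * (dgam 0 x l i + E k x l i)) * E' k x l j)) => l.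
    apply: (@null2_bM 1 (fun k x => k * (dgam 0 x l i + E k x l i))); last exact: dquot_null.
    have small : \forall k \near 0^', `|k| * (C2 + supq k) <= 1.
      by apply: (cvgr_le _ kb0); exact: ltr01.
    apply: filterS2 (kb l) small => k [mk bk] k1; split => //.
    by apply: filterS bk => x bk Ix; exact: le_trans (bk Ix) k1.
apply: null2_eq nW.
have := near_small; apply: filterS => k [k0 hk]; split.
  rewrite (_ : (fun x => _) = (fun x => k^-1 * (curvature L (gam k) x i j -
      curvature L (gam 0) x i j) - dcurv x i j)); last by apply/funext => x; rewrite !mxE.
  apply: measurable_funB; last exact: dcurv_meas.
  apply: measurable_funM; first exact: measurable_cst.
  by apply: measurable_funB; exact: curvature_meas.
have [_ wq] := quot_H1 hk; apply: filterS wq => x wq Ix.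
have {}wq := wq Ix.
have g1 l m : gam k x l m = gam 0 x l m + k * (dgam 0 x l m + quot k x l m).
  by rewrite /quot !mxE; field.
have g2 l m : wder L (gam k) x l m = wder L (gam 0) x l m +
    k * (wder L (dgam 0) x l m + wder L (quot k) x l m).
  by rewrite wq !mxE; field.
have -> : (k^-1 *: (curvature L (gam k) x - curvature L (gam 0) x) - dcurv x) i j =
    k^-1 * ((curvature L (gam k) x) i j - (curvature L (gam 0) x) i j) - (dcurv x) i j.
  by rewrite !mxE.
have mulT (F H : 'M[R]_3) : (F^T *m H) i j = \sum_l F l i * H l j := trmx_mulE F H i j.
have -> : dcurv x i j = \sum_l dgam 0 x l i * wder L (gam 0) x l j +
    \sum_l gam 0 x l i * wder L (dgam 0) x l j by rewrite mxE !mulT.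
rewrite !mulT /W /E /E' -!big_split /= -sumrB mulr_sumr -sumrB.
by apply: eq_bigr => l _; rewrite g1 g2; field.
Qed.

End Null.

(** * The first variation of the energy *)

Section Variation.
Variables (R : realType) (L : R) (om : set (R * R)) (LL : {linear 'M[R]_3 -> 'M[R]_3}).
Notation T1 := (measurableTypeR R).
Notation T2 := (measurableTypeR R * measurableTypeR R)%type.
Notation mu := (@lebesgue_measure R).
Notation mu2 := (@leb2 R).
Notation mu3 := (mu \x mu2)%E.
Notation I := (`]0, L[%classic : set (measurableTypeR R)).
Notation rod := (I `*` om : set (T1 * T2)).
Hypothesis L0 : 0 < L.
Hypothesis oom : open om.
Hypothesis om1 : leb2 om = 1%E.
Variable rad : R.
Hypothesis om_rad : forall p, om p -> `|p.1| <= rad /\ `|p.2| <= rad.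
Hypothesis LL_sym : forall F G, mxdot (LL F) G = mxdot F (LL G).
Hypothesis LL_ge0 : forall F, 0 <= mxdot (LL F) F.
Variable Q : 'M[R]_3 -> R.
Hypothesis QE : forall F, Q F = mxdot (LL F) F.

Let mom : measurable (om : set T2). Proof. exact: open_measurable2. Qed.
Let mI : measurable I. Proof. exact: measurable_itv. Qed.
Let mrod : measurable rod. Proof. exact: measurableX. Qed.

Variables (A : R -> 'M[R]_3) (beta : R -> R * R -> 'cV[R]_3) (G : R -> R * R -> 'M[R]_(3, 2)).
Hypothesis A_L2 : is_L2 leb `]0, L[ A.
Hypothesis A_skew : {ae mu, forall x, I x -> Defs.skew (A x)}.
Hypothesis bG : is_L2H1 L om beta G.
Hypothesis A_min : {ae mu, forall x, I x -> is_minimizer om Q (A x) 0 (beta x)}.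

Let X (z : T1 * T2) : 'M[R]_3 := strain (A z.1) (G z.1) z.2.

Lemma rod_strain_L2 : is_L2 mu3 rod X.
Proof.
have [_ sG _] := bG.
have mc (c : T2 -> R) : measurable_fun setT c -> measurable_fun rod (fun z : T1 * T2 => c z.2).
  by move=> mc; apply: measurable_funTS; exact: (measurableT_comp mc (@measurable_snd _ _ _ _)).
have cA i j (c : T2 -> R) : measurable_fun setT c -> (forall p, om p -> `|c p| <= rad) ->
    sqint mu3 rod (fun z => c z.2 * A z.1 i j).
  move=> hc cb; apply: (@sqint_bM _ _ _ mu3 rod mrod rad); first exact: (mc c hc).
    by apply: aeW => -[x p] [_ omp]; exact: cb.
  exact: (sqint_rod_fst oom om1 (A_L2 i j)).
move=> i j; case: (ord3_cases j) => ->.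
- apply: (@eq_sqint _ _ _ mu3 rod mrod (fun z => z.2.1 * A z.1 i (ix 2) + z.2.2 * A z.1 i (ix 3))).
    by move=> z _; rewrite /X /strain catmx1 xi_ofE mulrC (mulrC z.2.2).
  apply: (sqintD mrod).
    by apply: (cA i (ix 2) fst); [exact: measurable_fst|move=> p /om_rad[]].
  by apply: (cA i (ix 3) snd); [exact: measurable_snd|move=> p /om_rad[]].
- by apply: (@eq_sqint _ _ _ mu3 rod mrod _ _ _ (sG i 0)) => z _; rewrite /X /strain catmx2.
- by apply: (@eq_sqint _ _ _ mu3 rod mrod _ _ _ (sG i 1)) => z _; rewrite /X /strain catmx3.
Qed.

Let M := stress LL A G.

Lemma moment2_sqint i j : sqint mu I (fun x => moment2 om M x i j).
Proof.
have sM := is_L2_linear mrod LL rod_strain_L2.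
have := @sqint_section _ L om oom om1 (fun z => LL (X z) i j) rad fst
  (measurable_funTS (@measurable_fst _ _ _ _)) (fun p h => proj1 (om_rad h)) (sM i j).
by apply: eq_sqint => // x _; rewrite mxE.
Qed.

Lemma moment3_sqint i j : sqint mu I (fun x => moment3 om M x i j).
Proof.
have sM := is_L2_linear mrod LL rod_strain_L2.
have := @sqint_section _ L om oom om1 (fun z => LL (X z) i j) rad snd
  (measurable_funTS (@measurable_snd _ _ _ _)) (fun p h => proj2 (om_rad h)) (sM i j).
by apply: eq_sqint => // x _; rewrite mxE.
Qed.

(** The three force-like quantities dual to the entries 12, 13 and 23 of the
    curvature. *)
Definition w12 x := (moment2 om M x)_{1, 1} - (moment2 om M x)_{2, 2}.
Definition w13 x := (moment3 om M x)_{1, 1} - (moment3 om M x)_{3, 3}.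
Definition w23 x := (moment3 om M x)_{2, 1} - (moment2 om M x)_{3, 1}.

Lemma w12_sqint : sqint mu I w12.
Proof. by apply: (sqintB mI); exact: moment2_sqint. Qed.
Lemma w13_sqint : sqint mu I w13.
Proof. by apply: (sqintB mI); exact: moment3_sqint. Qed.
Lemma w23_sqint : sqint mu I w23.
Proof. by apply: (sqintB mI); [exact: moment3_sqint|exact: moment2_sqint]. Qed.

Definition qA x : R := bil om LL (strain (A x) (G x)) (strain (A x) (G x)).

Lemma qA_intble : intble mu I qA.
Proof.
have sX := rod_strain_L2; have sM := is_L2_linear mrod LL sX.
exact: (intble_section oom (intble_mxdot mrod sM sX)).
Qed.

Lemma ae_minimizer : {ae mu, forall x, I x -> adm om (A x) (strain (A x) (G x)) /\
  Qstar om Q (A x) 0 = (qA x)%:E}.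
Proof.
have [_ sG wG] := bG.
have secG : {ae mu, forall x, I x -> is_L2 leb2 om (G x)}.
  have h i j := section_sqint oom (sG i j).
  have := filter_forall (ae_leb_filter R) (fun i => filter_forall (ae_leb_filter R) (h i)).
  by apply: filterS => x hx Ix i j; exact: hx.
apply: aeI A_min (aeI (fun x _ => @conj _ _) A_skew (aeI (fun x _ => @conj _ _) secG wG)).
move=> x Ix hm [sk [sGx wGx]].
have fin : (Qstar om Q (A x) 0 < +oo)%E.
  have at_ := testF_adm oom om1 om_rad (A x)_{1, 2} (A x)_{1, 3} (A x)_{2, 3}.
  rewrite (skew_skew3 sk).
  exact: le_lt_trans (Qstar_le oom om1 om_rad QE at_) (ltry _).
exact: (minimizer_strain oom om1 om_rad QE hm fin sGx wGx).
Qed.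

(** The function e is not assumed to be measurable: being the supremum of the
    integrals of simple functions, its integral still lies between those of its
    integrable bounds. *)
Lemma sandwich (e : R -> \bar R) (lo up : R -> R) : (forall x, 0 <= e x)%E ->
  intble mu I lo -> intble mu I up ->
  {ae mu, forall x, I x -> ((lo x)%:E <= e x)%E /\ (e x <= (up x)%:E)%E} ->
  exists r, [/\ (\int[mu]_(x in I) e x)%E = r%:E,
    \int[mu]_(x in I) lo x <= r & r <= \int[mu]_(x in I) up x].
Proof.
move=> e0 ilo iup h.
have ilo0 : intble mu I (fun x => Num.max 0 (lo x)).
  apply: (@le_intble _ _ _ mu I mI _ (fun x => `|lo x|)).
  - apply: measurable_maxr; first exact: measurable_cst.
    exact: (intble_meas ilo).
  - move=> x _; rewrite ger0_norm ?le_max ?lexx// ge_max normr_ge0; exact: ler_norm.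
  - exact: integrable_norm.
have iup0 : intble mu I (fun x => Num.max 0 (up x)).
  apply: (@le_intble _ _ _ mu I mI _ (fun x => `|up x|)).
  - apply: measurable_maxr; first exact: measurable_cst.
    exact: (intble_meas iup).
  - move=> x _; rewrite ger0_norm ?le_max ?lexx// ge_max normr_ge0; exact: ler_norm.
  - exact: integrable_norm.
have h1 : (\int[mu]_(x in I) (Num.max 0 (lo x))%:E <= \int[mu]_(x in I) e x)%E.
  apply: ae_ge0_le_integral_measl => //.
  - by move=> x _; rewrite lee_fin le_max lexx.
  - exact: (measurable_int mu ilo0).
  - apply: filterS h => x h Ix; rewrite EFin_max ge_max e0.
    by have [] := h Ix.
have h2 : (\int[mu]_(x in I) e x <= \int[mu]_(x in I) (Num.max 0 (up x))%:E)%E.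
  apply: ae_ge0_le_integral_measr => //.
  - by move=> x _; rewrite lee_fin le_max lexx.
  - exact: (measurable_int mu iup0).
  - apply: filterS h => x h Ix; have [_ h'] := h Ix.
    by rewrite (le_trans h')// lee_fin le_max lexx orbT.
rewrite (EFin_Rintegral mI ilo0) in h1; rewrite (EFin_Rintegral mI iup0) in h2.
have h3 : \int[mu]_(x in I) lo x <= \int[mu]_(x in I) (Num.max 0 (lo x)).
  by apply: (le_Rintegral mI ilo ilo0) => x _; rewrite le_max lexx orbT.
have h4 : \int[mu]_(x in I) (Num.max 0 (up x)) <= \int[mu]_(x in I) up x.
  apply: (ae_le_Rintegral mI iup0 iup); apply: filterS h => x h Ix.
  have [_ h'] := h Ix; rewrite ge_max lexx andbT.
  by rewrite -lee_fin (le_trans (e0 x)).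
have fin : (\int[mu]_(x in I) e x)%E \is a fin_num.
  rewrite ge0_fin_numE; last exact: integral_ge0.
  exact: le_lt_trans h2 (ltry _).
have [r rE] : exists r, (\int[mu]_(x in I) e x)%E = r%:E.
  by exists (fine (\int[mu]_(x in I) e x)%E); rewrite (fineK fin).
exists r; move: h1 h2; rewrite rE !lee_fin => h1 h2.
by split => //; [exact: le_trans h1|exact: le_trans h4].
Qed.

(** Integrate the two bounds on the reduced density. Their remainder has a constant
    that does not depend on x, and finiteness of the energy at A' comes with them. *)
Lemma elastic_expansion : exists2 C, 0 <= C & forall A' : R -> 'M[R]_3,
  {ae mu, forall x, I x -> Defs.skew (A' x)} ->
  (forall i j, sqint mu I (fun x => A' x i j - A x i j)) ->
  let a12 x := (A' x)_{1, 2} - (A x)_{1, 2} in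
  let a13 x := (A' x)_{1, 3} - (A x)_{1, 3} in
  let a23 x := (A' x)_{2, 3} - (A x)_{2, 3} in
  let S := \int[mu]_(x in I) (w12 x * a12 x) + \int[mu]_(x in I) (w13 x * a13 x) +
    \int[mu]_(x in I) (w23 x * a23 x) in
  let N := nsq mu I a12 + nsq mu I a13 + nsq mu I a23 in
  exists r, (\int[mu]_(x in I) Qstar om Q (A' x) 0%R)%E = r%:E /\
    `|r - \int[mu]_(x in I) qA x - 2 * S| <= C * N.
Proof.
have [C C0 hC] := bil_testF_bound oom om1 om_rad LL_sym.
exists C => // A' skA' sa a12 a13 a23 S N.
have s12 : sqint mu I a12 := sa (ix 1) (ix 2).
have s13 : sqint mu I a13 := sa (ix 1) (ix 3).
have s23 : sqint mu I a23 := sa (ix 2) (ix 3).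
pose s x := w12 x * a12 x + w13 x * a13 x + w23 x * a23 x.
pose n x := a12 x ^+ 2 + a13 x ^+ 2 + a23 x ^+ 2.
have i12 := sqintM mI w12_sqint s12; have i13 := sqintM mI w13_sqint s13.
have i23 := sqintM mI w23_sqint s23.
have is_ : intble mu I s by exact: (intbleD mI (intbleD mI i12 i13) i23).
have in_ : intble mu I n.
  exact: (intbleD mI (intbleD mI (sqint_intble2 s12) (sqint_intble2 s13)) (sqint_intble2 s23)).
have Ss : \int[mu]_(x in I) s x = S.
  by rewrite /s (RintegralD mI (intbleD mI i12 i13) i23) (RintegralD mI i12 i13).
have Nn : \int[mu]_(x in I) n x = N.
  rewrite /n (RintegralD mI (intbleD mI (sqint_intble2 s12) (sqint_intble2 s13)) (sqint_intble2 s23)).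
  by rewrite (RintegralD mI (sqint_intble2 s12) (sqint_intble2 s13)).
have iq := qA_intble.
have iqs := intbleD mI iq (intbleZ mI 2 is_).
have iCn := intbleZ mI C in_.
have e0 x : (0 <= Qstar om Q (A' x) 0)%E.
  by apply: (le_Qstar oom om1 om_rad QE) => Y _; exact: bil_ge0.
have [|r [rE r1 r2]] := sandwich e0 (intbleB mI iqs iCn) (intbleD mI iqs iCn).
  have h := aeI (fun x _ => @conj _ _) ae_minimizer
     (aeI (fun x _ => @conj _ _) A_skew skA').
  apply: filterS h => x + Ix => /(_ Ix) [[aX minX] [skx skx']].
  pose t := testF (a12 x) (a13 x) (a23 x).
  have at_ : adm om (skew3 (a12 x) (a13 x) (a23 x)) t by exact: (testF_adm oom om1 om_rad).
  have FE : A' x = A x + skew3 (a12 x) (a13 x) (a23 x).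
    rewrite [in LHS](skew_skew3 skx') [X in X + _](skew_skew3 skx).
    apply: matrix3P => i; case: (ord3_cases i) => ->; rewrite [RHS]mxE !skew3E /a12 /a13 /a23; ring.
  have bs : bil om LL (strain (A x) (G x)) t = s x.
    rewrite (bil_testF LL oom om1 om_rad); last exact: (adm_L2 oom om1 om_rad aX).
    by rewrite /s /w12 /w13 /w23 /moment2 /moment3 !mxE /M /stress /strain; ring.
  have bn := hC (a12 x) (a13 x) (a23 x); rewrite -/t -/(n x) in bn.
  have up := Qstar_upper oom om1 om_rad LL_sym QE aX at_.
  have lo := Qstar_lower oom om1 om_rad LL_sym LL_ge0 QE aX at_ minX.
  rewrite FE; split.
    apply: le_trans lo; rewrite lee_fin bs -/(qA x); lra.
  by apply: (le_trans up); rewrite lee_fin bs -/(qA x); lra.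
exists r; split; first exact: rE.
move: r1 r2; rewrite (RintegralB mI iqs iCn) (RintegralD mI iqs iCn).
rewrite (RintegralD mI iq (intbleZ mI 2 is_)) (RintegralZl 2 mI is_) (RintegralZl C mI in_).
rewrite Ss Nn => r1 r2; rewrite ler_norml; apply/andP; split; lra.
Qed.

End Variation.

(** ** Frames and their curvature *)

Section Frames.
Variables (R : realType) (L : R).
Hypothesis L0 : 0 < L.
Notation mu := (@lebesgue_measure R).
Notation I := (`]0, L[%classic : set (measurableTypeR R)).
Let mI : measurable I. Proof. exact: measurable_itv. Qed.
Let I_lty : (mu I < +oo)%E. Proof. exact: mu_itv_lty. Qed.

Lemma is_L2_cst m n (F : 'M[R]_(m, n)) : is_L2 leb `]0, L[ (fun=> F).
Proof. by move=> i j; exact: (sqint_cst mI I_lty). Qed.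

Lemma H1_cst m n (F : 'M[R]_(m, n)) : is_H1 L (fun=> F) /\
  {ae mu, forall x, I x -> wder L (fun=> F) x = 0}.
Proof.
apply: (acrep_H1 L0 (is_L2_cst F) (is_L2_cst 0)) => i j.
exists (F i j); apply: aeW => x _.
have -> : prim (fun=> (0 : 'M[R]_(m, n)) i j) x = 0.
  by rewrite /prim (_ : (fun=> _) = fun=> 0) ?Rintegral_cst ?mul0r//; apply/funext => y; rewrite mxE.
by rewrite addr0.
Qed.

Lemma H1_trmx m n (f : R -> 'M[R]_(m, n)) : is_H1 L f -> is_H1 L (fun x => (f x)^T) /\
  {ae mu, forall x, I x -> wder L (fun x => (f x)^T) x = (wder L f x)^T}.
Proof.
move=> hf; have [sw _] := H1_wder hf; have sf := H1_L2 hf.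
apply: (acrep_H1 L0).
- by move=> i j; apply: (@eq_sqint _ _ _ mu I mI (fun x => f x j i)) (sf j i) => x _; rewrite mxE.
- by move=> i j; apply: (@eq_sqint _ _ _ mu I mI (fun x => wder L f x j i)) (sw j i) => x _; rewrite mxE.
move=> i j; have := H1_acrep L0 j i hf.
rewrite (_ : (fun x => (f x)^T i j) = fun x => f x j i); last by apply/funext => x; rewrite mxE.
by rewrite (_ : (fun x => (wder L f x)^T i j) = fun x => wder L f x j i)//; apply/funext => x; rewrite mxE.
Qed.

Lemma curvature_L2 P : is_H1 L P -> {ae mu, forall x, I x -> SO3 (P x)} ->
  is_L2 leb `]0, L[ (curvature L P).
Proof.
move=> hP soP i j; have [sw _] := H1_wder hP.
apply: (@eq_sqint _ _ _ mu I mI (fun x => \sum_l P x l i * wder L P x l j)).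
  by move=> x _; rewrite /curvature trmx_mulE.
apply: (@sqint_sum _ _ _ mu I mI _ (fun l x => P x l i * wder L P x l j)) => l.
apply: (@sqint_bM _ _ _ mu I mI 1) (sw l j); first exact: (is_L2_meas l i (H1_L2 hP)).
by apply: filterS soP => x h Ix; exact: SO3_entry (h Ix).
Qed.

(** Differentiate P^T P = 1. *)
Lemma curvature_skew P : is_H1 L P -> {ae mu, forall x, I x -> SO3 (P x)} ->
  {ae mu, forall x, I x -> Defs.skew (curvature L P x)}.
Proof.
move=> hP soP; have [hT wT] := H1_trmx hP.
have [hF wF] := H1_mulmx L0 hT hP.
have e1 : {ae mu, forall x, I x -> (P x)^T *m P x = 1%:M}.
  by apply: filterS soP => x h Ix; have [] := h Ix.
have [_ w1] := @ae_eq_H1 _ _ L0 _ _ _ (fun=> 1%:M) (fun i j => measurable_cst _) e1 hF.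
have [_ w0] := H1_cst (1%:M : 'M[R]_3).
have := aeI (fun x _ => @conj _ _) w0 (aeI (fun x _ => @conj _ _) w1 (aeI (fun x _ => @conj _ _) wT wF)).
apply: filterS => x + Ix => /(_ Ix) [e0 [e2 [e3 e4]]].
move: e2; rewrite e0 e4 e3 => /esym/eqP; rewrite addr_eq0 => /eqP h.
by rewrite /Defs.skew /curvature trmx_mul trmxK h.
Qed.

End Frames.

(** ** Differentiation of the energy along a curve *)

Lemma is_derive_err (R : realType) (f err : R -> R) x d :
  (\forall k \near 0^', `|k^-1 * (f (x + k) - f x) - d| <= err k) ->
  err k @[k --> 0^'] --> (0 : R) -> is_derive x (1 : R) f d.
Proof.
move=> fe e0.
have h : (fun k : R => k^-1 *: (f (k *: (1 : R) + x) - f x)) @ 0^' --> d.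
  apply/cvgrPdist_le => e e_gt0.
  have h : \forall k \near 0^', err k <= e by exact: (cvgr_le _ e0).
  apply: filterS2 fe h => k fk ek.
  rewrite -[k *: 1]/(k * 1) mulr1 -[_ *: _]/(_ * _) distrC (addrC k).
  exact: le_trans fk ek.
split; first by apply/cvg_ex; exists d.
exact: (cvg_lim _ h).
Qed.

Section Null.
Variables (R : realType) (L : R).
Hypothesis L0 : 0 < L.
Notation mu := (@lebesgue_measure R).
Notation I := (`]0, L[%classic : set (measurableTypeR R)).
Let mI : measurable I. Proof. exact: measurable_itv. Qed.

Lemma null2_pair (g : R -> R) (e : R -> R -> R) : sqint mu I g -> null2 L e ->
  `|\int[mu]_(x in I) (g x * e k x)| @[k --> 0^'] --> (0 : R).
Proof.
move=> sg [se e0].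
have h : nsq mu I g * nsq mu I (e k) @[k --> 0^'] --> nsq mu I g * 0.
  by apply: cvgM; [exact: cvg_cst|exact: e0].
have := @cvg_comp _ _ _ _ Num.sqrt _ _ _ h (@sqrt_continuous R _).
rewrite mulr0 sqrtr0 => h2; apply: (@squeeze_cvgr _ _ _ _ (fun=> 0) _ _ _ _ _ h2).
  apply: filterS se => k sek; rewrite normr_ge0 /= -sqrtr_sqr.
  by rewrite ler_wsqrtr// CauchySchwarz.
exact: cvg_cst.
Qed.

Lemma entry_expansion (w d e a : R -> R) k : sqint mu I w -> sqint mu I d ->
  sqint mu I e -> measurable_fun I a -> {ae mu, forall x, I x -> a x = k * (d x + e x)} ->
  [/\ sqint mu I a,
   \int[mu]_(x in I) (w x * a x) =
    k * (\int[mu]_(x in I) (w x * d x) + \int[mu]_(x in I) (w x * e x)) &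
   nsq mu I a <= k ^+ 2 * (2 * (nsq mu I d + nsq mu I e))].
Proof.
move=> sw sd se ma ae.
have sk := sqintZ mI k (sqintD mI sd se).
have sa : sqint mu I a.
  by apply: (ae_eq_sqint mI ma) sk; apply: filterS ae => x h Ix; rewrite h.
split => //.
  have i1 := sqintM mI sw sd; have i2 := sqintM mI sw se.
  rewrite -(RintegralD mI i1 i2) -(RintegralZl k mI (intbleD mI i1 i2)).
  apply: (ae_eq_Rintegral mI).
  - exact: (intble_meas (sqintM mI sw sa)).
  - exact: (intble_meas (intbleZ mI k (intbleD mI i1 i2))).
  - by apply: filterS ae => x h Ix; rewrite h//; ring.
rewrite (ae_eq_nsq mI ma (sqint_meas sk) ae) (nsqZ mI k (sqintD mI sd se)).
by rewrite ler_wpM2l ?sqr_ge0// nsqD.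
Qed.

End Null.

Lemma mxdot_evec1 (R : realType) (h : 'cV[R]_3) (F : 'M[R]_3) :
  mxdot h (F *m evec R 1) = \sum_i h i 0 * F i (ix 1).
Proof.
rewrite mxdotE; apply: eq_bigr => i _; rewrite big_ord1 /evec -colE mxE.
by [].
Qed.

Lemma quotient_bound (R : realType) (k r q S e H H0 T t E C N : R) : k != 0 ->
  `|r - q - 2 * (k * (S + e))| <= C * (k ^+ 2 * N) ->
  H = H0 + k * (t + E) -> T = S + t ->
  `|k^-1 * ((2^-1 * r + H) - (2^-1 * q + H0)) - T| <= `|e| + `|E| + `|k| * (2^-1 * (C * N)).
Proof.
move=> k0 h -> ->.
have -> : k^-1 * (2^-1 * r + (H0 + k * (t + E)) - (2^-1 * q + H0)) - (S + t) =
  e + E + k^-1 * (2^-1 * (r - q - 2 * (k * (S + e)))) by field.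
apply: le_trans (ler_normD _ _) _; apply: lerD; first exact: ler_normD.
have k1 : 0 < `|k| by rewrite normr_gt0.
rewrite normrM normfV ler_pdivrMl// normrM (ger0_norm (_ : 0 <= 2^-1))//.
apply: (le_trans (ler_wpM2l _ h)) => //.
rewrite -[k ^+ 2](ger0_norm (sqr_ge0 k)) normrX le_eqVlt; apply/orP; left; apply/eqP; ring.
Qed.

Section EnergyDerivative.
Variables (R : realType) (L : R) (om : set (R * R)) (LL : {linear 'M[R]_3 -> 'M[R]_3}).
Notation mu := (@lebesgue_measure R).
Notation I := (`]0, L[%classic : set (measurableTypeR R)).
Hypothesis L0 : 0 < L.
Hypothesis oom : open om.
Hypothesis om1 : leb2 om = 1%E.
Variable rad : R.
Hypothesis om_rad : forall p, om p -> `|p.1| <= rad /\ `|p.2| <= rad.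
Hypothesis LL_sym : forall F G, mxdot (LL F) G = mxdot F (LL G).
Hypothesis LL_ge0 : forall F, 0 <= mxdot (LL F) F.
Variable W : 'M[R]_3 -> R.
Hypothesis QE : forall F, hessQ W F = mxdot (LL F) F.
Let mI : measurable I. Proof. exact: measurable_itv. Qed.
Let I_lty : (mu I < +oo)%E. Proof. exact: mu_itv_lty. Qed.

Variables (A : R -> 'M[R]_3) (beta : R -> R * R -> 'cV[R]_3) (G : R -> R * R -> 'M[R]_(3, 2)).
Hypothesis A_L2 : is_L2 leb `]0, L[ A.
Hypothesis A_skew : {ae mu, forall x, I x -> Defs.skew (A x)}.
Hypothesis bG : is_L2H1 L om beta G.
Hypothesis A_min : {ae mu, forall x, I x -> is_minimizer om (hessQ W) (A x) 0 (beta x)}.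

Variable h : R -> 'cV[R]_3.
Hypothesis h_L2 : is_L2 leb `]0, L[ h.
Variables gam dgam : R -> R -> 'M[R]_3.
Hypothesis Cg : C1_curve L gam dgam.
Hypothesis gA : {ae mu, forall x, I x -> curvature L (gam 0) x = A x}.

Notation w12 := (w12 om LL A G).
Notation w13 := (w13 om LL A G).
Notation w23 := (w23 om LL A G).
Let s12 := w12_sqint LL oom om1 om_rad A_L2 bG.
Let s13 := w13_sqint LL oom om1 om_rad A_L2 bG.
Let s23 := w23_sqint LL oom om1 om_rad A_L2 bG.

Let err i j k x := (k^-1 *: (curvature L (gam k) x - curvature L (gam 0) x)
  - dcurv L gam dgam x) i j.

Let incr k i j x := curvature L (gam k) x i j - A x i j.

Lemma incr_err k i j : k != 0 -> {ae mu, forall x, I x ->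
  incr k i j x = k * (dcurv L gam dgam x i j + err i j k x)}.
Proof.
move=> k0; apply: filterS gA => x e Ix; rewrite /incr -(e Ix).
have -> : err i j k x = k^-1 * (curvature L (gam k) x i j - curvature L (gam 0) x i j) -
    dcurv L gam dgam x i j by rewrite /err !mxE.
by field.
Qed.

Lemma incr_meas k i j : -1 < k < 1 -> measurable_fun I (incr k i j).
Proof.
move=> hk; apply: measurable_funB; first exact: (curvature_meas Cg).
exact: (is_L2_meas i j A_L2).
Qed.

Let load k := \int[mu]_(x in I) mxdot (h x) (gam k x *m evec R 1).
Let dload := \int[mu]_(x in I) mxdot (h x) (dgam 0 x *m evec R 1).

Lemma load_expansion k : k != 0 -> -1 < k < 1 -> load k = load 0 +
  k * (dload + \sum_i \int[mu]_(x in I) (h x i 0 * quot gam dgam k x i (ix 1))).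
Proof.
move=> k0 hk; rewrite /load /dload.
have C0 : -1 < (0 : R) < 1 by rewrite oppr_lt0 ltr01.
have i0 i : intble mu I (fun x => h x i 0 * gam 0 x i (ix 1)).
  exact: (sqintM mI (h_L2 i 0) (H1_L2 (gam_H1 Cg C0) i (ix 1))).
have i1 i : intble mu I (fun x => h x i 0 * dgam 0 x i (ix 1)).
  exact: (sqintM mI (h_L2 i 0) (H1_L2 (dgam0_H1 Cg) i (ix 1))).
have i2 i : intble mu I (fun x => h x i 0 * quot gam dgam k x i (ix 1)).
  have [hq _] := quot_H1 L0 Cg hk.
  exact: (sqintM mI (h_L2 i 0) (H1_L2 hq i (ix 1))).
have dot (g : R -> 'M[R]_3) : (fun x => mxdot (h x) (g x *m evec R 1)) =
    (fun x => h x (ix 1) 0 * g x (ix 1) (ix 1) + h x (ix 2) 0 * g x (ix 2) (ix 1) +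
       h x (ix 3) 0 * g x (ix 3) (ix 1)).
  by apply/funext => x; rewrite mxdot_evec1 sum3.
rewrite !dot sum3.
have ss (e : 'I_3 -> R -> R) : (forall i, intble mu I (e i)) ->
    \int[mu]_(x in I) (e (ix 1) x + e (ix 2) x + e (ix 3) x) =
    \int[mu]_(x in I) e (ix 1) x + \int[mu]_(x in I) e (ix 2) x + \int[mu]_(x in I) e (ix 3) x.
  move=> ie; rewrite (RintegralD mI (intbleD mI (ie (ix 1)) (ie (ix 2))) (ie (ix 3))).
  by rewrite (RintegralD mI (ie (ix 1)) (ie (ix 2))).
rewrite (ss (fun i x => h x i 0 * dgam 0 x i (ix 1)) i1).
rewrite (ss (fun i x => h x i 0 * gam 0 x i (ix 1)) i0).
have ik i : intble mu I (fun x => h x i 0 * gam k x i (ix 1)).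
  exact: (sqintM mI (h_L2 i 0) (H1_L2 (gam_H1 Cg hk) i (ix 1))).
rewrite (ss (fun i x => h x i 0 * gam k x i (ix 1)) ik).
have one i : \int[mu]_(x in I) (h x i 0 * gam k x i (ix 1)) =
    \int[mu]_(x in I) (h x i 0 * gam 0 x i (ix 1)) + k *
     (\int[mu]_(x in I) (h x i 0 * dgam 0 x i (ix 1)) +
      \int[mu]_(x in I) (h x i 0 * quot gam dgam k x i (ix 1))).
  rewrite -(RintegralD mI (i1 i) (i2 i)) -(RintegralZl k mI (intbleD mI (i1 i) (i2 i))).
  rewrite -(RintegralD mI (i0 i) (intbleZ mI k (intbleD mI (i1 i) (i2 i)))).
  by apply: eq_Rintegral => x _; rewrite /quot !mxE; field.
by rewrite !one; ring.
Qed.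

(** Up to the square of the increment of the curvature, the elastic energy is affine
    in this increment, so its difference quotient converges with the one of the
    curvature, and the load is linear in the frame. *)
Lemma energy_derive : is_derive (0 : R) (1 : R)
  (fun s => fine (energy_frame L om W h (gam s)))
  (\int[mu]_(x in I) (w12 x * (dcurv L gam dgam x)_{1, 2})
   + \int[mu]_(x in I) (w13 x * (dcurv L gam dgam x)_{1, 3})
   + \int[mu]_(x in I) (w23 x * (dcurv L gam dgam x)_{2, 3})
   + \int[mu]_(x in I) mxdot (h x) (dgam 0 x *m evec R 1)).
Proof.
have C0 : -1 < (0 : R) < 1 by rewrite oppr_lt0 ltr01.
have [C Cge0 hC] := elastic_expansion oom om1 om_rad LL_sym LL_ge0 QE A_L2 A_skew bG A_min.
have cL2 k : -1 < k < 1 -> is_L2 leb `]0, L[ (curvature L (gam k)).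
  by move=> hk; apply: curvature_L2; [exact: (gam_H1 Cg)|exact: (gam_SO3 Cg)].
have csk k : -1 < k < 1 -> {ae mu, forall x, I x -> Defs.skew (curvature L (gam k) x)}.
  by move=> hk; apply: (curvature_skew L0); [exact: (gam_H1 Cg)|exact: (gam_SO3 Cg)].
have sincr k i j : -1 < k < 1 -> sqint mu I (incr k i j).
  by move=> hk; exact: (sqintB mI (cL2 k hk i j) (A_L2 i j)).
have ex k (hk : -1 < k < 1) := hC (curvature L (gam k)) (csk k hk)
  (fun i j => sincr k i j hk).
have fineE k r : (\int[mu]_(x in I) Qstar om (hessQ W) (curvature L (gam k) x) 0%R)%E = r%:E ->
   fine (energy_frame L om W h (gam k)) = 2^-1 * r + load k.
  by move=> e; rewrite /energy_frame e.
set q := \int[mu]_(x in I) qA om LL A G x in ex.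
have e0 : fine (energy_frame L om W h (gam 0)) = 2^-1 * q + load 0.
  have [r0 [r0E]] := ex 0 C0.
  have z i j : {ae mu, forall x, I x -> incr 0 i j x = 0}.
    by apply: filterS gA => x e Ix; rewrite /incr -(e Ix) subrr.
  have zint (w : R -> R) i j : sqint mu I w -> \int[mu]_(x in I) (w x * incr 0 i j x) = 0.
    move=> sw; rewrite -[RHS](mul0r (fine (mu I))) -(Rintegral_cst mu mI 0).
    apply: (ae_eq_Rintegral mI); first exact: (intble_meas (sqintM mI sw (sincr 0 i j C0))).
      exact: measurable_cst.
    by apply: filterS (z i j) => x e Ix; rewrite e// mulr0.
  have znsq i j : nsq mu I (incr 0 i j) = 0.
    rewrite -[RHS](zint (incr 0 i j) i j (sincr 0 i j C0)) /nsq.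
    by apply: eq_Rintegral => x _; rewrite expr2.
  move: (zint _ (ix 1) (ix 2) s12) (zint _ (ix 1) (ix 3) s13) (zint _ (ix 2) (ix 3) s23).
  rewrite /incr => -> -> ->.
  move: (znsq (ix 1) (ix 2)) (znsq (ix 1) (ix 3)) (znsq (ix 2) (ix 3)).
  rewrite /incr => -> -> ->.
  rewrite !addr0 !mulr0 subr0 normr_le0 subr_eq0 => /eqP r0q.
  by rewrite (fineE _ _ r0E) r0q.
pose e w i j k := \int[mu]_(x in I) (w x * err i j k x).
pose N k := 2 * (nsq mu I (fun x => dcurv L gam dgam x (ix 1) (ix 2)) + nsq mu I (err (ix 1) (ix 2) k))
   + 2 * (nsq mu I (fun x => dcurv L gam dgam x (ix 1) (ix 3)) + nsq mu I (err (ix 1) (ix 3) k))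
   + 2 * (nsq mu I (fun x => dcurv L gam dgam x (ix 2) (ix 3)) + nsq mu I (err (ix 2) (ix 3) k)).
pose E k := \sum_i \int[mu]_(x in I) (h x i 0 * quot gam dgam k x i (ix 1)).
pose S k := e w12 (ix 1) (ix 2) k + e w13 (ix 1) (ix 3) k + e w23 (ix 2) (ix 3) k.
have nul i j := curvature_null L0 Cg i j.
apply: (@is_derive_err _ _ (fun k => `|S k| + `|E k| + `|k| * (2^-1 * (C * N k)))).
  have near_err : \forall k \near 0^', forall i j, sqint mu I (err i j k).
    apply: filter_forall => i; apply: filter_forall => j.
    by have [se _] := nul i j; exact: se.
  apply: filterS2 (near_small R) near_err => k [k0 hk] sek.
  have [r [rE hr]] := ex k hk.
  rewrite add0r (fineE _ _ rE) e0.
  have ee w i j (sw : sqint mu I w) := entry_expansion sw (dcurv_sqint L0 Cg i j)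
    (sek i j) (incr_meas i j hk) (incr_err i j k0).
  have [_ p12 n12] := ee _ (ix 1) (ix 2) s12.
  have [_ p13 n13] := ee _ (ix 1) (ix 3) s13.
  have [_ p23 n23] := ee _ (ix 2) (ix 3) s23.
  apply: (quotient_bound k0 _ (load_expansion k0 hk) (erefl _)).
  have -> : (\int[mu]_(x in I) (w12 x * (dcurv L gam dgam x)_{1, 2})
   + \int[mu]_(x in I) (w13 x * (dcurv L gam dgam x)_{1, 3})
   + \int[mu]_(x in I) (w23 x * (dcurv L gam dgam x)_{2, 3}) + S k) = 
     (\int[mu]_(x in I) (w12 x * (dcurv L gam dgam x)_{1, 2}) + e w12 (ix 1) (ix 2) k)
   + (\int[mu]_(x in I) (w13 x * (dcurv L gam dgam x)_{1, 3}) + e w13 (ix 1) (ix 3) k)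
   + (\int[mu]_(x in I) (w23 x * (dcurv L gam dgam x)_{2, 3}) + e w23 (ix 2) (ix 3) k).
    by rewrite /S; ring.
  rewrite 2!(mulrDr k) -p12 -p13 -p23; apply: (le_trans hr).
  rewrite ler_wpM2l// /N 2!(mulrDr (k ^+ 2)).
  by apply: lerD => //; exact: lerD.
have S0 : `|S k| @[k --> 0^'] --> (0 : R).
  apply: (@squeeze_cvgr _ _ _ _ (fun=> 0) (fun k => `|e w12 (ix 1) (ix 2) k| +
     `|e w13 (ix 1) (ix 3) k| + `|e w23 (ix 2) (ix 3) k|)); last 2 first.
  - exact: cvg_cst.
  - rewrite -[X in _ --> X](addr0 0) -[X in _ --> X + _](addr0 0).
    apply: cvgD; [apply: cvgD|].
    + exact: (null2_pair s12 (nul _ _)).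
    + exact: (null2_pair s13 (nul _ _)).
    + exact: (null2_pair s23 (nul _ _)).
  apply: nearW => k; rewrite normr_ge0 /=.
  by apply: le_trans (ler_normD _ _) _; rewrite lerD2r ler_normD.
have E0 : `|E k| @[k --> 0^'] --> (0 : R).
  pose f i k := `|\int[mu]_(x in I) (h x i 0 * quot gam dgam k x i (ix 1))|.
  apply: (@squeeze_cvgr _ _ _ _ (fun=> 0) (fun k => f (ix 1) k + f (ix 2) k + f (ix 3) k)); last 2 first.
  - exact: cvg_cst.
  - rewrite -[X in _ --> X](addr0 0) -[X in _ --> X + _](addr0 0).
    have f0 i : f i k @[k --> 0^'] --> (0 : R).
      exact: (null2_pair (h_L2 i 0) (quot_null L0 Cg i (ix 1))).
    by apply: cvgD; [apply: cvgD|]; exact: f0.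
  apply: nearW => k; rewrite normr_ge0 /= /E sum3.
  by apply: le_trans (ler_normD _ _) _; rewrite lerD2r ler_normD.
have k0 : `|k| @[k --> (0 : R)^'] --> (0 : R).
  have en : (0 : R) = `|(0 : R)| by rewrite normr0.
  rewrite [X in _ --> X]en; apply: cvg_norm.
  by apply: cvg_within_filter; exact: cvg_id.
have [l N0] : exists l : R, N k @[k --> 0^'] --> l.
  have one i j : 2 * (nsq mu I (fun x => dcurv L gam dgam x i j) + nsq mu I (err i j k))
      @[k --> 0^'] --> 2 * (nsq mu I (fun x => dcurv L gam dgam x i j) + 0).
    apply: cvgM; first exact: cvg_cst.
    by apply: cvgD; [exact: cvg_cst|have [_ h0] := nul i j; exact: h0].
  eexists; apply: cvgD; [apply: cvgD|]; exact: one.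

rewrite -[X in _ --> X](addr0 0) -[X in _ --> X + _](addr0 0).
apply: cvgD; first exact: cvgD.
rewrite -[X in _ --> X](mul0r (2^-1 * (C * l))); apply: cvgM => //.
by apply: cvgM; [exact: cvg_cst|apply: cvgM => //; exact: cvg_cst].
Qed.

End EnergyDerivative.

(** * The boundary value problems *)

Section Natural.
Variables (R : realType) (L : R).
Hypothesis L0 : 0 < L.
Notation mu := (@lebesgue_measure R).
Notation I := (`]0, L[%classic : set (measurableTypeR R)).
Let mI : measurable I. Proof. exact: measurable_itv. Qed.
Let I_lty : (mu I < +oo)%E. Proof. exact: mu_itv_lty. Qed.

Lemma C1_on_cst (c : R) : C1_on setT (fun _ : R => c).
Proof.
by apply: (@C1_onI _ _ (fun=> 0)) => x; exact: cvg_cst.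
Qed.

Lemma C1_on_id : C1_on setT (fun x : R => x).
Proof.
by apply: (@C1_onI _ _ (fun=> 1)) => x; exact: cvg_cst.
Qed.

Lemma test_fun_C1 (phi : R -> R) (U : set R) : test_fun U phi -> C1_on setT phi.
Proof. by case. Qed.

(** Test functions need not vanish at the ends: testing with 1 and with x shows that
    the integral of g and the constant of integration are zero. *)
Lemma weak_bvp_acrep w g : intble mu I w -> intble mu I g -> weak_bvp L w g 0 0 ->
  prim g L = 0 /\ {ae mu, forall x, I x -> w x = prim g x}.
Proof.
move=> iw ig bvp.
have [c wE] : acrep L w g.
  apply: (wder1_acrep L0 iw ig) => phi tphi.
  have := bvp phi (test_fun_C1 tphi); rewrite !mul0r subrr => /eqP.
  by rewrite addr_eq0 => /eqP.
have key phi : C1_on setT phi -> (c + prim g L) * phi L - c * phi 0 = 0.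
  move=> C1; rewrite -(prim_by_parts_C1 L0 c ig C1).
  have := bvp phi C1; rewrite !mul0r subrr => bvp0; rewrite -[RHS]bvp0; congr (_ + _).
  exact: esym (ae_eq_RintegralMC (intble_meas iw) (measurable_acrep c ig)
    (C1_on_continuous_derive C1) wE).
have k1 := key _ (C1_on_cst 1); have k2 := key _ C1_on_id.
have gL : prim g L = 0 by move: k1; rewrite !mulr1 addrAC subrr add0r.
have c0 : c = 0.
  by move: k2; rewrite gL addr0 mulr0 subr0 => /eqP; rewrite mulf_eq0 (gt_eqF L0) orbF => /eqP.
by split=> //; apply: filterS wE => x e Ix; rewrite e// c0 add0r.
Qed.

Lemma intble_bM (C : R) (b f : R -> R) : measurable_fun I b ->
  {ae mu, forall x, I x -> `|b x| <= C} -> intble mu I f -> intble mu I (fun x => b x * f x).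
Proof.
move=> mb bC fi; apply: (@ae_le_intble _ _ _ mu I mI _ (fun x => C * `|f x|)).
- by apply: measurable_funM => //; exact: (intble_meas fi).
- by apply: filterS bC => x h Ix; rewrite normrM ler_wpM2r// h.
- by apply: (intbleZ mI); exact: integrable_norm.
Qed.

(** Both w and b are primitives, so that this is the integration by parts of two
    absolutely continuous functions; the boundary terms vanish with w. *)
Lemma weak_bvp_test (w g b b' : R -> R) (C : R) : intble mu I w -> intble mu I g -> weak_bvp L w g 0 0 ->
  intble mu I b' -> acrep L b b' -> measurable_fun I b ->
  {ae mu, forall x, I x -> `|b x| <= C} -> intble mu I (fun x => w x * b' x) ->
  \int[mu]_(x in I) (w x * b' x) + \int[mu]_(x in I) (g x * b x) = 0.
Proof.
move=> iw ig bvp ib [c bE] mb bC iwb; have [gL wE] := weak_bvp_acrep iw ig bvp.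
have i1 := intbleM_prim ig ib; have i2 := intbleM_prim ib ig.
have -> : \int[mu]_(x in I) (w x * b' x) = \int[mu]_(x in I) (b' x * prim g x).
  apply: (ae_eq_Rintegral mI); [exact: (intble_meas iwb)|exact: (intble_meas i1)|].
  by apply: filterS wE => x e Ix; rewrite e// mulrC.
have -> : \int[mu]_(x in I) (g x * b x) =
    c * \int[mu]_(x in I) g x + \int[mu]_(x in I) (g x * prim b' x).
  rewrite -(RintegralZl c mI ig) -(RintegralD mI (intbleZ mI c ig) i2).
  apply: (ae_eq_Rintegral mI).
  - by apply: measurable_funM => //; exact: (intble_meas ig).
  - exact: (intble_meas (intbleD mI (intbleZ mI c ig) i2)).
  - by apply: filterS bE => x e Ix; rewrite e//; ring.
rewrite -/(prim g L) gL mulr0 add0r -(RintegralD mI i1 i2).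
by rewrite prim_by_parts// gL mul0r.
Qed.

End Natural.

Section FirstVariation.
Variables (R : realType) (L : R).
Hypothesis L0 : 0 < L.
Notation mu := (@lebesgue_measure R).
Notation I := (`]0, L[%classic : set (measurableTypeR R)).
Let mI : measurable I. Proof. exact: measurable_itv. Qed.
Let I_lty : (mu I < +oo)%E. Proof. exact: mu_itv_lty. Qed.

Variables (P B : R -> 'M[R]_3) (gam dgam : R -> R -> 'M[R]_3).
Hypothesis hP : is_H1 L P.
Hypothesis soP : {ae mu, forall x, I x -> SO3 (P x)}.
Hypothesis hB : is_H1 L B.
Hypothesis skB : {ae mu, forall x, I x -> Defs.skew (B x)}.
Hypothesis Cg : C1_curve L gam dgam.
Hypothesis gP : {ae mu, forall x, I x -> gam 0 x = P x}.
Hypothesis gPB : {ae mu, forall x, I x -> dgam 0 x = P x *m B x}.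

Lemma C1_curve_curvature : {ae mu, forall x, I x -> curvature L (gam 0) x = curvature L P x}.
Proof.
have C0 : -1 < (0 : R) < 1 by rewrite oppr_lt0 ltr01.
have [_ wP] := ae_eq_H1 L0 (fun i j => is_L2_meas i j (H1_L2 hP)) gP (gam_H1 Cg C0).
by apply: aeI gP wP => x Ix e1 e2; rewrite /curvature e1 e2.
Qed.

(** Along P (1 + s B + o(s)) the curvature A moves with velocity B' + AB - BA. *)
Lemma dcurv_commutator : {ae mu, forall x, I x -> dcurv L gam dgam x =
  wder L B x + (curvature L P x *m B x - B x *m curvature L P x)}.
Proof.
have C0 : -1 < (0 : R) < 1 by rewrite oppr_lt0 ltr01.
have [_ wP] := ae_eq_H1 L0 (fun i j => is_L2_meas i j (H1_L2 hP)) gP (gam_H1 Cg C0).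
have [hPB wPB] := H1_mulmx L0 hP hB.
have [_ wd] := ae_eq_H1 L0 (fun i j => is_L2_meas i j (H1_L2 (dgam0_H1 Cg)))
  (filterS (fun x (h : I x -> _) Ix => esym (h Ix)) gPB) hPB.
have H := aeI (fun x _ => @conj _ _) gP (aeI (fun x _ => @conj _ _) gPB
  (aeI (fun x _ => @conj _ _) wP (aeI (fun x _ => @conj _ _) wPB
  (aeI (fun x _ => @conj _ _) wd (aeI (fun x _ => @conj _ _) soP skB))))).
apply: filterS H => x + Ix => /(_ Ix) [e1 [e2 [e3 [e4 [e5 [[PP _] sk]]]]]].
rewrite /dcurv /curvature e1 e2 -e3 e5 e4 trmx_mul sk mulmxDr !mulmxA PP mul1mx.
by rewrite !mulNmx addrC addrAC addrC addrA addrAC addrC.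
Qed.

(** ** The Euler-Lagrange form of the derivative *)

Variables (w1 w2 w3 : R -> R) (h : R -> 'cV[R]_3).
Hypothesis sw1 : sqint mu I w1.
Hypothesis sw2 : sqint mu I w2.
Hypothesis sw3 : sqint mu I w3.
Hypothesis h_L2 : is_L2 leb `]0, L[ h.
Notation A := (curvature L P).

Definition rhs12 x := (A x)_{1, 3} * w3 x - (A x)_{2, 3} * w2 x - mxdot (h x) (col (ix 2) (P x)).
Definition rhs13 x := - (A x)_{1, 2} * w3 x + (A x)_{2, 3} * w1 x - mxdot (h x) (col (ix 3) (P x)).
Definition rhs23 x := (A x)_{1, 2} * w2 x - (A x)_{1, 3} * w1 x.

Lemma mxdot_col_intble j : intble mu I (fun x => mxdot (h x) (col j (P x))).
Proof.
apply: (@eq_intble _ _ _ mu I mI (fun x => \sum_i h x i 0 * P x i j)).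
  move=> x _; rewrite mxdotE; apply: eq_bigr => i _.
  by rewrite big_ord1 mxE.
apply: (@intble_sum _ _ _ mu I mI _ (fun i x => h x i 0 * P x i j)) => i.
exact: (sqintM mI (h_L2 i 0) (H1_L2 hP i j)).
Qed.

Let A_L2 := curvature_L2 hP soP.

Lemma rhs12_intble : intble mu I rhs12.
Proof.
apply: (intbleB mI); last exact: mxdot_col_intble.
by apply: (intbleB mI); [exact: (sqintM mI (A_L2 _ _) sw3)|exact: (sqintM mI (A_L2 _ _) sw2)].
Qed.

Lemma rhs13_intble : intble mu I rhs13.
Proof.
apply: (intbleB mI); last exact: mxdot_col_intble.
apply: (intbleD mI); last exact: (sqintM mI (A_L2 _ _) sw1).
exact: (sqintM mI (sqintN mI (A_L2 _ _)) sw3).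
Qed.

Lemma rhs23_intble : intble mu I rhs23.
Proof.
by apply: (intbleB mI); [exact: (sqintM mI (A_L2 _ _) sw2)|exact: (sqintM mI (A_L2 _ _) sw1)].
Qed.

Lemma wB_intble (w : R -> R) i j : sqint mu I w -> intble mu I (fun x => w x * wder L B x i j).
Proof. by move=> sw; have [sB _] := H1_wder hB; exact: (sqintM mI sw (sB i j)). Qed.

Lemma gB_intble (g : R -> R) i j : intble mu I g -> intble mu I (fun x => g x * B x i j).
Proof.
move=> ig; have [C _ bB] := H1_bounded L0 hB.
apply: (@eq_intble _ _ _ mu I mI (fun x => B x i j * g x)); first by move=> x _; rewrite mulrC.
exact: (intble_bM (is_L2_meas i j (H1_L2 hB)) (bB i j) ig).
Qed.

Lemma load_intble : intble mu I (fun x => mxdot (h x) (dgam 0 x *m evec R 1)).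
Proof.
apply: (@eq_intble _ _ _ mu I mI (fun x => \sum_i h x i 0 * dgam 0 x i (ix 1))).
  by move=> x _; rewrite mxdot_evec1.
apply: (@intble_sum _ _ _ mu I mI _ (fun i x => h x i 0 * dgam 0 x i (ix 1))) => i.
exact: (sqintM mI (h_L2 i 0) (H1_L2 (dgam0_H1 Cg) i (ix 1))).
Qed.

(** The bracket A B - B A is a cross product of axial vectors, and the first
    column of P B has components along the two directors only. *)
Lemma pointwise_variation (F S S' Fr : 'M[R]_3) (v : 'cV[R]_3) (x1 x2 x3 : R) :
  Defs.skew F -> Defs.skew S ->
  let dc := S' + (F *m S - S *m F) in
  x1 * dc _{1, 2} + x2 * dc _{1, 3} + x3 * dc _{2, 3} + mxdot v (Fr *m S *m evec R 1) =
  (x1 * S' _{1, 2} + (F _{1, 3} * x3 - F _{2, 3} * x2 - mxdot v (col (ix 2) Fr)) * S _{1, 2}) +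
  (x2 * S' _{1, 3} + (- F _{1, 2} * x3 + F _{2, 3} * x1 - mxdot v (col (ix 3) Fr)) * S _{1, 3}) +
  (x3 * S' _{2, 3} + (F _{1, 2} * x2 - F _{1, 3} * x1) * S _{2, 3}).
Proof.
have mul3 (M N : 'M[R]_3) i j :
    (M *m N) i j = M i (ix 1) * N (ix 1) j + M i (ix 2) * N (ix 2) j + M i (ix 3) * N (ix 3) j.
  by rewrite mxE sum3.
have add3 (M N : 'M[R]_3) i j : (M + N) i j = M i j + N i j by rewrite mxE.
have opp3 (M : 'M[R]_3) i j : (- M) i j = - M i j by rewrite mxE.
have colE (M : 'M[R]_3) j i : col j M i 0 = M i j by rewrite mxE.
move=> /skew_skew3 FE /skew_skew3 SE dc; rewrite /dc mxdot_evec1 !mxdotE !sum3 !big_ord1.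
rewrite !colE !add3 !opp3 !mul3.
set f1 := F _{1, 2} in FE *; set f2 := F _{1, 3} in FE *; set f3 := F _{2, 3} in FE *.
set s1 := S _{1, 2} in SE *; set s2 := S _{1, 3} in SE *; set s3 := S _{2, 3} in SE *.
rewrite FE SE !skew3E.
ring.
Qed.

Lemma variation_formula :
  \int[mu]_(x in I) (w1 x * (dcurv L gam dgam x)_{1, 2})
   + \int[mu]_(x in I) (w2 x * (dcurv L gam dgam x)_{1, 3})
   + \int[mu]_(x in I) (w3 x * (dcurv L gam dgam x)_{2, 3})
   + \int[mu]_(x in I) mxdot (h x) (dgam 0 x *m evec R 1) =
  (\int[mu]_(x in I) (w1 x * (wder L B x)_{1, 2}) + \int[mu]_(x in I) (rhs12 x * (B x)_{1, 2}))
   + (\int[mu]_(x in I) (w2 x * (wder L B x)_{1, 3}) + \int[mu]_(x in I) (rhs13 x * (B x)_{1, 3}))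
   + (\int[mu]_(x in I) (w3 x * (wder L B x)_{2, 3}) + \int[mu]_(x in I) (rhs23 x * (B x)_{2, 3})).
Proof.
have l1 := sqintM mI sw1 (dcurv_sqint L0 Cg (ix 1) (ix 2)).
have l2 := sqintM mI sw2 (dcurv_sqint L0 Cg (ix 1) (ix 3)).
have l3 := sqintM mI sw3 (dcurv_sqint L0 Cg (ix 2) (ix 3)).
have l4 := load_intble.
rewrite -(RintegralD mI l1 l2) -(RintegralD mI (intbleD mI l1 l2) l3).
rewrite -(RintegralD mI (intbleD mI (intbleD mI l1 l2) l3) l4).
have r1 := wB_intble (ix 1) (ix 2) sw1; have r2 := wB_intble (ix 1) (ix 3) sw2.
have r3 := wB_intble (ix 2) (ix 3) sw3.
have q1 := gB_intble (ix 1) (ix 2) rhs12_intble; have q2 := gB_intble (ix 1) (ix 3) rhs13_intble.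
have q3 := gB_intble (ix 2) (ix 3) rhs23_intble.
have p1 := intbleD mI r1 q1; have p2 := intbleD mI r2 q2; have p3 := intbleD mI r3 q3.
rewrite -(RintegralD mI r1 q1) -(RintegralD mI r2 q2) -(RintegralD mI r3 q3).
rewrite -(RintegralD mI p1 p2) -(RintegralD mI (intbleD mI p1 p2) p3).
apply: (ae_eq_Rintegral mI).
- exact: (intble_meas (intbleD mI (intbleD mI (intbleD mI l1 l2) l3) l4)).
- exact: (intble_meas (intbleD mI (intbleD mI p1 p2) p3)).
have H := aeI (fun x _ => @conj _ _) dcurv_commutator (aeI (fun x _ => @conj _ _) gPB
  (aeI (fun x _ => @conj _ _) skB (curvature_skew L0 hP soP))).
apply: filterS H => x + Ix => /(_ Ix) [e1 [e2 [e3 e4]]].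
rewrite e1 e2; exact: (pointwise_variation (wder L B x) (P x) (h x) (w1 x) (w2 x) (w3 x) e4 e3).
Qed.

Lemma variation_zero : weak_bvp L w1 rhs12 0 0 -> weak_bvp L w2 rhs13 0 0 ->
  weak_bvp L w3 rhs23 0 0 ->
  \int[mu]_(x in I) (w1 x * (dcurv L gam dgam x)_{1, 2})
   + \int[mu]_(x in I) (w2 x * (dcurv L gam dgam x)_{1, 3})
   + \int[mu]_(x in I) (w3 x * (dcurv L gam dgam x)_{2, 3})
   + \int[mu]_(x in I) mxdot (h x) (dgam 0 x *m evec R 1) = 0.
Proof.
move=> b1 b2 b3; rewrite variation_formula.
have [C _ bB] := H1_bounded L0 hB; have [sB _] := H1_wder hB.
have one w g i j : sqint mu I w -> intble mu I g -> weak_bvp L w g 0 0 ->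
    \int[mu]_(x in I) (w x * wder L B x i j) + \int[mu]_(x in I) (g x * B x i j) = 0.
  move=> sw ig bvp.
  exact: (weak_bvp_test L0 (sqint_intble1 sw) ig bvp (is_L2_intble i j sB)
    (H1_acrep L0 i j hB) (is_L2_meas i j (H1_L2 hB)) (bB i j) (wB_intble i j sw)).
rewrite (one _ _ _ _ sw1 rhs12_intble b1) (one _ _ _ _ sw2 rhs13_intble b2).
by rewrite (one _ _ _ _ sw3 rhs23_intble b3) !addr0.
Qed.

End FirstVariation.

(** * Rotations by a small variable angle *)

Section Trigonometry.
Variable R : realType.
Implicit Types f g : R -> R.

Lemma lipschitz_derive f f' a b : (forall x, is_derive x (1 : R) f (f' x)) ->
  (forall x, `|f' x| <= 1) -> `|f b - f a| <= `|b - a|.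
Proof.
move=> df f1.
have key (c d : R) : c <= d -> `|f d - f c| <= `|d - c|.
  move=> cd; have [|z _ ->] := @MVT_segment R f f' c d cd (fun x _ => df x).
    apply: derivable_within_continuous => x _; by have [] := df x.
  by rewrite normrM -[leRHS]mul1r ler_wpM2r.
by have [ab|/ltW ab] := leP a b; [exact: key|rewrite distrC (distrC b); exact: key].
Qed.

Lemma taylor_derive f f' a t : (forall x, is_derive x (1 : R) f (f' x)) ->
  (forall x y, `|f' y - f' x| <= `|y - x|) -> `|f (a + t) - f a - t * f' a| <= t ^+ 2.
Proof.
move=> df lip.
pose g x := f x - f' a * x; pose g' x := f' x - f' a * 1.
have dg x : is_derive x (1 : R) g (g' x).
  exact: (derB (df x) (derZ (f' a) (is_derive_id x (1 : R)))).
have key (c d : R) : c <= d -> (forall x, x \in `[c, d] -> `|x - a| <= `|t|) ->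
    `|g d - g c| <= `|t| * `|d - c|.
  move=> cd xa; have [|z zcd ->] := @MVT_segment R g g' c d cd (fun x _ => dg x).
    apply: derivable_within_continuous => x _; by have [] := dg x.
  rewrite normrM ler_wpM2r// /g' mulr1; exact: le_trans (lip _ _) (xa _ zcd).
have -> : f (a + t) - f a - t * f' a = g (a + t) - g a by rewrite /g; ring.
rewrite -[t ^+ 2](ger0_norm (sqr_ge0 t)) normrX expr2.
have [t0|t0] := leP 0 t.
  rewrite [X in _ <= _ * X](_ : `|t| = `|a + t - a|); last by congr `|_|; ring.
  apply: key; first by rewrite lerDl.
  move=> x; rewrite in_itv /= => /andP[x1 x2].
  by rewrite ger0_norm ?subr_ge0// ger0_norm// lerBlDl.
rewrite distrC [X in _ <= _ * X](_ : `|t| = `|a - (a + t)|); last by rewrite -normrN; congr `|_|; ring.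
apply: key; first by rewrite gerDl ltW.
move=> x; rewrite in_itv /= => /andP[x1 x2].
rewrite ler0_norm ?subr_le0// ltr0_norm//; lra.
Qed.

(** The properties of sin and of 1 - cos, the coefficients of Rodrigues' formula,
    that the estimates use; g1 and g2 are the first two derivatives of g. *)
Definition trig (g g1 g2 : R -> R) := [/\ forall x, is_derive x (1 : R) g (g1 x),
  forall x, is_derive x (1 : R) g1 (g2 x), forall x, `|g1 x| <= 1, forall x, `|g2 x| <= 1 &
  forall x y, `|g2 y - g2 x| <= `|y - x|].

Lemma trig_sin : trig (@sin R) (@cos R) (fun x => - sin x).
Proof.
split; [exact: is_derive_sin|exact: is_derive_cos|exact: cos_max| |].
  by move=> x; rewrite normrN sin_max.
move=> x y; rewrite -opprD normrN; apply: (@lipschitz_derive (@sin R) (@cos R)).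
exact: cos_max.
Qed.

Lemma trig_1cos : trig (fun x : R => 1 - cos x) (@sin R) (@cos R).
Proof.
split; [|exact: is_derive_sin|exact: sin_max|exact: cos_max|].
  move=> x; have -> : sin x = 0 - - sin x by rewrite sub0r opprK.
  exact: (derB (is_derive_cst (1 : R) x (1 : R)) (is_derive_cos x)).
move=> x y; apply: (@lipschitz_derive (@cos R) (fun x => - sin x)).
by move=> z; rewrite normrN sin_max.
Qed.

End Trigonometry.

Section C1derivative.
Variable R : realType.
Implicit Types f g : R -> R.

(** Explicit derivatives, unlike those of [C1_on], can be computed and estimated. *)
Definition C1d f f' := (forall x, is_derive x (1 : R) f (f' x)) /\ continuous f'.

Lemma derive_continuous f f' : (forall x, is_derive x (1 : R) f (f' x)) -> continuous f.
Proof.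
move=> df x; apply: differentiable_continuous; apply/derivable1_diffP.
by have [] := df x.
Qed.

Lemma C1d_continuous f f' : C1d f f' -> continuous f.
Proof. by case=> df _; exact: derive_continuous df. Qed.

Lemma C1d_eq f f1' f' : (forall x, f1' x = f' x) -> C1d f f1' -> C1d f f'.
Proof. by move=> /funext ->. Qed.

Lemma C1dD f f' g g' : C1d f f' -> C1d g g' ->
  C1d (fun x => f x + g x) (fun x => f' x + g' x).
Proof.
move=> [df cf] [dg cg]; split=> x; first exact: (derD (df x) (dg x)).
by apply: cvgD; [exact: cf|exact: cg].
Qed.

Lemma C1dM f f' g g' : C1d f f' -> C1d g g' ->
  C1d (fun x => f x * g x) (fun x => f' x * g x + f x * g' x).
Proof.
move=> hf hg; have [df cf] := hf; have [dg cg] := hg; split=> x; first exact: (derM (df x) (dg x)).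
apply: cvgD; apply: cvgM; [exact: cf|exact: (C1d_continuous hg)|
  exact: (C1d_continuous hf)|exact: cg].
Qed.

Lemma C1d_cst (c : R) : C1d (fun=> c) (fun=> 0).
Proof. by split=> x; [exact: is_derive_cst|exact: cvg_cst]. Qed.

Lemma C1dZ c f f' : C1d f f' -> C1d (fun x => c * f x) (fun x => c * f' x).
Proof.
move=> hf; by apply: C1d_eq (C1dM (C1d_cst c) hf) => x; rewrite mul0r add0r.
Qed.

Lemma C1d_comp f f' g g' : C1d f f' -> C1d g g' ->
  C1d (fun x => f (g x)) (fun x => f' (g x) * g' x).
Proof.
move=> [df cf] hg; have [dg cg] := hg; split=> x.
  exact: (@is_derive1_comp _ f g x _ _ (df (g x)) (dg x)).
apply: cvgM; last exact: cg.
by apply: continuous_comp; [exact: (C1d_continuous hg)|exact: cf].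
Qed.

Lemma lipschitz_continuous f : (forall x y, `|f y - f x| <= `|y - x|) -> continuous f.
Proof.
move=> lf x; apply/cvgrPdist_le => e e0.
have h : \forall y \near x, `|x - y| <= e by apply/(nbhs_ballP _ _).2; exists e => //= y; rewrite /ball /= => /ltW.
apply: filterS h => y h.
by rewrite distrC; apply: le_trans (lf x y) _; rewrite distrC.
Qed.

Lemma C1_on_C1d phi : C1_on setT phi -> C1d phi (derive1 phi).
Proof. by move=> C1; split; [exact: C1_on_derive|exact: C1_on_continuous_derive]. Qed.

Lemma C1d_C1_on f f' : C1d f f' -> C1_on setT f.
Proof. by case=> df cf; exact: C1_onI df cf. Qed.

Lemma trig_C1d (g g1 g2 : R -> R) : trig g g1 g2 -> C1d g g1 /\ C1d g1 g2.
Proof.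
case=> dg dg1 _ _ l2; split; split => //; first exact: derive_continuous dg1.
exact: lipschitz_continuous.
Qed.

(** ** Chords of a rotation with variable angle *)

Variables (g g1 g2 phi dphi : R -> R).
Hypothesis tg : trig g g1 g2.
Hypothesis hphi : C1d phi dphi.

(** The error of the difference quotient in s of g (s phi x), with its derivative in
    x; [velo] is the increment of the velocity phi g1 (s phi x). *)
Definition chord s k x := k^-1 * (g ((s + k) * phi x) - g (s * phi x)) - phi x * g1 (s * phi x).

Definition dchord s k x := dphi x * (k^-1 * (s * (g1 (s * phi x + k * phi x) - g1 (s * phi x)
    - k * phi x * g2 (s * phi x))) + (g1 (s * phi x + k * phi x) - g1 (s * phi x))).

Definition velo s k x := phi x * g1 ((s + k) * phi x) - phi x * g1 (s * phi x).

Definition dvelo s k x := dphi x * (g1 (s * phi x + k * phi x) - g1 (s * phi x)) +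
  phi x * dphi x * (s * (g2 (s * phi x + k * phi x) - g2 (s * phi x)) + k * g2 (s * phi x + k * phi x)).

Lemma angle_C1d s : C1d (fun x => g (s * phi x)) (fun x => s * (dphi x * g1 (s * phi x))).
Proof.
have [tg1 _] := trig_C1d tg.
apply: C1d_eq (C1d_comp tg1 (C1dZ s hphi)) => x; ring.
Qed.

Lemma angle_velocity_C1d s : C1d (fun x => phi x * g1 (s * phi x))
  (fun x => dphi x * g1 (s * phi x) + phi x * (s * (dphi x * g2 (s * phi x)))).
Proof.
have [_ tg2] := trig_C1d tg.
apply: C1d_eq (C1dM hphi (C1d_comp tg2 (C1dZ s hphi))) => x; ring.
Qed.

Lemma chord_C1d s k : k != 0 -> C1d (chord s k) (dchord s k).
Proof.
move=> k0.
have h := C1dD (C1dZ k^-1 (C1dD (angle_C1d (s + k)) (C1dZ (-1) (angle_C1d s))))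
  (C1dZ (-1) (angle_velocity_C1d s)).
have -> : chord s k = (fun x => k^-1 * (g ((s + k) * phi x) + -1 * g (s * phi x)) +
    -1 * (phi x * g1 (s * phi x))) by apply/funext => x; rewrite /chord !mulN1r.
apply: C1d_eq h => x; rewrite /dchord (mulrDl s k (phi x)); field.
exact: k0.
Qed.

Lemma velo_C1d s k : C1d (velo s k) (dvelo s k).
Proof.
have h := C1dD (angle_velocity_C1d (s + k)) (C1dZ (-1) (angle_velocity_C1d s)).
have -> : velo s k = (fun x => phi x * g1 ((s + k) * phi x) + -1 * (phi x * g1 (s * phi x))).
  by apply/funext => x; rewrite /velo mulN1r.
apply: C1d_eq h => x; rewrite /dvelo (mulrDl s k (phi x)); ring.
Qed.

Variables (M : R).

Lemma prod_bound (a b c d : R) : `|a| <= c -> `|b| <= d -> `|a * b| <= c * d.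
Proof. by move=> ac bd; rewrite normrM ler_pM. Qed.

Lemma sum_bound (a b c d : R) : `|a| <= c -> `|b| <= d -> `|a + b| <= c + d.
Proof. by move=> ac bd; rewrite (le_trans (ler_normD _ _))// lerD. Qed.

(** First-order Taylor expansions of g and g1 bound the errors and their derivatives
    in x by a multiple of |k|, uniformly in x. *)
Lemma chord_bounds s k x : `|s| <= 1 -> `|phi x| <= M -> `|dphi x| <= M ->
  let m := `|k| * (M ^+ 2 * (M + 2)) in
  [/\ k != 0 -> `|chord s k x| <= m, k != 0 -> `|dchord s k x| <= m,
      `|velo s k x| <= m & `|dvelo s k x| <= m].
Proof.
move=> s1 pM dM m; have [dg dg1 b1 b2 l2] := tg.
have l1 a b : `|g1 b - g1 a| <= `|b - a| by exact: (lipschitz_derive _ _ dg1 b2).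
have M0 : 0 <= M by exact: le_trans pM.
have kp : `|k * phi x| <= `|k| * M by rewrite normrM ler_wpM2l.
have kp2 : (k * phi x) ^+ 2 <= `|k| ^+ 2 * M ^+ 2.
  rewrite -(ger0_norm (sqr_ge0 (k * phi x))) normrX -exprMn ler_pXn2r ?nnegrE//.
  by rewrite mulr_ge0.
have t0 := taylor_derive (s * phi x) (k * phi x) dg l1.
have t1 := taylor_derive (s * phi x) (k * phi x) dg1 l2.
have d1 : `|g1 (s * phi x + k * phi x) - g1 (s * phi x)| <= `|k| * M.
  by apply: (le_trans (l1 _ _)); rewrite addrAC subrr add0r.
have d2 : `|g2 (s * phi x + k * phi x) - g2 (s * phi x)| <= `|k| * M.
  by apply: (le_trans (l2 _ _)); rewrite addrAC subrr add0r.
have e0 (y : R) : k != 0 -> `|y| <= (k * phi x) ^+ 2 -> `|k^-1 * y| <= `|k| * M ^+ 2.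
  rewrite -normr_gt0 => k1 hy; rewrite normrM normfV ler_pdivrMl// mulrA -expr2.
  exact: le_trans hy kp2.
have mE : m = `|k| * M ^+ 2 * (M + 2) by rewrite /m mulrA.
have kM0 : 0 <= `|k| * M ^+ 2 by rewrite mulr_ge0// sqr_ge0.
have M1 : 1 <= M + 2 by lra.
split.
- move=> k0; have -> : chord s k x = k^-1 * (g (s * phi x + k * phi x) - g (s * phi x) -
      k * phi x * g1 (s * phi x)) by rewrite /chord (mulrDl s k (phi x)); field.
  by apply: (le_trans (e0 _ k0 t0)); rewrite mE ler_peMr.
- move=> k0; rewrite /dchord; apply: (le_trans (prod_bound dM (sum_bound (d := `|k| * M) (c := `|k| * M ^+ 2) _ d1))).
    rewrite mulrCA -[leRHS]mul1r; exact: prod_bound s1 (e0 _ k0 t1).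
  rewrite mE; apply: (@le_trans _ _ (`|k| * M ^+ 2 * (M + 1))).
    by rewrite le_eqVlt; apply/orP; left; apply/eqP; ring.
  by rewrite ler_wpM2l// lerD2l; lra.
- rewrite /velo -mulrBr (mulrDl s k (phi x)); apply: (le_trans (prod_bound pM d1)).
  rewrite mE mulrCA -expr2; exact: ler_peMr.
- rewrite /dvelo; apply: (le_trans (sum_bound (prod_bound dM d1)
    (prod_bound (prod_bound pM dM) (sum_bound (prod_bound s1 d2)
      (prod_bound (lexx `|k|) (b2 _)))))).
  by rewrite mE le_eqVlt; apply/orP; left; apply/eqP; ring.
Qed.

End C1derivative.

(** * Spinning a frame *)

Section FrameCurves.
Variables (R : realType) (L : R).
Hypothesis L0 : 0 < L.
Notation mu := (@lebesgue_measure R).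
Notation I := (`]0, L[%classic : set (measurableTypeR R)).
Let mI : measurable I. Proof. exact: measurable_itv. Qed.
Let I_lty : (mu I < +oo)%E. Proof. exact: mu_itv_lty. Qed.

Lemma continuous_sqint (f : R -> R) : continuous f -> sqint mu I f.
Proof.
move=> cf; have [K _ fK] := continuous_bounded L0 cf.
apply: (@bounded_sqint _ _ _ mu I mI I_lty K f (@measurable_continuous _ L f cf)).
by apply: aeW => x; rewrite /= in_itv /= => /andP[/ltW x0 /ltW xL]; rewrite fK// x0.
Qed.

Lemma C1d_H1 m n (E E' : R -> 'M[R]_(m, n)) :
  (forall i j, C1d (fun x => E x i j) (fun x => E' x i j)) ->
  is_H1 L E /\ {ae mu, forall x, I x -> wder L E x = E' x}.
Proof.
move=> hE; apply: (acrep_H1 L0).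
- by move=> i j; apply: continuous_sqint; exact: (C1d_continuous (hE i j)).
- by move=> i j; apply: continuous_sqint; have [_] := hE i j.
move=> i j; exists (E 0 i j); apply: aeW => x; rewrite /= in_itv /= => /andP[/ltW x0 _].
rewrite (C1_prim (C1d_C1_on (hE i j)) x0).
have -> // : derive1 (fun x => E x i j) = (fun x => E' x i j).
by apply/funext => y; have [d _] := hE i j; exact: (derive1_val (d y)).
Qed.

Lemma sqint_norm (f : R -> R) : sqint mu I f -> sqint mu I (fun x => `|f x|).
Proof.
move=> sf; apply: (ae_le_sqint mI _ _ sf).
  by apply: measurableT_comp => //; exact: (sqint_meas sf).
by apply: aeW => x _; rewrite normr_id.
Qed.

Lemma nsq_le (f g : R -> R) c : measurable_fun I f -> sqint mu I g ->
  {ae mu, forall x, I x -> `|f x| <= c * g x} -> nsq mu I f <= c ^+ 2 * nsq mu I g.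
Proof.
move=> mf sg fg.
have sf : sqint mu I f.
  apply: (ae_le_sqint mI mf _ (sqintZ mI c sg)); apply: filterS fg => x h Ix.
  exact: le_trans (h Ix) (ler_norm _).
rewrite -(nsqZ mI c sg); apply: (ae_le_Rintegral mI (sqint_intble2 sf)
  (sqint_intble2 (sqintZ mI c sg))); apply: filterS fg => x h Ix.
rewrite -(real_normK (num_real (f x))) ler_pXn2r ?nnegrE//; first exact: h.
exact: le_trans (h Ix).
Qed.

(** Reduces convergence in H^1 of the curves below to uniform estimates on smooth
    coefficients. *)
Lemma H1norm_mulmx_le (P : R -> 'M[R]_3) : is_H1 L P -> exists2 C, 0 <= C &
  forall (E E' : R -> 'M[R]_3) m, 0 <= m ->
  (forall i j, C1d (fun x => E x i j) (fun x => E' x i j)) ->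
  (forall x, I x -> forall i j, `|E x i j| <= m /\ `|E' x i j| <= m) ->
  H1norm L (fun x => P x *m E x) <= m * C.
Proof.
move=> hP; have [sW _] := H1_wder hP; have sP := H1_L2 hP.
pose p i x := \sum_l `|P x i l|.
pose q i x := \sum_l `|wder L P x i l| + p i x.
have sp i : sqint mu I (p i).
  by apply: (@sqint_sum _ _ _ mu I mI _ (fun l x => `|P x i l|)) => l; exact: sqint_norm (sP i l).
have sq i : sqint mu I (q i).
  apply: (sqintD mI) (sp i).
  by apply: (@sqint_sum _ _ _ mu I mI _ (fun l x => `|wder L P x i l|)) => l; exact: sqint_norm (sW i l).
pose C2 : R := \sum_(i < 3) \sum_(j < 3) (nsq mu I (p i) + nsq mu I (q i)).
have C20 : 0 <= C2.
  by apply: sumr_ge0 => i _; apply: sumr_ge0 => j _; rewrite addr_ge0 ?nsq_ge0.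
exists (Num.sqrt C2); first exact: sqrtr_ge0.
move=> E E' m m0 hE bE; have [h1E wE] := C1d_H1 hE.
have [hPE wPE] := H1_mulmx L0 hP h1E.
rewrite (H1normE hPE) -[m](ger0_norm m0) -sqrtr_sqr -sqrtrM ?sqr_ge0//.
rewrite ler_wsqrtr// /H1sq /C2 mulr_sumr; apply: ler_sum => i _.
rewrite mulr_sumr; apply: ler_sum => j _; rewrite mulrDr; apply: lerD.
  apply: nsq_le (sp i) _; first exact: (is_L2_meas i j (H1_L2 hPE)).
  apply: aeW => x Ix; rewrite mxE; apply: (le_trans (ler_norm_sum _ _ _)).
  rewrite /p mulr_sumr; apply: ler_sum => l _; rewrite normrM mulrC ler_wpM2r//.
  by have [] := bE x Ix l j.
have [sPE _] := H1_wder hPE.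
apply: nsq_le (sq i) _; first exact: (is_L2_meas i j sPE).
apply: aeI wPE wE => x Ix -> ->; rewrite 3!mxE /q /p -!big_split mulr_sumr /=.
apply: (le_trans (ler_norm_sum _ _ _)); apply: ler_sum => l _.
rewrite mulrDr; apply: (le_trans (ler_normD _ _)); apply: lerD; rewrite normrM mulrC ler_wpM2r//.
  by have [] := bE x Ix l j.
by have [] := bE x Ix l j.
Qed.

(** ** Rotations about a fixed axis *)

Section Rotation.
Variables K N : 'M[R]_3.
Hypothesis KT : K^T = - K.
Hypothesis KK : K *m K = N.
Hypothesis KN : K *m N = - K.

Let NK : N *m K = - K. Proof. by rewrite -KK -mulmxA KK. Qed.
Let NN : N *m N = - N. Proof. by rewrite -{1}KK -mulmxA KN mulmxN KK. Qed.
Let NT : N^T = N. Proof. by rewrite -KK trmx_mul KT mulmxN mulNmx opprK. Qed.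

Definition rotexp (x y : R) : 'M[R]_3 := 1%:M + x *: K + y *: N.

Lemma rotexpM x y x' y' : rotexp x y *m rotexp x' y' =
  rotexp (x + x' - x * y' - y * x') (y + y' + x * x' - y * y').
Proof.
rewrite /rotexp !mulmxDl !mulmxDr !mul1mx !mulmx1 -!scalemxAl -!scalemxAr KK KN NK NN !scalerA.
apply/matrixP => i j; rewrite !mxE; ring.
Qed.

(** Rodrigues' formula for the rotation of angle t about the axis of K. *)
Definition rot (t : R) : 'M[R]_3 := rotexp (sin t) (1 - cos t).

Lemma rot_orth t : (rot t)^T *m rot t = 1%:M.
Proof.
have -> : (rot t)^T = rotexp (- sin t) (1 - cos t).
  by rewrite /rot /rotexp !linearD /= !linearZ /= trmx1 KT NT scalerN scaleNr.
rewrite /rot rotexpM.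
have -> : - sin t + sin t - - sin t * (1 - cos t) - (1 - cos t) * sin t = 0 by ring.
have -> : 1 - cos t + (1 - cos t) + - sin t * sin t - (1 - cos t) * (1 - cos t) =
  1 - (cos t ^+ 2 + sin t ^+ 2) by ring.
by rewrite cos2Dsin2 subrr /rotexp !scale0r !addr0.
Qed.

Lemma rot_double t : rot (t + t) = rot t *m rot t.
Proof.
rewrite /rot rotexpM sinD cosD; congr rotexp; first by ring.
have := cos2Dsin2 t; rewrite !expr2 => h.
apply/eqP; rewrite -subr_eq0; apply/eqP.
have -> : 1 - (cos t * cos t - sin t * sin t) - (1 - cos t + (1 - cos t) + sin t * sin t -
  (1 - cos t) * (1 - cos t)) = 0 by ring.
by [].
Qed.

(** The determinant is a square, since a rotation is the square of the rotation by
    half the angle, which has determinant 1 or -1. *)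
Lemma rot_SO3 t : SO3 (rot t).
Proof.
split; first exact: rot_orth.
have -> : t = t / 2 + t / 2 by rewrite -splitr.
rewrite rot_double det_mulmx; have := congr1 determinant (rot_orth (t / 2)).
by rewrite det_mulmx det_tr det1.
Qed.

Lemma SO3M (F G : 'M[R]_3) : SO3 F -> SO3 G -> SO3 (F *m G).
Proof.
move=> [F1 F2] [G1 G2]; split; last by rewrite det_mulmx F2 G2 mulr1.
by rewrite trmx_mul mulmxA -(mulmxA G^T) F1 mulmx1.
Qed.

Variables (P : R -> 'M[R]_3) (phi : R -> R).
Hypothesis hP : is_H1 L P.
Hypothesis soP : {ae mu, forall x, I x -> SO3 (P x)}.
Hypothesis hphi : C1_on setT phi.

Definition spin (s x : R) : 'M[R]_3 := P x *m rot (s * phi x).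
Definition dspin (s x : R) : 'M[R]_3 :=
  P x *m ((phi x * cos (s * phi x)) *: K + (phi x * sin (s * phi x)) *: N).

Let Cphi := C1_on_C1d hphi.

Lemma comb_C1d (c : R) (F : 'M[R]_3) e1 e1' e2 e2' : C1d e1 e1' -> C1d e2 e2' -> forall i j,
  C1d (fun x => (c *: F + e1 x *: K + e2 x *: N) i j) (fun x => (e1' x *: K + e2' x *: N) i j).
Proof.
move=> h1 h2 i j.
have h := C1dD (C1dD (C1d_cst ((c *: F) i j)) (C1dZ (K i j) h1)) (C1dZ (N i j) h2).
have -> : (fun x => (c *: F + e1 x *: K + e2 x *: N) i j) =
    (fun x => (c *: F) i j + K i j * e1 x + N i j * e2 x).
  by apply/funext => x; rewrite [LHS]mxE [X in X + _]mxE [(e1 x *: K) i j]mxE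
    [(e2 x *: N) i j]mxE (mulrC (e1 x)) (mulrC (e2 x)).
by apply: C1d_eq h => x; rewrite add0r !mxE mulrC (mulrC (N i j)).
Qed.

Lemma comb0_C1d e1 e1' e2 e2' : C1d e1 e1' -> C1d e2 e2' -> forall i j,
  C1d (fun x => (e1 x *: K + e2 x *: N) i j) (fun x => (e1' x *: K + e2' x *: N) i j).
Proof.
move=> h1 h2 i j; have := comb_C1d 0 0 h1 h2 i j.
by under eq_fun do rewrite scale0r add0r.
Qed.

Lemma spin_H1 s : is_H1 L (spin s).
Proof.
have h := comb_C1d 1 1%:M (angle_C1d (trig_sin R) Cphi s) (angle_C1d (trig_1cos R) Cphi s).
have [h1 _] := C1d_H1 h.
have -> : spin s = (fun x => P x *m (1 *: 1%:M + sin (s * phi x) *: K + (1 - cos (s * phi x)) *: N)).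
  by apply/funext => x; rewrite scale1r.
by have [] := H1_mulmx L0 hP h1.
Qed.

Lemma dspin_H1 s : is_H1 L (dspin s).
Proof.
have h := comb0_C1d (angle_velocity_C1d (trig_sin R) Cphi s) (angle_velocity_C1d (trig_1cos R) Cphi s).
have [h1 _] := C1d_H1 h.
by have [] := H1_mulmx L0 hP h1.
Qed.

Lemma spin_SO3 s : {ae mu, forall x, I x -> SO3 (spin s x)}.
Proof. by apply: filterS soP => x h Ix; apply: SO3M (h Ix) (rot_SO3 _). Qed.

Lemma H1norm_ge0 m n (f : R -> 'M[R]_(m, n)) : 0 <= H1norm L f.
Proof. exact: sqrtr_ge0. Qed.

Lemma spin_bounds : exists2 C, 0 <= C & forall s k, `|s| <= 1 ->
  (k != 0 -> H1norm L (fun x => k^-1 *: (spin (s + k) x - spin s x) - dspin s x) <= `|k| * C) /\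
  H1norm L (fun x => dspin (s + k) x - dspin s x) <= `|k| * C.
Proof.
have [C C0 hC] := H1norm_mulmx_le hP.
have [M1 M10 bM1] := continuous_bounded L0 (C1_on_continuous hphi).
have [M2 M20 bM2] := continuous_bounded L0 (C1_on_continuous_derive hphi).
pose M := M1 + M2; pose kap := \sum_i \sum_j (`|K i j| + `|N i j|).
have kap_ge i j : `|K i j| + `|N i j| <= kap.
  rewrite /kap (bigD1 i) //= (bigD1 j) //= -addrA lerDl addr_ge0//.
    by apply: sumr_ge0 => l _; rewrite addr_ge0.
  by apply: sumr_ge0 => l _; apply: sumr_ge0 => l' _; rewrite addr_ge0.
have kap0 : 0 <= kap by apply: le_trans (kap_ge (ix 1) (ix 1)); rewrite addr_ge0.
have M0 : 0 <= M by rewrite addr_ge0 ?ltW.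
have mul (e1 e2 m : R) i j : 0 <= m -> `|e1| <= m -> `|e2| <= m ->
    `|(e1 *: K + e2 *: N) i j| <= m * kap.
  move=> m0 h1 h2; rewrite !mxE; apply: (le_trans (ler_normD _ _)).
  rewrite !normrM; apply: (le_trans _ (ler_wpM2l m0 (kap_ge i j))); rewrite mulrDr.
  by apply: lerD; rewrite ler_wpM2r.
pose B := M ^+ 2 * (M + 2).
have B0 : 0 <= B by rewrite mulr_ge0 ?sqr_ge0// addr_ge0.
exists (B * kap * C); first exact: mulr_ge0 (mulr_ge0 B0 kap0) C0.
move=> s k s1.
have bphi x : I x -> `|phi x| <= M /\ `|derive1 phi x| <= M.
  rewrite /= in_itv /= => /andP[/ltW x0 /ltW xL]; have xI : 0 <= x <= L by rewrite x0.
  by rewrite (le_trans (bM1 x xI)) ?(le_trans (bM2 x xI)) ?lerDl ?lerDr ?ltW.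
have bs x (Ix : I x) := chord_bounds (trig_sin R) k s1 (proj1 (bphi x Ix)) (proj2 (bphi x Ix)).
have bc x (Ix : I x) := chord_bounds (trig_1cos R) k s1 (proj1 (bphi x Ix)) (proj2 (bphi x Ix)).
have kB0 : 0 <= `|k| * B by rewrite mulr_ge0.
have -> : `|k| * (B * kap * C) = `|k| * B * kap * C by rewrite !mulrA.
have kBk0 : 0 <= `|k| * B * kap by rewrite mulr_ge0.
split.
  move=> k0.
  have h := hC _ _ (`|k| * B * kap) kBk0 (comb0_C1d (chord_C1d (trig_sin R) Cphi s k0) (chord_C1d (trig_1cos R) Cphi s k0)).
  apply: le_trans (h _); last first.
    move=> x Ix i j; have [/(_ k0) u1 /(_ k0) u2 _ _] := bs x Ix.
    have [/(_ k0) v1 /(_ k0) v2 _ _] := bc x Ix.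
    by split; apply: mul.
  rewrite le_eqVlt; apply/orP; left; apply/eqP; congr (H1norm L _); apply/funext => x.
  rewrite /spin /dspin -mulmxBr scalemxAr -mulmxBr; congr (_ *m _).
  by apply/matrixP => i j; rewrite /rot /rotexp /chord !mxE; ring.
have h := hC _ _ (`|k| * B * kap) kBk0 (comb0_C1d (velo_C1d (trig_sin R) Cphi s k) (velo_C1d (trig_1cos R) Cphi s k)).
apply: le_trans (h _); last first.
  move=> x Ix i j; have [_ _ u1 u2] := bs x Ix; have [_ _ v1 v2] := bc x Ix.
  by split; apply: mul.
rewrite le_eqVlt; apply/orP; left; apply/eqP; congr (H1norm L _); apply/funext => x.
rewrite /dspin -mulmxBr; congr (_ *m _).
by apply/matrixP => i j; rewrite /velo !mxE; ring.
Qed.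

Lemma spin_C1_curve : C1_curve L spin dspin.
Proof.
have [C C0 hC] := spin_bounds.
move=> s /andP[s1 s2].
have sn : `|s| <= 1 by rewrite ler_norml !ltW.
split; [exact: spin_H1|exact: spin_SO3|exact: dspin_H1| |].
- apply: (@squeeze_cvgr _ _ _ _ (fun=> 0) (fun k => `|k| * C)).
  + have h : \forall k \near (0 : R)^', k != 0 by exact: nbhs_dnbhs_neq.
    apply: filterS h => k k0; rewrite H1norm_ge0 /=.
    by have [hk _] := hC s k sn; exact: hk.
  + exact: cvg_cst.
  + have en : (0 : R) = `|(0 : R)| * C by rewrite normr0 mul0r.
    rewrite [X in _ --> X]en.
    apply: cvgM; last exact: cvg_cst.
    by apply: cvg_norm; apply: cvg_within_filter; exact: cvg_id.
- apply: (@squeeze_cvgr _ _ _ _ (fun=> 0) (fun k => `|k| * C)).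
  + apply: nearW => k; rewrite H1norm_ge0 /=.
    by have [_ hk] := hC s k sn.
  + exact: cvg_cst.
  + have en : (0 : R) = `|(0 : R)| * C by rewrite normr0 mul0r.
    rewrite [X in _ --> X]en.
    apply: cvgM; last exact: cvg_cst.
    by apply: cvg_norm; exact: cvg_id.
Qed.

Lemma spin0 x : spin 0 x = P x.
Proof. by rewrite /spin /rot /rotexp mul0r sin0 cos0 subrr !scale0r !addr0 mulmx1. Qed.

Lemma dspin0 x : dspin 0 x = P x *m (phi x *: K).
Proof. by rewrite /dspin mul0r sin0 cos0 mulr1 mulr0 scale0r addr0. Qed.

End Rotation.

(** The axial vector of [skew3 a b c] is a unit vector, up to signs: this is the
    normalisation in Rodrigues' formula. *)
Lemma skew3_cube a b c : a ^+ 2 + b ^+ 2 + c ^+ 2 = 1 ->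
  skew3 a b c *m (skew3 a b c *m skew3 a b c) = - skew3 a b c :> 'M[R]_3.
Proof.
move=> h; have mul3 (M N : 'M[R]_3) i j :
    (M *m N) i j = M i (ix 1) * N (ix 1) j + M i (ix 2) * N (ix 2) j + M i (ix 3) * N (ix 3) j.
  by rewrite mxE sum3.
have opp3 (M : 'M[R]_3) i j : (- M) i j = - (a ^+ 2 + b ^+ 2 + c ^+ 2) * M i j.
  by rewrite h mxE mulN1r.
by apply: matrix3P => i; case: (ord3_cases i) => ->; rewrite opp3 !mul3 !skew3E; ring.
Qed.

End FrameCurves.

(** * Stationary points *)

Section Setting.
Variables (R : realType) (L : R).
Hypothesis L0 : 0 < L.
Notation mu := (@lebesgue_measure R).
Notation I := (`]0, L[%classic : set (measurableTypeR R)).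
Let mI : measurable I. Proof. exact: measurable_itv. Qed.
Let I_lty : (mu I < +oo)%E. Proof. exact: mu_itv_lty. Qed.

Lemma bounded_radius (om : set (R * R)) : bounded_set om ->
  exists rad : R, forall p, om p -> `|p.1| <= rad /\ `|p.2| <= rad.
Proof.
move=> bom; have [r [_ hr]] := bom; exists (r + 1) => p omp.
have : `|p| <= r + 1 by apply: (hr (r + 1)) => //; rewrite ltrDl ltr01.
by rewrite prod_normE /= ge_max => /andP[].
Qed.

Lemma catmx_H1 (a : R -> 'cV[R]_3) (D : R -> 'M[R]_(3, 2)) : is_H1 L a -> is_H1 L D ->
  is_H1 L (fun x => catmx (a x) (D x)).
Proof.
move=> ha hD; have [sa _] := H1_wder ha; have [sD _] := H1_wder hD.
have L2 (b : R -> 'cV[R]_3) (E : R -> 'M[R]_(3, 2)) : is_L2 leb `]0, L[ b ->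
    is_L2 leb `]0, L[ E -> is_L2 leb `]0, L[ (fun x => catmx (b x) (E x)).
  move=> sb sE i j; case: (ord3_cases j) => ->.
  - by apply: (@eq_sqint _ _ _ mu I mI (fun x => b x i 0)) (sb i 0) => x _; rewrite catE.
  - by apply: (@eq_sqint _ _ _ mu I mI (fun x => E x i 0)) (sE i 0) => x _; rewrite catE.
  - by apply: (@eq_sqint _ _ _ mu I mI (fun x => E x i 1)) (sE i 1) => x _; rewrite catE.
have [] // := acrep_H1 L0 (L2 _ _ (H1_L2 ha) (H1_L2 hD)) (L2 _ _ sa sD).
move=> i j; case: (ord3_cases j) => ->.
- under eq_fun do rewrite catE; under [X in acrep _ _ X]eq_fun do rewrite catE.
  exact: H1_acrep.
- under eq_fun do rewrite catE; under [X in acrep _ _ X]eq_fun do rewrite catE.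
  exact: H1_acrep.
- under eq_fun do rewrite catE; under [X in acrep _ _ X]eq_fun do rewrite catE.
  exact: H1_acrep.
Qed.

Lemma primitive_L2 (f : R -> 'cV[R]_3) : is_L2 leb `]0, L[ f ->
  is_L2 leb `]0, L[ (primitive f).
Proof.
move=> sf i j; have ifi : intble mu I (fun x => f x i 0) := is_L2_intble i 0 sf.
apply: (@eq_sqint _ _ _ mu I mI (prim (fun x => f x i 0))).
  by move=> x _; rewrite mxE.
apply: (@bounded_sqint _ _ _ mu I mI I_lty _ _ (measurable_prim ifi)).
apply: aeW => x; rewrite /= in_itv /= => /andP[_ /ltW xL]; exact: prim_bound xL ifi.
Qed.

Lemma frame_col2 (a : 'cV[R]_3) (D : 'M[R]_(3, 2)) : col (ix 2) (catmx a D) = col 0 D.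
Proof. by apply/colP => i; rewrite [LHS]mxE [RHS]mxE catE. Qed.

Lemma frame_col3 (a : 'cV[R]_3) (D : 'M[R]_(3, 2)) : col (ix 3) (catmx a D) = col 1 D.
Proof. by apply/colP => i; rewrite [LHS]mxE [RHS]mxE catE. Qed.

End Setting.

Section Stationarity.
Variables (R : realType) (L : R) (om : set (R * R)) (LL : {linear 'M[R]_3 -> 'M[R]_3}).
Notation mu := (@lebesgue_measure R).
Notation I := (`]0, L[%classic : set (measurableTypeR R)).
Hypothesis L0 : 0 < L.
Hypothesis oom : open om.
Hypothesis om1 : leb2 om = 1%E.
Variable rad : R.
Hypothesis om_rad : forall p, om p -> `|p.1| <= rad /\ `|p.2| <= rad.
Hypothesis LL_sym : forall F G, mxdot (LL F) G = mxdot F (LL G).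
Hypothesis LL_ge0 : forall F, 0 <= mxdot (LL F) F.
Variable W : 'M[R]_3 -> R.
Hypothesis QE : forall F, hessQ W F = mxdot (LL F) F.
Let mI : measurable I. Proof. exact: measurable_itv. Qed.

Variables (P : R -> 'M[R]_3) (h : R -> 'cV[R]_3).
Variables (beta : R -> R * R -> 'cV[R]_3) (G : R -> R * R -> 'M[R]_(3, 2)).
Notation A := (curvature L P).
Hypothesis hP : is_H1 L P.
Hypothesis soP : {ae mu, forall x, I x -> SO3 (P x)}.
Hypothesis h_L2 : is_L2 leb `]0, L[ h.
Hypothesis bG : is_L2H1 L om beta G.
Hypothesis A_min : {ae mu, forall x, I x -> is_minimizer om (hessQ W) (A x) 0 (beta x)}.

Notation w12 := (w12 om LL A G).
Notation w13 := (w13 om LL A G).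
Notation w23 := (w23 om LL A G).
Let A_L2 := curvature_L2 hP soP.
Let A_skew := curvature_skew L0 hP soP.
Let s12 := w12_sqint LL oom om1 om_rad A_L2 bG.
Let s13 := w13_sqint LL oom om1 om_rad A_L2 bG.
Let s23 := w23_sqint LL oom om1 om_rad A_L2 bG.
Notation g12 := (rhs12 L P w13 w23 h).
Notation g13 := (rhs13 L P w12 w23 h).
Notation g23 := (rhs23 L P w12 w13).

Lemma bvp_stationary : weak_bvp L w12 g12 0 0 -> weak_bvp L w13 g13 0 0 ->
  weak_bvp L w23 g23 0 0 -> stationary L (energy_frame L om W h) P.
Proof.
move=> b12 b13 b23 B gam dgam hB skB Cg gP gPB.
have T0 := variation_zero L0 hP soP hB skB Cg gP gPB s12 s13 s23 h_L2 b12 b13 b23.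
have d := (energy_derive L0 oom om1 om_rad LL_sym LL_ge0 QE A_L2 A_skew bG A_min h_L2 Cg
  (C1_curve_curvature L0 hP Cg gP)).
by rewrite T0 in d.
Qed.

(** The derivative of the energy when the frame spins about the axis of
    [skew3 a b c] by the angle s phi(x). *)
Lemma stationary_spin a b c phi : stationary L (energy_frame L om W h) P ->
  a ^+ 2 + b ^+ 2 + c ^+ 2 = 1 -> C1_on setT phi ->
  a * (\int[mu]_(x in I) (w12 x * derive1 phi x) + \int[mu]_(x in I) (g12 x * phi x)) +
  b * (\int[mu]_(x in I) (w13 x * derive1 phi x) + \int[mu]_(x in I) (g13 x * phi x)) +
  c * (\int[mu]_(x in I) (w23 x * derive1 phi x) + \int[mu]_(x in I) (g23 x * phi x)) = 0.
Proof.
move=> st abc hphi; pose K := skew3 a b c; pose B x := phi x *: K.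
have C1B i j : C1d (fun x => B x i j) (fun x => (derive1 phi x *: K) i j).
  have hK := C1dZ (K i j) (C1_on_C1d hphi).
  have -> : (fun x => B x i j) = (fun x => K i j * phi x).
    by apply/funext => x; rewrite [LHS]mxE mulrC.
  by apply: C1d_eq hK => x; rewrite [RHS]mxE mulrC.
have [hB wB] := C1d_H1 L0 C1B.
have skB : {ae mu, forall x, I x -> Defs.skew (B x)}.
  by apply: aeW => x _; rewrite /Defs.skew /B linearZ /= skew3_skew scalerN.
have KT : K^T = - K := skew3_skew a b c.
have Cg := spin_C1_curve L0 KT (erefl _) (skew3_cube abc) hP soP hphi.
have gP : {ae mu, forall x, I x -> spin K (K *m K) P phi 0 x = P x}.
  by apply: aeW => x _; rewrite spin0.
have gPB : {ae mu, forall x, I x -> dspin K (K *m K) P phi 0 x = P x *m B x}.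
  by apply: aeW => x _; rewrite dspin0.
have d0 := st B _ _ hB skB Cg gP gPB.
have dT := energy_derive L0 oom om1 om_rad LL_sym LL_ge0 QE A_L2 A_skew bG A_min h_L2 Cg
  (C1_curve_curvature L0 hP Cg gP).
have T0 := esym (@derive_val _ _ _ _ _ _ _ d0); rewrite (@derive_val _ _ _ _ _ _ _ dT) in T0.
rewrite (variation_formula L0 hP soP hB skB Cg gP gPB s12 s13 s23 h_L2) in T0.
have pull (w g : R -> R) i j : sqint mu I w -> intble mu I g ->
    \int[mu]_(x in I) (w x * (wder L B x) i j) + \int[mu]_(x in I) (g x * (B x) i j) =
    K i j * (\int[mu]_(x in I) (w x * derive1 phi x) + \int[mu]_(x in I) (g x * phi x)).
  move=> sw ig; have iw := sqint_intble1 sw.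
  have i1 := intbleMC L0 iw (C1_on_continuous_derive hphi).
  have i2 := intbleMC L0 ig (C1_on_continuous hphi).
  rewrite mulrDr -(RintegralZl (K i j) mI i1) -(RintegralZl (K i j) mI i2); congr (_ + _).
    apply: (ae_eq_Rintegral mI).
    - by have [sB _] := H1_wder hB; exact: (intble_meas (sqintM mI sw (sB i j))).
    - exact: (intble_meas (intbleZ mI (K i j) i1)).
    - by apply: filterS wB => x e Ix; rewrite e// mxE; ring.
  by apply: eq_Rintegral => x _; rewrite /B mxE; ring.
move: T0; rewrite (pull _ _ _ _ s12 (rhs12_intble hP soP s13 s23 h_L2)).
rewrite (pull _ _ _ _ s13 (rhs13_intble hP soP s12 s23 h_L2)).
by rewrite (pull _ _ _ _ s23 (rhs23_intble hP soP s12 s13)) /K !skew3E => <-.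
Qed.

Lemma stationary_bvp : stationary L (energy_frame L om W h) P ->
  [/\ weak_bvp L w12 g12 0 0, weak_bvp L w13 g13 0 0 & weak_bvp L w23 g23 0 0].
Proof.
move=> st.
have axis a b c (abc : a ^+ 2 + b ^+ 2 + c ^+ 2 = 1) phi := @stationary_spin a b c phi st abc.
split=> phi hphi; rewrite !mul0r subrr.
- by rewrite -[RHS](axis 1 0 0 _ phi hphi) ?mul1r ?mul0r ?addr0// expr1n expr0n /= !addr0.
- by rewrite -[RHS](axis 0 1 0 _ phi hphi) ?mul1r ?mul0r ?addr0 ?add0r// expr1n expr0n /= addr0 add0r.
- by rewrite -[RHS](axis 0 0 1 _ phi hphi) ?mul1r ?mul0r ?add0r// expr1n expr0n /= !add0r.
Qed.

End Stationarity.

Theorem proposition4p3 (R : realType) (L : R) (om : set (R * R))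
    (W : 'M[R]_3 -> R) (LL : {linear 'M[R]_3 -> 'M[R]_3})
    (f : R -> 'cV[R]_3) (u : R -> 'cV[R]_3) (D : R -> 'M[R]_(3, 2))
    (beta : R -> R * R -> 'cV[R]_3) (G : R -> R * R -> 'M[R]_(3, 2)) :
  let h := primitive f in
  let P := frame L u D in
  let A := curvature L P in
  let M := stress LL A G in
  let Mh := moment2 om M in
  let Mc := moment3 om M in
  0 < L -> cross_section om -> energy_density W -> elasticity_tensor W LL ->
  is_L2 leb `]0, L[ f ->
  (forall i, \int[leb]_(x in `]0, L[) f x i 0 = 0) ->
  admissible L u D ->
  is_L2H1 L om beta G ->
  (\forall x \ae leb, x \in `]0, L[ -> is_minimizer om (hessQ W) (A x) 0 (beta x)) ->
  stationary L (energy_frame L om W h) P <->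
  [/\ weak_bvp L (fun x => (Mh x)_{1, 1} - (Mh x)_{2, 2})
        (fun x => (A x)_{1, 3} * ((Mc x)_{2, 1} - (Mh x)_{3, 1})
                  - (A x)_{2, 3} * ((Mc x)_{1, 1} - (Mc x)_{3, 3})
                  - mxdot (h x) (col 0 (D x))) 0 0,
      weak_bvp L (fun x => (Mc x)_{1, 1} - (Mc x)_{3, 3})
        (fun x => - (A x)_{1, 2} * ((Mc x)_{2, 1} - (Mh x)_{3, 1})
                  + (A x)_{2, 3} * ((Mh x)_{1, 1} - (Mh x)_{2, 2})
                  - mxdot (h x) (col 1 (D x))) 0 0 &
      weak_bvp L (fun x => (Mc x)_{2, 1} - (Mh x)_{3, 1})
        (fun x => (A x)_{1, 2} * ((Mc x)_{1, 1} - (Mc x)_{3, 3})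
                  - (A x)_{1, 3} * ((Mh x)_{1, 1} - (Mh x)_{2, 2})) 0 0].
Proof.
move=> h P A M Mh Mc L0 [[bom _ [oom _ _]] [om1 _ _ _]] hW [LL_sym QE] fL2 _
  [[_ hu] hD soP] bG Amin.
have [rad om_rad] := bounded_radius bom.
have LL_ge0 F : 0 <= mxdot (LL F) F by rewrite -QE; exact: hessQ_ge0.
have hP : is_H1 L P := catmx_H1 L0 hu hD.
have hL2 : is_L2 leb `]0, L[ h := primitive_L2 fL2.
have -> : (fun x => (A x)_{1, 3} * ((Mc x)_{2, 1} - (Mh x)_{3, 1})
    - (A x)_{2, 3} * ((Mc x)_{1, 1} - (Mc x)_{3, 3}) - mxdot (h x) (col 0 (D x))) =
    rhs12 L P (w13 om LL A G) (w23 om LL A G) h.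
  by apply/funext => x; rewrite /rhs12 /P /frame frame_col2.
have -> : (fun x => - (A x)_{1, 2} * ((Mc x)_{2, 1} - (Mh x)_{3, 1})
    + (A x)_{2, 3} * ((Mh x)_{1, 1} - (Mh x)_{2, 2}) - mxdot (h x) (col 1 (D x))) =
    rhs13 L P (w12 om LL A G) (w23 om LL A G) h.
  by apply/funext => x; rewrite /rhs13 /P /frame frame_col3.
split=> [st|[b12 b13 b23]].
  exact: (stationary_bvp L0 oom om1 om_rad LL_sym LL_ge0 QE hP soP hL2 bG Amin st).
exact: (bvp_stationary L0 oom om1 om_rad LL_sym LL_ge0 QE hP soP hL2 bG Amin b12 b13 b23).
Qed.
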